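(* The $C^*$-algebra $\mathcal{E}(-1)$ is isomorphic to the $C^*$-algebra of continuous matrix-functions $f:D\to M_4(\mathbb{C})$ satisfying the following boundary conditions, for all values of the variables: $$f(r_1,0,x_2,e^{i\phi},e^{i\phi_1},e^{i\phi_2})=f(r_1,0,x_2,e^{i\phi},1,e^{i\phi_2}),$$ $$f(r_1,x_1,0,e^{i\phi},e^{i\phi_1},e^{i\phi_2})=f(r_1,x_1,0,e^{i\phi},e^{i\phi_1},1),$$ $$f(1,x_1,x_2,e^{i\phi},e^{i\phi_1},e^{i\phi_2})=f(1,x_1,0,e^{i\phi},e^{i\phi_1},1)\in M_2(\mathbb{C})\otimes\mathbf{1}_2,$$ $$f(0,x_1,x_2,e^{i\phi},e^{i\phi_1},e^{i\phi_2})=f(0,x_1,x_2,1,e^{i\phi_1},e^{i\phi_2}),$$ $$\nu_2^*(\phi_2)f(r_1,x_1,\tfrac12,e^{i\phi},e^{i\phi_1},e^{i\phi_2})\nu_2(\phi_2)\in M_2(\mathbb{C})\oplus M_2(\mathbb{C}),$$ $$\nu_1^*(\phi_1,\phi_2)f(0,\tfrac12,x_2,e^{i\phi},e^{i\phi_1},e^{i\phi_2})\nu_1(\phi_1,\phi_2)\in M_2(\mathbb{C})\oplus M_2(\mathbb{C}),$$ $$U^*(r_1,x_2,\phi,\phi_1,\phi_2)f(r_1,\tfrac12,x_2,e^{i\phi},e^{i\phi_1},e^{i\phi_2})U(r_1,x_2,\phi,\phi_1,\phi_2)=f(0,\tfrac12,t,1,e^{i\phi_1},e^{i\psi}),$$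 where $t$, $\psi$ and the unitary matrix-function $U$ are as specified in the context.
   Context: $\mathcal{E}(-1)$ is the enveloping (universal) $C^*$-algebra generated by $a_1,a_2$ with relations $a_i^*a_i+a_ia_i^*=1$ ($i=1,2$), $a_1^*a_2=-a_2a_1^*$ (WCAR with two degrees of freedom). $D=\{(r_1,x_1,x_2): 0\le x_i\le\frac12,\ i=1,2,\ 0\le r_1\le1\}\times\mathbf{T}^3$, $\mathbf{T}=\{z\in\mathbb{C}:|z|=1\}$; points of $D$ are written $(r_1,x_1,x_2,e^{i\phi},e^{i\phi_1},e^{i\phi_2})$, with angles in $[0,2\pi]$. Matrix tensor products are Kronecker products, $A\otimes B=(a_{ij}B)$; $M_2(\mathbb{C})\oplus M_2(\mathbb{C})\subset M_4(\mathbb{C})$ denotes block-diagonal matrices with two $2\times 2$ blocks. With $V(\phi)=\frac{1}{\sqrt2}\begin{pmatrix} e^{i\phi/2} & -e^{i\phi/2}\\ 1&1\end{pmatrix}$, $T(x\otimes y)=y\otimes x$ on $\mathbb{C}^2\otimes\mathbb{C}^2$, $$S=\begin{pmatrix}1&0\\0&0\end{pmatrix}\otimes\begin{pmatrix}1&0\\0&1\end{pmatrix}+\begin{pmatrix}0&0\\0&1\end{pmatrix}\otimes\begin{pmatrix}0&1\\1&0\end{pmatrix},\qquad W(\phi)=(\mathbf{1}_2\otimes V(\phi))\,S\,(\mathbf{1}_2\otimes V^*(\phi)),$$ put $\nu_1(\phi_1,\phi_2)=W(\phi_2)(V(\phi_1)\otimes\mathbf{1}_2)$ and $\nu_2(\phi_2)=T(V(\phi_2)\otimes\mathbf{1}_2)$.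 Define functions $a_1,a_2:D\to M_4(\mathbb{C})$ by $$a_1=\begin{pmatrix}0&e^{i\phi_1}\sqrt{x_1}\\ \sqrt{1-x_1}&0\end{pmatrix}\otimes\mathbf{1}_2,$$ $$a_2=\sqrt{1-r_1^2}\begin{pmatrix}1&0\\0&-1\end{pmatrix}\otimes\begin{pmatrix}0&e^{i\phi_2}\sqrt{x_2}\\ \sqrt{1-x_2}&0\end{pmatrix}+r_1e^{i\phi}\begin{pmatrix}0&\sqrt{1-x_1}\\-e^{-i\phi_1}\sqrt{x_1}&0\end{pmatrix}\otimes\mathbf{1}_2.$$ Given $(r_1,x_2,\phi,\phi_1,\phi_2)$ let $$z=e^{i\phi_2}(1-r_1^2)\sqrt{x_2(1-x_2)}-\frac{r_1^2e^{i(2\phi-\phi_1)}}{2},$$ let $t\in[0,\frac12]$ be defined by $\sqrt{t(1-t)}=|z|$ and $\psi=\arg z$ (arbitrary if $z=0$). $U(r_1,x_2,\phi,\phi_1,\phi_2)$ is a unitary $4\times4$ matrix such that, for $i=1,2$, $$U^*(r_1,x_2,\phi,\phi_1,\phi_2)\,a_i(r_1,\tfrac12,x_2,e^{i\phi},e^{i\phi_1},e^{i\phi_2})\,U(r_1,x_2,\phi,\phi_1,\phi_2)=a_i(0,\tfrac12,t,1,e^{i\phi_1},e^{i\psi});$$ such a unitary exists for $0<r_1\le1$, and for $r_1=0$ one takes $U=\mathbf{1}_4$. *)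

(* Defs.v *)
From HB Require Import structures.
From mathcomp Require Import all_boot all_order all_algebra.
From mathcomp Require Import complex mxtens.
From mathcomp Require Import all_classical all_reals all_analysis.
Set Implicit Arguments.
Unset Strict Implicit.
Unset Printing Implicit Defensive.
Import Order.TTheory GRing.Theory Num.Theory numFieldNormedType.Exports.
Local Open Scope classical_set_scope.
Local Open Scope complex_scope.
Local Open Scope sesquilinear_scope.
Local Open Scope ring_scope.

(* The type ascription is what gives R[i] its norm topology: MathComp-Analysis
   puts a topology on the carrier of any numClosedFieldType, but has no
   instance for the type constructor [complex] itself. *)
Definition Cplx (R : realType) : numClosedFieldType := R[i].

Definition cabs (R : realType) (z : Cplx R) : R := complex.Re `|z|.

(** * Unital C*-algebras *)

(* Hierarchy-Builder rejects a join of [algType] with [normedModType] (such a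
   join would have to be declared before Num.NumDomain), so the norm and its
   completeness are fields.  [algType] algebras are unital and nonzero. *)
Record cstarType (R : realType) := CStarType {
  cstar_sort :> algType (Cplx R);
  star : cstar_sort -> cstar_sort;
  cnorm : cstar_sort -> R;
  starK : involutive star;
  starD : {morph star : x y / x + y};
  starZ : forall (c : Cplx R) x, star (c *: x) = c^* *: star x;
  starM : forall x y, star (x * y) = star y * star x;
  cnorm_eq0 : forall x, cnorm x = 0 -> x = 0;
  ler_cnormD : forall x y, cnorm (x + y) <= cnorm x + cnorm y;
  cnormZ : forall (c : Cplx R) x, cnorm (c *: x) = cabs c * cnorm x;
  ler_cnormM : forall x y, cnorm (x * y) <= cnorm x * cnorm y;
  cnorm_cstar : forall x, cnorm (star x * x) = cnorm x ^+ 2;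
  cnorm_complete : forall u : nat -> cstar_sort,
    (forall e : R, 0 < e -> exists N : nat, forall m n : nat,
       (N <= m)%N -> (N <= n)%N -> cnorm (u m - u n) < e) ->
    exists l : cstar_sort, (fun n => cnorm (u n - l)) @ \oo --> (0 : R)
}.
Arguments star {R c0} _.
Arguments cnorm {R c0} _.

Definition wcar (R : realType) (A : cstarType R) (a1 a2 : A) : Prop :=
  [/\ star a1 * a1 + a1 * star a1 = 1,
      star a2 * a2 + a2 * star a2 = 1 &
      star a1 * a2 = - (a2 * star a1)].

(* (E, a1, a2) is the enveloping C*-algebra of the relations [wcar], which
   determines it up to a unique *-isomorphism.  Uniqueness of the induced
   *-homomorphisms amounts to E being generated by a1 and a2. *)
Definition is_wcar_envelope (R : realType) (E : cstarType R) (a1 a2 : E)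
    : Prop :=
  wcar a1 a2 /\
  forall (A : cstarType R) (b1 b2 : A), wcar b1 b2 ->
    let induced (h : {lrmorphism E -> A}) :=
      [/\ {morph h : x / star x}, h a1 = b1 & h a2 = b2] in
    (exists h, induced h) /\
    (forall h h', induced h -> induced h' -> h =1 h').

(** * The domain D *)

Section Domain.
Variable R : realType.

(* Sets coerce to the types of their elements, with the subset topology. *)
Definition Iunit : set R := `[0, 1].
Definition Ihalf : set R := `[0, 2^-1].
Definition circle : set (Cplx R) := [set z | `|z| = 1].

Definition dom : topologicalType :=
  (Iunit * Ihalf * Ihalf * circle * circle * circle)%type.

Lemma mem_Iunit (x : R) : 0 <= x -> x <= 1 -> x \in Iunit.
Proof. by move=> x0 x1; apply/mem_set; rewrite /Iunit /= in_itv /= x0. Qed.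

Lemma mem_Ihalf (x : R) : 0 <= x -> x <= 2^-1 -> x \in Ihalf.
Proof. by move=> x0 x1; apply/mem_set; rewrite /Ihalf /= in_itv /= x0. Qed.

Definition cexp (phi : R) : Cplx R := cos phi +i* sin phi.

Lemma cexp_circle (phi : R) : cexp phi \in circle.
Proof.
by apply/mem_set; rewrite /circle /= /cexp normc_def /= cos2Dsin2 sqrtr1.
Qed.

Lemma half_ge0 : 0 <= 2^-1 :> R. Proof. by rewrite invr_ge0. Qed.

Definition unit0 : Iunit := exist _ 0 (mem_Iunit (lexx 0) ler01).
Definition unit1 : Iunit := exist _ 1 (mem_Iunit ler01 (lexx 1)).
Definition half0 : Ihalf := exist _ 0 (mem_Ihalf (lexx 0) half_ge0).
Definition half1 : Ihalf := exist _ 2^-1 (mem_Ihalf half_ge0 (lexx _)).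
Definition cis (phi : R) : circle := exist _ (cexp phi) (cexp_circle phi).

(* The point (r1, x1, x2, e^{i phi}, e^{i phi1}, e^{i phi2}). *)
Definition pt (r1 : Iunit) (x1 x2 : Ihalf) (phi phi1 phi2 : R) : dom :=
  (r1, x1, x2, cis phi, cis phi1, cis phi2).

Definition is_angle (phi : R) : Prop := 0 <= phi <= 2 * pi.

End Domain.

Arguments Iunit R _ : clear implicits.
Arguments Ihalf R _ : clear implicits.
Arguments circle R _ : clear implicits.
Arguments unit0 {R}.
Arguments unit1 {R}.
Arguments half0 {R}.
Arguments half1 {R}.

(** * Matrices *)

Section Matrices.
Variable R : realType.
Local Notation C := (Cplx R).

Definition mx2 (a b c d : C) : 'M[C]_2 :=
  \matrix_(i, j) if i == ord0 then (if j == ord0 then a else b)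
                 else (if j == ord0 then c else d).

Definition kron (A B : 'M[C]_2) : 'M[C]_4 := tensmx A B.

Definition flipT : 'M[C]_4 := \matrix_(i, j)
  (let k := @mxtens_unindex 2 2 i in
   (k.2, k.1) == @mxtens_unindex 2 2 j)%:R.

Lemma flipTE (x y : 'cV[C]_2) :
  flipT *m tensmx x y = tensmx y x :> 'M[C]_(4, 1).
Proof.
apply/matrixP=> i j; rewrite !mxE.
set k := @mxtens_unindex 2 2 i.
have flipE l : flipT i l = ((k.2, k.1) == @mxtens_unindex 2 2 l)%:R.
  by rewrite mxE.
rewrite (bigD1 (@mxtens_index 2 2 (k.2, k.1))) //= flipE mxE mxtens_indexK.
rewrite eqxx mul1r big1 ?addr0 => [|l lN].
  by rewrite mulrC; congr (_ * _); congr (fun_of_matrix _ _ _); rewrite !ord1.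
rewrite flipE; case: eqP => [e|_]; last by rewrite mul0r.
by case/eqP: lN; rewrite e mxtens_unindexK.
Qed.

Definition Vmx (phi : R) : 'M[C]_2 :=
  (Num.sqrt 2)^-1%:C *:
  mx2 (cexp (phi / 2)) (- cexp (phi / 2)) 1 1.

Definition Smx : 'M[C]_4 :=
  kron (mx2 1 0 0 0) 1%:M + kron (mx2 0 0 0 1) (mx2 0 1 1 0).

Definition Wmx (phi : R) : 'M[C]_4 :=
  kron 1%:M (Vmx phi) *m Smx *m kron 1%:M ((Vmx phi)^t*).

Definition nu1 (phi1 phi2 : R) : 'M[C]_4 :=
  Wmx phi2 *m kron (Vmx phi1) 1%:M.

Definition nu2 (phi2 : R) : 'M[C]_4 := flipT *m kron (Vmx phi2) 1%:M.

(* M_2 (+) M_2 inside M_4; the dimension 4 is read as 2 + 2. *)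
Definition in_M2M2 (M : 'M[C]_4) : Prop :=
  exists X Y : 'M[C]_2, M = block_mx X 0 0 Y.

Definition in_M2_tens1 (M : 'M[C]_4) : Prop :=
  exists X : 'M[C]_2, M = kron X 1%:M.

Definition rsqrt (x : R) : C := (Num.sqrt x)%:C.

Definition gen1 (p : dom R) : 'M[C]_4 :=
  let: (_, x1, _, _, w1, _) := p in
  kron (mx2 0 (val w1 * rsqrt (val x1)) (rsqrt (1 - val x1)) 0) 1%:M.

(* w = e^{i phi}, w1 = e^{i phi1}, w2 = e^{i phi2}. *)
Definition gen2 (p : dom R) : 'M[C]_4 :=
  let: (r1, x1, x2, w, w1, w2) := p in
  rsqrt (1 - val r1 ^+ 2) *:
    kron (mx2 1 0 0 (-1))
         (mx2 0 (val w2 * rsqrt (val x2)) (rsqrt (1 - val x2)) 0)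
  + ((val r1)%:C * val w) *:
    kron (mx2 0 (rsqrt (1 - val x1)) (- ((val w1)^* * rsqrt (val x1))) 0) 1%:M.

Definition zval (r1 : Iunit R) (x2 : Ihalf R) (phi phi1 phi2 : R) : C :=
  cexp phi2 * ((1 - val r1 ^+ 2) * Num.sqrt (val x2 * (1 - val x2)))%:C
  - (val r1 ^+ 2)%:C * cexp (2 * phi - phi1) / 2.

(* t = t(r1, x2, phi, phi1, phi2) and psi is a determination of arg z; every
   real psi qualifies when z = 0. *)
Definition is_t_psi (r1 : Iunit R) (x2 : Ihalf R) (phi phi1 phi2 : R)
    (t : Ihalf R) (psi : R) : Prop :=
  let z := zval r1 x2 phi phi1 phi2 in
  Num.sqrt (val t * (1 - val t)) = cabs z /\ z = `|z| * cexp psi.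

Definition is_intertwiner (U : Iunit R -> Ihalf R -> R -> R -> R -> 'M[C]_4)
    : Prop :=
  forall (r1 : Iunit R) (x2 : Ihalf R) (phi phi1 phi2 : R),
    is_angle phi -> is_angle phi1 -> is_angle phi2 ->
    let u := U r1 x2 phi phi1 phi2 in
    [/\ u \is unitarymx,
        r1 = unit0 -> u = 1%:M &
        forall (t : Ihalf R) (psi : R),
          is_t_psi r1 x2 phi phi1 phi2 t psi ->
          u^t* *m gen1 (pt r1 half1 x2 phi phi1 phi2) *m u
            = gen1 (pt unit0 half1 t 0 phi1 psi) /\
          u^t* *m gen2 (pt r1 half1 x2 phi phi1 phi2) *m u
            = gen2 (pt unit0 half1 t 0 phi1 psi)].

(** * The function algebra *)

(* The angle 0 stands for the point 1 of the circle. *)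
Definition boundary_conditions
    (U : Iunit R -> Ihalf R -> R -> R -> R -> 'M[C]_4)
    (f : dom R -> 'M[C]_4) : Prop :=
  forall (r1 : Iunit R) (x1 x2 : Ihalf R) (phi phi1 phi2 : R),
    is_angle phi -> is_angle phi1 -> is_angle phi2 ->
    (f (pt r1 half0 x2 phi phi1 phi2) = f (pt r1 half0 x2 phi 0 phi2)) /\
    (f (pt r1 x1 half0 phi phi1 phi2) = f (pt r1 x1 half0 phi phi1 0)) /\
    (f (pt unit1 x1 x2 phi phi1 phi2) = f (pt unit1 x1 half0 phi phi1 0)) /\
    in_M2_tens1 (f (pt unit1 x1 half0 phi phi1 0)) /\
    (f (pt unit0 x1 x2 phi phi1 phi2) = f (pt unit0 x1 x2 0 phi1 phi2)) /\
    in_M2M2 ((nu2 phi2)^t* *m f (pt r1 x1 half1 phi phi1 phi2) *m nu2 phi2) /\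
    in_M2M2 ((nu1 phi1 phi2)^t* *m f (pt unit0 half1 x2 phi phi1 phi2)
               *m nu1 phi1 phi2) /\
    (forall (t : Ihalf R) (psi : R), is_t_psi r1 x2 phi phi1 phi2 t psi ->
       (U r1 x2 phi phi1 phi2)^t* *m f (pt r1 half1 x2 phi phi1 phi2)
          *m U r1 x2 phi phi1 phi2
       = f (pt unit0 half1 t 0 phi1 psi)).

Definition boundary_algebra
    (U : Iunit R -> Ihalf R -> R -> R -> R -> 'M[C]_4)
    : set (dom R -> 'M[C]_4) :=
  [set f | continuous f /\ boundary_conditions U f].

Definition l2norm (v : 'cV[C]_4) : R :=
  Num.sqrt (\sum_i cabs (v i ord0) ^+ 2).

Definition opnorm (M : 'M[C]_4) : R :=
  sup [set l2norm (M *m v) | v in [set v : 'cV[C]_4 | l2norm v <= 1]].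

Definition supnorm (f : dom R -> 'M[C]_4) : R := sup (range (opnorm \o f)).

(* The C*-structure on B is the usual one: pointwise operations and the
   supremum norm. *)
Definition is_cstar_iso (E : cstarType R) (B : set (dom R -> 'M[C]_4))
    (h : E -> dom R -> 'M[C]_4) : Prop :=
  [/\ forall (c : C) x y p, h (c *: x + y) p = c *: h x p + h y p,
      (forall p, h 1 p = 1%:M) /\ (forall x y p, h (x * y) p = h x p *m h y p),
      forall x p, h (star x) p = (h x p)^t*,
      injective h /\ range h = B &
      forall x, supnorm (h x) = cnorm x].

End Matrices.

(* Main.v *)
Require Import Defs.
From HB Require Import structures.
From mathcomp Require Import all_boot all_order all_algebra.
From mathcomp Require Import complex mxtens.
From mathcomp Require Import all_classical all_reals all_analysis.
From mathcomp Require Import ring lra.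

(* The squares al = a1^2, be = a2^2 and the anticommutator ga = a1 a2 + a2 a1 are central in
   every C*-algebra generated by a solution of the relations, so that the enveloping algebra
   is fibred over the values of (al, be, ga).  Every boundary condition says that the value at
   one point is a unitary conjugate of the value at another (possibly the same) point.  Each
   fibre of D contains exactly one normalised point, whose value determines the values on the
   whole fibre, and the generators produce every value permitted at that point; hence the
   *-algebra generated by the two sections gen1 and gen2 is dense in the function algebra B,
   by Machado's theorem.

   It remains to show that B has the universal property, that is, ||P(a1, a2)|| in an
   arbitrary C*-algebra A is at most ||P(gen1, gen2)|| in B.  Consider both evaluations in
   A x B.  Over the central subring Z generated by al, be, ga and their adjoints, the algebra
   is spanned by the 16 monomials in a1, a1^*, a2, a2^*.  If h is self-adjoint and l > ||h||_B,
   then right multiplication by l - h has a matrix over Z, whose determinant d is bounded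
   away from 0 on D because its eigenvalues at a generic point are those of l - h.  If d were
   not invertible in A, the Positivstellensatz for the archimedean preorder of the elements of
   Z that are positive in A would give a character chi of Z with chi(d) = 0, nonnegative on
   that preorder.  Since (l a1 + m a2 + adjoint)^2 lies in Z and is positive, chi satisfies the
   inequalities that characterise the values of (al, be, ga) at points of D; so chi is a point
   of D, a contradiction.  Hence l - h is invertible in A for all l > ||h||_B. *)

Set Implicit Arguments.
Unset Strict Implicit.
Unset Printing Implicit Defensive.
Import Order.TTheory GRing.Theory Num.Theory numFieldNormedType.Exports.
Local Open Scope classical_set_scope.
Local Open Scope complex_scope.
Local Open Scope sesquilinear_scope.
Local Open Scope ring_scope.

(** No ideals, states or representations of A are used. Positivity in A is obtained from norm
    estimates: square roots come from a contraction, and an upper bound of the spectrum of h is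
    expressed by the invertibility of every l - h with l above it. The factor B of A x B records the
    same polynomial in gen1 and gen2, and its points turn the elements of Z into complex numbers.
    The preorder sees only A and the determinant bound only B; they meet because a character of Z
    that respects adjoints is fixed by its values on al, be and ga. The lower bound on D concerns
    |d|, whereas the preorder consists of self-adjoint elements, so the Positivstellensatz is
    applied to d^* d. Only where r1 < 1, x1 < 1/2 and x2 < 1/2 do the monomials take linearly
    independent values in M_4; the bound reaches the other points of D by continuity. The
    inequalities for (al, be, ga) come from minimising over l the nonnegative quadratic form given
    by the squares; if 4 |al|^2 = 1 the form degenerates and forces ga = 0. *)

Lemma addlKB (V : zmodType) (z x y : V) : (z + x) - (z + y) = x - y.
Proof. by rewrite opprD addrACA subrr add0r. Qed.

(** * Complex scalars and their absolute value *)

Section Scalars.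
Variable R : realType.
Local Notation C := (Cplx R).
Implicit Types (x y : R) (c d : C).

Lemma realcD x y : (x + y)%:C = x%:C + y%:C :> C.
Proof. exact: rmorphD. Qed.

Lemma realcN x : (- x)%:C = - x%:C :> C.
Proof. exact: rmorphN. Qed.

Lemma realcB x y : (x - y)%:C = x%:C - y%:C :> C.
Proof. exact: rmorphB. Qed.

Lemma realcM x y : (x * y)%:C = x%:C * y%:C :> C.
Proof. exact: rmorphM. Qed.

Lemma realcV x : x^-1%:C = x%:C^-1 :> C.
Proof. exact: fmorphV. Qed.

Lemma realcX x n : (x ^+ n)%:C = x%:C ^+ n :> C.
Proof. exact: rmorphXn. Qed.

Lemma conj_realc x : (x%:C : C)^* = x%:C.
Proof. exact: conjc_real. Qed.

Lemma realc_eq0 x : (x%:C == 0 :> C) = (x == 0).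
Proof. exact: (fmorph_eq0 (real_complex R)). Qed.

Lemma cabsE c : (cabs c)%:C = `|c|.
Proof. by rewrite /cabs RRe_real // normr_real. Qed.

Lemma cabs_ge0 c : 0 <= cabs c.
Proof. by rewrite -lecR cabsE; exact: (@normr_ge0 _ C). Qed.

Lemma cabsM c d : cabs (c * d) = cabs c * cabs d.
Proof. by apply: (@complexI R); rewrite realcM !cabsE; exact: (@normrM C). Qed.

Lemma cabsD c d : cabs (c + d) <= cabs c + cabs d.
Proof. by rewrite -lecR realcD !cabsE; exact: (@ler_normD _ C). Qed.

Lemma cabs_real x : cabs x%:C = `|x|.
Proof. by rewrite /cabs normc_def /= expr0n addr0 sqrtr_sqr. Qed.

Lemma cabs_conj c : cabs c^* = cabs c.
Proof. by apply: (@complexI R); rewrite !cabsE; exact: (@norm_conjC C). Qed.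

Lemma cabs1 : cabs (1 : C) = 1.
Proof. by rewrite -[1 : C]/(1%:C) cabs_real normr1. Qed.

Lemma cabsN c : cabs (- c) = cabs c.
Proof. by rewrite /cabs normrN. Qed.

Lemma cabs0 : cabs (0 : C) = 0.
Proof. by rewrite /cabs normr0. Qed.

Lemma cabs_i : cabs ('i : C) = 1.
Proof. by apply: (@complexI R); rewrite cabsE; exact: (@normCi C). Qed.

Lemma cabs_eq0 c : (cabs c == 0) = (c == 0).
Proof. by rewrite -realc_eq0 cabsE; exact: normr_eq0. Qed.

Lemma mulC_conj c : c * c^* = (cabs c ^+ 2)%:C.
Proof. by rewrite realcX cabsE normCK. Qed.

Lemma le_of_eq x y : x = y -> x <= y.
Proof. by move->. Qed.

Lemma geo_le0 (r K q : R) : 0 <= q < 1 -> (forall n, r <= K * q ^+ n) -> r <= 0.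
Proof.
move=> /andP[q0 q1] h.
have cq : (fun n => K * q ^+ n) @ \oo --> K * 0.
  by apply: cvgM; [exact: cvg_cst | apply: cvg_expr; rewrite ger0_norm].
rewrite mulr0 in cq.
apply: (@ler_cvg_to nat \oo _ R (fun=> r) (fun n => K * q ^+ n)) cq _.
  exact: cvg_cst.
by apply: nearW => n; exact: h.
Qed.

End Scalars.

(** * C*-algebras *)

Section CstarBasics.
Variables (R : realType) (A : cstarType R).
Local Notation C := (Cplx R).
Implicit Types (x y u v a b : A) (r t e : R).
Local Notation "t %:S" := ((t%:C : C)%:A : A) (at level 2, format "t %:S").

Lemma star0 : star (0 : A) = 0.
Proof. by apply: (addrI (star 0)); rewrite -starD !addr0. Qed.

Lemma starN x : star (- x) = - star x.
Proof. by apply: (addrI (star x)); rewrite -starD !subrr star0. Qed.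

Lemma starB x y : star (x - y) = star x - star y.
Proof. by rewrite starD starN. Qed.

Lemma star1 : star (1 : A) = 1.
Proof. by rewrite -[LHS]mulr1 -[X in _ * X]starK -starM mulr1 starK. Qed.

Lemma starX x n : star (x ^+ n) = star x ^+ n.
Proof. by elim: n => [|n ih]; rewrite ?star1 // exprS starM ih exprSr. Qed.

Lemma star_real t : star t%:S = t%:S.
Proof. by rewrite starZ star1 conj_realc. Qed.

Lemma cnorm0 : cnorm (0 : A) = 0.
Proof. by rewrite -(scale0r 0) cnormZ cabs0 mul0r. Qed.

Lemma cnormN x : cnorm (- x) = cnorm x.
Proof. by rewrite -scaleN1r cnormZ cabsN cabs1 mul1r. Qed.

Lemma cnormBC x y : cnorm (x - y) = cnorm (y - x).
Proof. by rewrite -cnormN opprB. Qed.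

Lemma cnorm_ge0 x : 0 <= cnorm x.
Proof.
have := ler_cnormD x (- x).
by rewrite subrr cnorm0 cnormN -mulr2n pmulrn_lge0.
Qed.

Lemma ler_cnormB x y : cnorm (x - y) <= cnorm x + cnorm y.
Proof. by rewrite (le_trans (ler_cnormD _ _))// cnormN. Qed.

Lemma ler_cnorm_dist x y z : cnorm (x - z) <= cnorm (x - y) + cnorm (y - z).
Proof. by have := ler_cnormD (x - y) (y - z); rewrite subrKA. Qed.

Lemma cnorm1 : cnorm (1 : A) = 1.
Proof.
have n0 : cnorm (1 : A) != 0.
  by apply: contra_neq (@oner_neq0 A) => /cnorm_eq0.
apply: (mulfI n0); rewrite mulr1 -expr2.
by rewrite -cnorm_cstar star1 mul1r.
Qed.

Lemma cnorm_star x : cnorm (star x) = cnorm x.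
Proof.
have h y : cnorm y <= cnorm (star y).
  have [->|y0] := eqVneq (cnorm y) 0; first exact: cnorm_ge0.
  have y1 : 0 < cnorm y by rewrite lt_def y0 cnorm_ge0.
  by rewrite -(ler_pM2r y1) -expr2 -cnorm_cstar ler_cnormM.
by apply/eqP; rewrite eq_le h -{2}[x]starK h.
Qed.

Lemma realS_D r t : (r + t)%:S = r%:S + t%:S.
Proof. by rewrite realcD scalerDl. Qed.

Lemma realS_M r t : (r * t)%:S = r%:S * t%:S.
Proof. by rewrite realcM -scalerAl mul1r scalerA. Qed.

Lemma realS_1 : 1%:S = 1.
Proof. by rewrite scale1r. Qed.

Lemma realS_0 : 0%:S = 0.
Proof. by rewrite scale0r. Qed.

Lemma mulSl r x : r%:S * x = r%:C *: x.
Proof. by rewrite -scalerAl mul1r. Qed.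

Lemma realS_comm r x : r%:S * x = x * r%:S.
Proof. by rewrite mulSl -scalerAr mulr1. Qed.

Lemma cnorm_realS r : cnorm r%:S = `|r|.
Proof. by rewrite cnormZ cabs_real cnorm1 mulr1. Qed.

Lemma cnorm_realZ r x : cnorm (r%:C *: x) = `|r| * cnorm x.
Proof. by rewrite cnormZ cabs_real. Qed.

Lemma cnorm_sa_sqr (h : A) : star h = h -> cnorm (h ^+ 2) = cnorm h ^+ 2.
Proof. by move=> sh; rewrite -cnorm_cstar sh expr2. Qed.

Lemma complete_dist (u : nat -> A) :
  (forall e : R, 0 < e -> exists N, forall m n, (N <= m)%N -> (N <= n)%N ->
     cnorm (u m - u n) < e) ->
  exists l, forall e : R, 0 < e -> exists N, forall n, (N <= n)%N ->
     cnorm (u n - l) < e.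
Proof.
move=> /cnorm_complete[l /cvgrPdist_lt cl]; exists l => e e0.
have [N _ hN] := cl e e0; exists N => n Nn.
by have := hN n Nn; rewrite /= sub0r normrN ger0_norm ?cnorm_ge0.
Qed.

(** Banach's fixed point argument. The explicit rate [K * q ^+ n] turns later passages to the limit
    into applications of [geo_le0]. *)
Lemma iter_cvg (u : nat -> A) (q : R) : 0 <= q < 1 ->
  (forall n, cnorm (u n.+2 - u n.+1) <= q * cnorm (u n.+1 - u n)) ->
  exists (l : A) (K : R), forall n, cnorm (u n - l) <= K * q ^+ n.
Proof.
move=> /[dup] q01 /andP[q0 q1] h.
set d := cnorm (u 1%N - u 0%N).
have d0 : 0 <= d by exact: cnorm_ge0.
have p0 : 0 < 1 - q by rewrite subr_gt0.
have h1 n : cnorm (u n.+1 - u n) <= d * q ^+ n.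
  elim: n => [|n ih]; first by rewrite mulr1.
  by apply: le_trans (h n) _; rewrite exprS mulrCA ler_wpM2l.
set K := d / (1 - q).
have K0 : 0 <= K by rewrite divr_ge0 // ltW.
have h2 n k : cnorm (u (n + k)%N - u n) <= K * (q ^+ n - q ^+ (n + k)).
  elim: k => [|k ih]; first by rewrite addn0 !subrr cnorm0 mulr0.
  apply: le_trans (ler_cnorm_dist _ (u (n + k)%N) _) _.
  rewrite addnS; apply: le_trans (lerD (h1 _) ih) _.
  have <- : K * (1 - q) = d by rewrite divfK ?gt_eqF.
  by rewrite exprS; apply: le_of_eq; ring.
have h3 n k : cnorm (u (n + k)%N - u n) <= K * q ^+ n.
  by apply: le_trans (h2 _ _) _; rewrite ler_wpM2l // gerBl exprn_ge0.
have cq e : 0 < e -> exists N, K * q ^+ N < e.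
  move=> e0; apply: contrapT => /forallNP hN.
  have : e <= 0 by apply: (geo_le0 q01 (K := K)) => n; rewrite leNgt; apply/negP/hN.
  by rewrite leNgt e0.
have [e e0|l hl] := @complete_dist u.
  have [N hN] := cq _ (divr_gt0 e0 (ltr0n _ 2)).
  exists N => m n /subnKC <- /subnKC <-.
  apply: le_lt_trans (ler_cnorm_dist _ (u N) _) _.
  rewrite [e](splitr e) ltrD //; apply: le_lt_trans hN; first exact: h3.
  by rewrite cnormBC.
exists l, K => n; apply/ler_addgt0Pr => e e0.
have [N hN] := hl e e0.
apply: le_trans (ler_cnorm_dist _ (u (n + N)%N) _) _.
by rewrite lerD // ?(cnormBC (u n)) // ltW // hN // leq_addl.
Qed.

Lemma iter_lim0 (u : nat -> A) l (K q c : R) y : 0 <= q < 1 ->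
  (forall n, cnorm (u n - l) <= K * q ^+ n) ->
  (forall n, cnorm y <= c * cnorm (u n - l)) -> 0 <= c -> y = 0.
Proof.
move=> q01 hl hy c0; apply: cnorm_eq0; apply/eqP.
rewrite eq_le cnorm_ge0 andbT; apply: (geo_le0 q01 (K := c * K)) => n.
by apply: le_trans (hy n) _; rewrite -mulrA ler_wpM2l.
Qed.

(** Membership of [b] in the bicommutant of [a]. It replaces functional calculus: roots of commuting
    elements obtained by iteration commute again. *)
Definition comm_with a b := forall y, y * a = a * y -> y * b = b * y.

(* A fixed point of w |-> (x + w ^+ 2) / 2 is a solution of (1 - w) ^+ 2 = 1 - x. *)
Lemma sqrt_one_sub x : cnorm x < 1 -> star x = x ->
  exists y, [/\ star y = y, y ^+ 2 = 1 - x & comm_with x y].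
Proof.
move=> x1 sx; pose F w := (2^-1 : R)%:C *: (x + w ^+ 2).
pose u n := iter n F 0.
(* The ball of radius [q] is invariant under [F], because [cnorm x = 2 * q - 1] and [q < 1], and [F]
   is [q]-Lipschitz on it. *)
pose q := (1 + cnorm x) / 2.
have x0 := cnorm_ge0 x.
have q01 : 0 <= q < 1 by rewrite /q; lra.
have uq n : cnorm (u n) <= q.
  elim: n => [|n ih]; first by rewrite cnorm0; case/andP: q01.
  rewrite /u iterS -/(u n) /F cnorm_realZ ger0_norm ?invr_ge0 //.
  rewrite -ler_pdivlMl // ?invr_gt0 //; apply: le_trans (ler_cnormD _ _) _.
  have : cnorm (u n ^+ 2) <= q ^+ 2.
    by rewrite expr2 (le_trans (ler_cnormM _ _)) // expr2 ler_pM ?cnorm_ge0.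
  by rewrite /q; nra.
have FB w v : F w - F v = (2^-1 : R)%:C *: (w * (w - v) + (w - v) * v).
  by rewrite /F -scalerBr addlKB mulrBr mulrBl !expr2 addrA subrK.
have nFB w v : cnorm w <= q -> cnorm v <= q -> cnorm (F w - F v) <= q * cnorm (w - v).
  move=> wq vq; rewrite FB cnorm_realZ ger0_norm ?invr_ge0 // -ler_pdivlMl ?invr_gt0 //.
  apply: le_trans (ler_cnormD _ _) _; rewrite invrK mulr_natl mulr2n.
  rewrite lerD //; apply: le_trans (ler_cnormM _ _) _.
    by rewrite ler_wpM2r ?cnorm_ge0.
  by rewrite mulrC ler_wpM2r ?cnorm_ge0.
have [l [K hl]] : exists (l : A) (K : R), forall n, cnorm (u n - l) <= K * q ^+ n.
  by apply: iter_cvg q01 _ => n; exact: (nFB (u n.+1) (u n) (uq n.+1) (uq n)).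
have lim0 := iter_lim0 q01 hl.
have lq : cnorm l <= q.
  rewrite -subr_le0; apply: (geo_le0 q01 (K := K)) => n.
  apply: le_trans (hl n); rewrite lerBlDr.
  have := ler_cnormB (u n) (u n - l); rewrite opprB addrC subrK => /le_trans; apply.
  by rewrite addrC lerD.
have su n : star (u n) = u n.
  elim: n => [|n ih]; first exact: star0.
  by rewrite /u iterS -/(u n) starZ conj_realc starD starX sx ih.
have sl : star l = l.
  apply/eqP; rewrite -subr_eq0; apply/eqP; apply: (lim0 2) => // n.
  have -> : star l - l = (u n - l) - star (u n - l).
    by rewrite starB su addlKB opprK addrC.
  by apply: le_trans (ler_cnormB _ _) _; rewrite cnorm_star mulr_natl mulr2n.
have Fl : F l = l.
  apply/eqP; rewrite -subr_eq0; apply/eqP.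
  have q0 : 0 <= q by case/andP: q01.
  apply: cnorm_eq0; apply/eqP; rewrite eq_le cnorm_ge0 andbT.
  apply: (geo_le0 q01 (K := (2 * q) * K)) => n.
  apply: le_trans (ler_cnorm_dist _ (u n.+1) _) _.
  have h1 : cnorm (F l - u n.+1) <= q * (K * q ^+ n).
    by apply: le_trans (nFB _ _ lq (uq n)) _; rewrite ler_wpM2l // cnormBC.
  have h2 := hl n.+1; rewrite exprS in h2.
  by apply: le_trans (lerD h1 h2) _; rewrite le_eqVlt; apply/orP; left; apply/eqP; ring.
exists (1 - l); split.
- by rewrite starB star1 sl.
- have l2 : x + l ^+ 2 = l + l.
    rewrite -[in RHS]Fl -scalerDl -realcD.
    have -> : 2^-1 + 2^-1 = 1 :> R by field.
    by rewrite scale1r.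
  have {}l2 : l ^+ 2 = l + l - x by rewrite -l2 addrAC subrr add0r.
  have e : l - (l + l - x) = x - l.
    by rewrite -addrA opprD addrA subrr add0r opprB.
  by rewrite expr2 mulrBl mul1r mulrBr mulr1 -expr2 l2 e opprB addrA subrK.
move=> y yx; rewrite mulrBr mulrBl mulr1 mul1r; congr (_ - _).
have yu n : y * u n = u n * y.
  elim: n => [|n ih]; first by rewrite mulr0 mul0r.
  rewrite /u iterS -/(u n) /F -scalerAr -scalerAl mulrDr mulrDl yx; congr (_ *: (_ + _)).
  by rewrite expr2 mulrA ih -mulrA ih mulrA.
apply/eqP; rewrite -subr_eq0; apply/eqP; apply: (lim0 (2 * cnorm y)) => [n|]; last first.
  by rewrite mulr_ge0 ?cnorm_ge0.
have -> : y * l - l * y = (u n - l) * y - y * (u n - l).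
  by rewrite mulrBl mulrBr yu addlKB opprK addrC.
apply: le_trans (ler_cnormB _ _) _.
apply: le_trans (lerD (ler_cnormM _ _) (ler_cnormM _ _)) _.
by apply: le_of_eq; ring.
Qed.

(** The Neumann series, as the fixed point of [w |-> 1 + x * w]. The iterates commute with [x],
    which makes the inverse two-sided. *)
Lemma inv_one_sub x : cnorm x < 1 -> exists y, y * (1 - x) = 1 /\ (1 - x) * y = 1.
Proof.
move=> x1; have x0 := cnorm_ge0 x.
pose u n := iter n (fun w => 1 + x * w) 0.
have q01 : 0 <= cnorm x < 1 by rewrite x0.
have uS n : u n.+1 = 1 + x * u n by [].
have [l [K hl]] : exists (l : A) (K : R), forall n, cnorm (u n - l) <= K * cnorm x ^+ n.
  by apply: iter_cvg q01 _ => n; rewrite !uS addlKB -mulrBr ler_cnormM.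
have lim0 := iter_lim0 q01 hl.
have ux n : x * u n = u n * x.
  elim: n => [|n ih]; first by rewrite mulr0 mul0r.
  by rewrite uS mulrDr mulrDl mulr1 mul1r -mulrA -ih.
have xl : x * l = l * x.
  apply/eqP; rewrite -subr_eq0; apply/eqP; apply: (lim0 (2 * cnorm x)) => [n|]; last first.
    by rewrite mulr_ge0.
  have -> : x * l - l * x = (u n - l) * x - x * (u n - l).
    by rewrite mulrBl mulrBr -ux addlKB opprK addrC.
  apply: le_trans (ler_cnormB _ _) _.
  apply: le_trans (lerD (ler_cnormM _ _) (ler_cnormM _ _)) _.
  by apply: le_of_eq; ring.
have e : (1 - x) * l = 1.
  rewrite mulrBl mul1r; apply/eqP; rewrite subr_eq -subr_eq0; apply/eqP.
  apply: cnorm_eq0; apply/eqP; rewrite eq_le cnorm_ge0 andbT.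
  apply: (geo_le0 q01 (K := 2 * cnorm x * K)) => n.
  apply: le_trans (ler_cnorm_dist _ (u n.+1) _) _.
  have h1 := hl n.+1; rewrite exprS cnormBC in h1.
  have h2 : cnorm (u n.+1 - (1 + x * l)) <= cnorm x * (K * cnorm x ^+ n).
    by rewrite uS addlKB -mulrBr (le_trans (ler_cnormM _ _)) // ler_wpM2l.
  by apply: le_trans (lerD h1 h2) _; rewrite le_eqVlt; apply/orP; left; apply/eqP; ring.
by exists l; split => //; rewrite mulrBr mulr1 -xl -[X in X - _]mul1r -mulrBl.
Qed.

End CstarBasics.

(** * Positive elements and order bounds for norms *)

Section Positivity.
Variables (R : realType) (A : cstarType R).
Local Notation C := (Cplx R).
Implicit Types (x y u v a b h : A) (r t e : R).
Local Notation "t %:S" := ((t%:C : C)%:A : A) (at level 2, format "t %:S").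

(* The usual criterion for a self-adjoint element to have nonnegative spectrum. *)
Definition pos a := star a = a /\ exists t, cnorm (t%:S - a) <= t.

Lemma pos_realS r : 0 <= r -> pos r%:S.
Proof. by move=> r0; split; [exact: star_real|exists r; rewrite subrr cnorm0]. Qed.

Lemma posD a b : pos a -> pos b -> pos (a + b).
Proof.
move=> [sa [t ta]] [sb [r rb]]; split; first by rewrite starD sa sb.
exists (t + r); rewrite realS_D opprD addrACA.
exact: le_trans (ler_cnormD _ _) (lerD ta rb).
Qed.

Lemma posZ r a : 0 <= r -> pos a -> pos (r%:C *: a).
Proof.
move=> r0 [sa [t ta]]; split; first by rewrite starZ conj_realc sa.
exists (r * t); rewrite realS_M mulSl -scalerBr cnorm_realZ ger0_norm //.
exact: ler_wpM2l.
Qed.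

Lemma pos_sub_norm r a : star a = a -> cnorm a <= r -> pos (r%:S - a).
Proof.
move=> sa ar; split; first by rewrite starB sa star_real.
by exists r; rewrite opprB addrC subrK.
Qed.

Lemma cnorm_unitary u : star u * u = 1 -> cnorm u = 1.
Proof.
move=> uu; apply/eqP; have := cnorm_cstar u; rewrite uu cnorm1 => /esym/eqP.
rewrite sqrf_eq1 => /orP[//|/eqP u1].
by have := cnorm_ge0 u; rewrite u1 lerNr oppr0 leNgt ltr01.
Qed.

Lemma re_imM x y :
  (x - 'i *: y) * (x + 'i *: y) = x ^+ 2 + y ^+ 2 + 'i *: (x * y - y * x).
Proof.
rewrite mulrBl !mulrDr -!scalerAr -!scalerAl scalerA -(expr2 'i) sqrCi scaleN1r.
rewrite scalerBr -!expr2 opprD opprK [- _ + y ^+ 2]addrC.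
by rewrite [LHS]addrACA.
Qed.

Lemma star_re_im x y : star x = x -> star y = y -> x * y = y * x ->
  star (x + 'i *: y) * (x + 'i *: y) = x ^+ 2 + y ^+ 2.
Proof.
move=> sx sy xy; rewrite starD starZ sx sy conjCi scaleNr re_imM.
by rewrite xy subrr scaler0 addr0.
Qed.

Lemma dbl_scale x : x + x = (2 : R)%:C *: x.
Proof. by rewrite (_ : (2 : R) = 1 + 1) // realcD scalerDl scale1r. Qed.

Lemma cnorm_re_im x y : star x = x -> star y = y ->
  cnorm x <= cnorm (x + 'i *: y) /\ cnorm y <= cnorm (x + 'i *: y).
Proof.
move=> sx sy; set u := _ + _.
have su : star u = x - 'i *: y by rewrite starD starZ sx sy conjCi scaleNr.
have h2 : cnorm u + cnorm (star u) = 2 * cnorm u by rewrite cnorm_star; ring.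
split.
  rewrite -(ler_pM2l (ltr0n R 2)) -h2.
  have -> : 2 * cnorm x = cnorm (u + star u).
    by rewrite su addrACA subrr addr0 dbl_scale cnorm_realZ ger0_norm.
  exact: ler_cnormD.
rewrite -(ler_pM2l (ltr0n R 2)) -h2.
have -> : 2 * cnorm y = cnorm (u - star u).
  by rewrite su addlKB opprK dbl_scale cnorm_realZ ger0_norm // cnormZ cabs_i mul1r.
exact: ler_cnormB.
Qed.

(** With [y] a square root of [1 - h ^+ 2] that commutes with [h], the element [h + 'i *: y] is
    unitary, and its imaginary part has norm at most 1. Writing [h] as the real part of a unitary
    takes the place of its spectrum. *)
Lemma sa_complement h : star h = h -> cnorm h < 1 ->
  exists y, [/\ star y = y, h * y = y * h, h ^+ 2 + y ^+ 2 = 1 & cnorm y <= 1].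
Proof.
move=> sh h1.
have hh1 : cnorm (h ^+ 2) < 1.
  by rewrite cnorm_sa_sqr // expr_lt1 ?cnorm_ge0.
have [|y [sy y2 cy]] := sqrt_one_sub hh1; first by rewrite starX sh.
have hy : h * y = y * h by apply: cy; rewrite expr2 mulrA.
have e : h ^+ 2 + y ^+ 2 = 1 by rewrite y2 addrC subrK.
exists y; split => //.
have [_ /le_trans] := cnorm_re_im sh sy; apply.
by rewrite cnorm_unitary // star_re_im.
Qed.

Lemma scale_realC_inv r a : r != 0 -> r%:C *: (r^-1%:C *: a) = a.
Proof. by move=> r0; rewrite scalerA -realcM mulfV // scale1r. Qed.

Lemma pos_sq h : star h = h -> pos (h ^+ 2).
Proof.
move=> sh; set t := cnorm h + 1.
have t0 : 0 < t by rewrite ltr_wpDl ?cnorm_ge0.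
pose k := t^-1%:C *: h.
have sk : star k = k by rewrite starZ conj_realc sh.
have k1 : cnorm k < 1.
  rewrite cnorm_realZ gtr0_norm ?invr_gt0 // ltr_pdivrMl // mulr1.
  by rewrite ltrDl.
have [y [sy _ e y1]] := sa_complement sk k1.
have -> : h ^+ 2 = (t ^+ 2)%:C *: (k ^+ 2).
  rewrite expr2 -[h](scale_realC_inv _ (lt0r_neq0 t0)) -/k.
  by rewrite -scalerAl -scalerAr scalerA -realcM.
apply: posZ; first exact: sqr_ge0.
split; first by rewrite starX sk.
exists 1; rewrite realS_1 -e addrAC subrr add0r (cnorm_sa_sqr sy).
by rewrite expr_le1 ?cnorm_ge0.
Qed.

(** The shift by [e] makes [(t - a) / (t + e)] a strict contraction, as [sqrt_one_sub] requires; in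
    the applications [e] tends to 0. *)
Lemma pos_sqrt e a : pos a -> 0 < e ->
  exists x, [/\ star x = x, x ^+ 2 = a + e%:S & comm_with a x].
Proof.
move=> [sa [t ta]] e0.
have t0 : 0 <= t by exact: le_trans (cnorm_ge0 _) ta.
have te0 : 0 < t + e by exact: ltr_wpDl.
pose b := (t + e)^-1%:C *: (t%:S - a).
have b1 : cnorm b < 1.
  rewrite cnorm_realZ gtr0_norm ?invr_gt0 // ltr_pdivrMl // mulr1.
  by rewrite (le_lt_trans ta) // ltrDl.
have [|y [sy y2 cy]] := sqrt_one_sub b1.
  by rewrite starZ conj_realc starB sa star_real.
exists ((Num.sqrt (t + e))%:C *: y); split.
- by rewrite starZ conj_realc sy.
- rewrite expr2 -scalerAl -scalerAr scalerA -realcM -!expr2 sqr_sqrtr ?(ltW te0) // y2.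
  rewrite scalerBr scale_realC_inv ?gt_eqF // realS_D opprB addrC.
  by rewrite -addrA; congr (_ + _); rewrite addrA [- _ + _]addrC subrr add0r.
move=> z za; rewrite -scalerAr -scalerAl cy //.
by rewrite -scalerAr -scalerAl mulrBl mulrBr realS_comm za.
Qed.

(** The witness in [pos] may be replaced by any number above the norm. This bound is uniform under
    small perturbations of [a], which is why [pos] is closed. *)
Lemma pos_norm t a : pos a -> cnorm a < t -> cnorm (t%:S - a) <= t.
Proof.
move=> pa /[dup] at0 ; have t0 := le_lt_trans (cnorm_ge0 _) at0.
rewrite -subr_gt0 => d0; apply/ler_addgt0Pr => e e0.
pose d := Num.min (e / 2) ((t - cnorm a) / 2).
have dd : 0 < d by rewrite lt_min !divr_gt0.
have [de dt] : d <= e / 2 /\ d <= (t - cnorm a) / 2 by rewrite !ge_min !lexx orbT.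
have [x [sx x2 _]] := pos_sqrt pa dd.
have xt : cnorm (x ^+ 2) < t.
  rewrite x2 (le_lt_trans (ler_cnormD _ _)) // cnorm_realS gtr0_norm //.
  by move: dt d0; lra.
pose k := (Num.sqrt t)^-1%:C *: x.
have s0 : 0 < Num.sqrt t by rewrite sqrtr_gt0.
have sk : star k = k by rewrite starZ conj_realc sx.
have k1 : cnorm k < 1.
  rewrite cnorm_realZ gtr0_norm ?invr_gt0 // ltr_pdivrMl // mulr1.
  rewrite -(@ltr_pXn2r _ 2) ?nnegrE ?cnorm_ge0 ?sqrtr_ge0 //.
  by rewrite sqr_sqrtr ?(ltW t0) // -cnorm_sa_sqr.
have [y [sy _ e1 y1]] := sa_complement sk k1.
have ex : x ^+ 2 = t%:C *: (k ^+ 2).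
  rewrite expr2 -[x](scale_realC_inv _ (lt0r_neq0 s0)) -/k.
  by rewrite -scalerAl -scalerAr scalerA -realcM -expr2 sqr_sqrtr ?(ltW t0).
have : cnorm (t%:S - x ^+ 2) <= t.
  rewrite ex -scalerBr -e1 addrAC subrr add0r cnorm_realZ gtr0_norm // (cnorm_sa_sqr sy).
  by rewrite ger_pMr // expr_le1 ?cnorm_ge0.
rewrite x2 => h.
have -> : t%:S - a = (t%:S - (a + d%:S)) + d%:S by rewrite opprD addrA subrK.
apply: le_trans (ler_cnormD _ _) _; rewrite cnorm_realS gtr0_norm //.
by move: h de; lra.
Qed.

Lemma pos_closed a : (forall e, 0 < e -> pos (a + e%:S)) -> pos a.
Proof.
move=> h; split.
  have [+ _] := h 1 ltr01; rewrite starD star_real => /addIr //.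
exists (cnorm a + 1); apply/ler_addgt0Pr => e e0.
pose d := Num.min (e / 2) (2^-1).
have d0 : 0 < d by rewrite lt_min divr_gt0 ?invr_gt0 ?ltr0n.
have [de dt] : d <= e / 2 /\ d <= 2^-1 by rewrite !ge_min !lexx orbT.
have lt1 : cnorm (a + d%:S) < cnorm a + 1.
  rewrite (le_lt_trans (ler_cnormD _ _)) // cnorm_realS gtr0_norm //.
  by move: dt; lra.
have h1 := pos_norm (h _ d0) lt1.
set T := (_ + 1)%:S in h1 *.
have -> : T - a = (T - (a + d%:S)) + d%:S by rewrite opprD addrA subrK.
apply: le_trans (ler_cnormD _ _) _; rewrite cnorm_realS gtr0_norm //.
by move: h1 de; lra.
Qed.

(** Up to an error that vanishes with [d], the product is the square of [x * y], where [x] and [y]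
    are roots of [a + d] and [b + d]; the bicommutant clause of [pos_sqrt] makes them commute. *)
Lemma posM a b : pos a -> pos b -> a * b = b * a -> pos (a * b).
Proof.
move=> pa pb ab; apply: pos_closed => e e0.
have [[sa _] [sb _]] := (pa, pb).
pose m := cnorm a + cnorm b + 1.
have m0 : 1 <= m by rewrite lerDr addr_ge0 ?cnorm_ge0.
(* The error is at most [d * (cnorm a + cnorm b) + d * d]; [d <= 1] bounds this by [d * m], hence by
   [e]. *)
pose d := Num.min 1 (e / (m + 1)).
have d0 : 0 < d by rewrite lt_min ltr01 divr_gt0 // addr_gt0 // (lt_le_trans ltr01).
have [d1 de] : d <= 1 /\ d <= e / (m + 1) by rewrite !ge_min !lexx orbT.
have [x [sx x2 cx]] := pos_sqrt pa d0.
have [y [sy y2 cy]] := pos_sqrt pb d0.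
have xy : x * y = y * x.
  by apply: cy; apply/esym/cx.
have sxy : star (x * y) = x * y by rewrite starM sx sy xy.
have -> : a * b + e%:S = (x * y) ^+ 2 + (e%:S - (d%:C *: (a + b) + (d * d)%:S)).
  have -> : (x * y) ^+ 2 = (a + d%:S) * (b + d%:S) by rewrite exprMn_comm // x2 y2.
  have -> : (a + d%:S) * (b + d%:S) = a * b + (d%:C *: (a + b) + (d * d)%:S).
    rewrite mulrDl !mulrDr -realS_comm -realS_M !mulSl scalerDr.
    by rewrite !addrA.
  by rewrite addrACA subrr addr0.
apply: posD; first exact: pos_sq.
apply: pos_sub_norm.
  by rewrite starD star_real starZ conj_realc starD sa sb.
apply: le_trans (ler_cnormD _ _) _.
rewrite cnorm_realZ cnorm_realS !gtr0_norm ?mulr_gt0 //.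
have := ler_cnormD a b; rewrite ler_pdivlMr in de; last by rewrite addr_gt0 // (lt_le_trans ltr01).
move: m0 d0 d1 de; rewrite /m; nra.
Qed.

(** Commuting roots [x] of [a + d] and [y] of [t - a + d] satisfy [x ^+ 2 + y ^+ 2 = t + 2 * d], so
    [x + 'i *: y] has square norm [t + 2 * d] and dominates [x]. Removing the shift costs a third
    [d], hence [d = e / 3]. *)
Lemma pos_norm_le t a : 0 <= t -> pos a -> pos (t%:S - a) -> cnorm a <= t.
Proof.
move=> t0 pa pb; apply/ler_addgt0Pr => e e0.
have d0 : 0 < e / 3 by rewrite divr_gt0.
set d := e / 3 in d0.
have [x [sx x2 cx]] := pos_sqrt pa d0.
have [y [sy y2 cy]] := pos_sqrt pb d0.
have xy : x * y = y * x.
  apply: cy; apply/esym/cx.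
  by rewrite mulrBl mulrBr realS_comm.
have h1 : cnorm (x + 'i *: y) ^+ 2 = t + d + d.
  rewrite -cnorm_cstar star_re_im // x2 y2 addrACA (addrC a) subrK.
  rewrite -!realS_D cnorm_realS ger0_norm ?addr_ge0 ?(ltW d0) //.
  by ring.
have [h2 _] := cnorm_re_im sx sy.
have h3 : cnorm (a + d%:S) <= t + d + d.
  by rewrite -x2 (cnorm_sa_sqr sx) -h1 ler_pXn2r ?nnegrE ?cnorm_ge0.
have -> : a = (a + d%:S) - d%:S by rewrite addrK.
apply: le_trans (ler_cnormB _ _) _; rewrite cnorm_realS gtr0_norm //.
have e3 : e = d + d + d by rewrite /d; field.
by clearbody d; move: h3 e3; lra.
Qed.

(** [t ^+ 2 - h ^+ 2] is the product of the commuting positive elements [t - h] and [t + h]. *)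
Lemma sa_norm_le t h : star h = h -> 0 <= t ->
  pos (t%:S - h) -> pos (t%:S + h) -> cnorm h <= t.
Proof.
move=> sh t0 p1 p2.
rewrite -(@ler_pXn2r _ 2) ?nnegrE ?cnorm_ge0 // -cnorm_sa_sqr //.
apply: pos_norm_le; [exact: sqr_ge0|exact: pos_sq|].
have -> : (t ^+ 2)%:S - h ^+ 2 = (t%:S - h) * (t%:S + h).
  by rewrite mulrBl !mulrDr -realS_M -!expr2 realS_comm opprD addrA addrK.
apply: posM => //.
by apply: commrD; apply: commr_sym; apply: commrB => //; rewrite /GRing.comm realS_comm.
Qed.

Lemma sq_sum_eq0 u v : star u = u -> star v = v -> u ^+ 2 + v ^+ 2 = 0 -> u = 0.
Proof.
move=> su sv e; apply: cnorm_eq0; apply/eqP; rewrite -sqrf_eq0.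
rewrite -cnorm_sa_sqr // eq_le cnorm_ge0 andbT.
apply: pos_norm_le => //; first exact: pos_sq.
have -> : 0%:S - u ^+ 2 = v ^+ 2.
  by rewrite realS_0 sub0r; apply/eqP; rewrite eq_sym -addr_eq0 addrC e.
exact: pos_sq.
Qed.

Definition rpart x := (2^-1 : R)%:C *: (x + star x).
Definition ipart x := - ('i *: ((2^-1 : R)%:C *: (x - star x))).

Lemma rpart_sa x : star (rpart x) = rpart x.
Proof. by rewrite starZ conj_realc starD starK addrC. Qed.

Lemma ipart_sa x : star (ipart x) = ipart x.
Proof.
rewrite /ipart starN !starZ conjCi conj_realc starB starK.
by rewrite scaleNr opprK -[star x - x]opprB !scalerN.
Qed.

Lemma re_imE x : x = rpart x + 'i *: ipart x.
Proof.
rewrite /ipart scalerN scalerA -expr2 sqrCi scaleN1r opprK -scalerDr.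
by rewrite addrACA subrr addr0 dbl_scale scalerA -realcM mulVf ?scale1r.
Qed.

(** In terms of the real part [r] and the imaginary part [s] of [x], the commutators cancel and the
    sum is [2 * (r ^+ 2 + s ^+ 2)]. *)
Lemma anticommuting_square_eq0 x : star x * x + x * star x = 0 -> x = 0.
Proof.
rewrite {}(re_imE x).
move: (rpart x) (ipart x) (rpart_sa x) (ipart_sa x) => r s sr si.
rewrite starD starZ sr si conjCi scaleNr re_imM.
have -> : (r + 'i *: s) * (r - 'i *: s) = r ^+ 2 + s ^+ 2 - 'i *: (r * s - s * r).
  have := re_imM r (- s); rewrite scalerN opprK sqrrN mulrN mulNr -opprD scalerN.
  by move->.
rewrite addrACA subrr addr0 dbl_scale => h.
have {}h : r ^+ 2 + s ^+ 2 = 0.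
  by rewrite -[LHS](@scale_realC_inv 2^-1) ?invr_eq0 // invrK h scaler0.
rewrite (sq_sum_eq0 sr si h) (sq_sum_eq0 si sr) ?scaler0 ?addr0 //.
by rewrite addrC.
Qed.

(** With [d] the inverse of [cnorm k], the difference [a - d] is [d * a * (cnorm k - k)], a product
    of commuting positive elements. *)
Lemma pos_inv_lower a k : pos a -> k * a = 1 -> a * k = 1 ->
  exists2 d, 0 < d & pos (a - d%:S).
Proof.
move=> pa ka ak; have [sa _] := pa.
have sk : star k = k.
  have h : star k * a = 1 by rewrite -{1}sa -starM ak star1.
  by rewrite -[LHS]mulr1 -ak mulrA h mul1r.
have k0 : cnorm k != 0.
  apply/eqP => /cnorm_eq0 k0; have := oner_neq0 A.
  by rewrite -ka k0 mul0r eqxx.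
have {}k0 : 0 < cnorm k by rewrite lt_def k0 cnorm_ge0.
have pk : pos ((cnorm k)%:S - k) by exact: pos_sub_norm.
exists (cnorm k)^-1; first by rewrite invr_gt0.
have -> : a - (cnorm k)^-1%:S = (cnorm k)^-1%:C *: (a * ((cnorm k)%:S - k)).
  rewrite mulrBr ak -realS_comm mulSl scalerBr.
  by rewrite scalerA -realcM mulVf ?gt_eqF // scale1r.
apply: posZ; first by rewrite invr_ge0 ltW.
by apply: posM => //; rewrite mulrBr mulrBl realS_comm ak ka.
Qed.

Lemma pos_succ_inv s : pos s -> exists k, k * (1 + s) = 1 /\ (1 + s) * k = 1.
Proof.
move=> [_ [t ts]].
have t0 : 0 <= t by exact: le_trans (cnorm_ge0 _) ts.
have t1 : 0 < 1 + t by exact: ltr_wpDr.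
pose x := (1 + t)^-1%:C *: (t%:S - s).
have x1 : cnorm x < 1.
  rewrite cnorm_realZ gtr0_norm ?invr_gt0 // ltr_pdivrMl // mulr1.
  by rewrite (le_lt_trans ts) // ltrDr.
have [y [yl yr]] := inv_one_sub x1.
have e : 1 + s = (1 + t)%:C *: (1 - x).
  rewrite scalerBr scale_realC_inv ?gt_eqF // realS_D realS_1.
  by rewrite opprB addrACA subrr addr0.
exists ((1 + t)^-1%:C *: y); rewrite e.
by rewrite -!scalerAl -!scalerAr !scalerA -!realcM mulVf ?mulfV ?gt_eqF // !scale1r.
Qed.

(** The [l] with [l - h] positive form an upward closed set, which contains its infimum by
    [pos_closed]. If the infimum exceeded [m], invertibility there would lower it further by
    [pos_inv_lower]. *)
Lemma sa_spectral_bound (m : R) h : star h = h ->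
  (forall l, m < l -> exists k, k * (l%:S - h) = 1 /\ (l%:S - h) * k = 1) ->
  forall l, m < l -> pos (l%:S - h).
Proof.
move=> sh inv l1 ml1; apply: contrapT => np.
have up l l' : pos (l%:S - h) -> l <= l' -> pos (l'%:S - h).
  move=> pl ll'; have -> : l'%:S - h = (l%:S - h) + (l' - l)%:S.
    by rewrite realcB scalerBl [RHS]addrC addrA subrK.
  by apply: posD => //; apply: pos_realS; rewrite subr_ge0.
pose S := [set l : R | pos (l%:S - h)].
have S0 : S !=set0 by exists (cnorm h); exact: pos_sub_norm.
have lb : lbound S l1.
  by move=> l Sl; rewrite leNgt; apply/negP => /ltW /(up _ _ Sl).
have hS : has_inf S by split => //; exists l1.
have l1S : l1 <= inf S by apply: lb_le_inf.
have mS := lt_le_trans ml1 l1S.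
have pS : pos ((inf S)%:S - h).
  apply: pos_closed => e e0.
  have [l Sl le] := inf_adherent e0 hS.
  rewrite addrAC -realS_D; apply: up Sl _; exact: ltW.
have [k [k1 k2]] := inv _ mS.
have [d d0] := pos_inv_lower pS k1 k2.
rewrite addrAC -scalerBl -realcB => pd.
have := ge_inf hS.2 pd; rewrite leNgt => /negP; apply.
by rewrite ltrBlDr ltrDl.
Qed.

End Positivity.

(** A self-adjoint [h] of norm below 1 is the real part of a unitary, whose image is a unitary with
    real part [f h]. Rescaling and the C*-identity extend the bound to all [x]. *)
Lemma hom_contractive (R : realType) (A B : cstarType R) (f : {lrmorphism A -> B}) :
  {morph f : x / star x} -> forall x, cnorm (f x) <= cnorm x.
Proof.
move=> fs.
have sa1 h : star h = h -> cnorm h < 1 -> cnorm (f h) <= 1.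
  move=> sh h1; have [y [sy hy e _]] := sa_complement sh h1.
  have [sfh sfy] : star (f h) = f h /\ star (f y) = f y by rewrite -!fs sh sy.
  have [/le_trans + _] := cnorm_re_im sfh sfy; apply.
  by rewrite cnorm_unitary // star_re_im // -?rmorphM ?hy // -!rmorphXn -rmorphD e rmorph1.
have sa h : star h = h -> cnorm (f h) <= cnorm h.
  move=> sh; apply/ler_addgt0Pr => e e0.
  set t := cnorm h + e; have t0 : 0 < t by rewrite ltr_wpDl ?cnorm_ge0.
  pose k := t^-1%:C *: h.
  have k1 : cnorm k < 1.
    by rewrite cnorm_realZ gtr0_norm ?invr_gt0 // ltr_pdivrMl // mulr1 ltrDl.
  have := sa1 k; rewrite starZ conj_realc sh => /(_ erefl k1).
  by rewrite linearZ /= cnorm_realZ gtr0_norm ?invr_gt0 // ler_pdivrMl // mulr1.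
move=> x; rewrite -(@ler_pXn2r _ 2) ?nnegrE ?cnorm_ge0 // -!cnorm_cstar -fs -rmorphM.
by apply: sa; rewrite starM starK.
Qed.

(** * Central elements produced by the relations *)

Section Wcar.
Variables (R : realType) (A : cstarType R).
Implicit Types (a b c x : A).

Lemma wcar_sym a b : wcar a b -> wcar b a.
Proof.
case=> h1 h2 h3; split => //.
by rewrite -[LHS]starK starM starK h3 starN starM starK.
Qed.

Section Fixed.
Variables a b : A.
Hypothesis w : wcar a b.

Let ab : star a * b = - (b * star a). Proof. by case: w. Qed.
Let ba : star b * a = - (a * star b). Proof. by case/wcar_sym: w. Qed.
Let aa : star a * a = 1 - a * star a.
Proof. by case: w => <- _ _; rewrite addrK. Qed.

Lemma wcar_sqr_star : a ^+ 2 * star a = star a * a ^+ 2.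
Proof.
rewrite expr2 [RHS]mulrA aa mulrBl mul1r -[a * star a * a]mulrA aa mulrBr mulr1.
by rewrite opprB addrC subrK mulrA.
Qed.

Lemma wcar_sqr_star2 : a ^+ 2 * star b = star b * a ^+ 2.
Proof. by rewrite expr2 [RHS]mulrA ba mulNr -(mulrA _ _ a) ba mulrN opprK mulrA. Qed.

Let g := a * b + b * a.

Lemma wcar_anticomm_star : g * star a = star a * g.
Proof.
have ab' : b * star a = - (star a * b) by rewrite ab opprK.
have aa' : a * star a = 1 - star a * a by rewrite aa opprB addrC subrK.
have e1 : a * b * star a = - (a * star a * b) by rewrite -mulrA ab' mulrN mulrA.
have e2 : b * a * star a = b + star a * b * a.
  by rewrite -mulrA aa' mulrBr mulr1 mulrA ab' mulNr opprK.
have e3 : star a * a * b = b - a * star a * b by rewrite aa mulrBl mul1r.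
by rewrite /g mulrDl mulrDr e1 e2 !mulrA e3 addrA [- _ + b]addrC.
Qed.

End Fixed.

(* The commutator [c] of [a] with the anticommutator of [a] and [b] satisfies
   [star c * c = - (c * star c)]; this replaces an appeal to Fuglede's theorem. *)
Lemma wcar_anticomm_comm a b : wcar a b ->
  a * (a * b + b * a) = (a * b + b * a) * a.
Proof.
move=> w; set g := a * b + b * a.
have ga : g * star a = star a * g by exact: wcar_anticomm_star w.
have gb : g * star b = star b * g.
  by rewrite /g addrC; exact: wcar_anticomm_star (wcar_sym w).
have ag : a * star g = star g * a.
  by rewrite -[a]starK -!starM ga.
(* [star g] is a polynomial in [star a] and [star b], with which [g] commutes; so [g] is normal. *)
have gg : g * star g = star g * g.
  rewrite /g starD !starM mulrDr [RHS]mulrDl.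
  by rewrite !mulrA ga gb -!mulrA ga gb !mulrA.
have aa : star a * a = 1 - a * star a by case: w => <- _ _; rewrite addrK.
apply/eqP; rewrite -subr_eq0; apply/eqP; set c := a * g - g * a.
(* [star c] is the commutator of [star g] and [star a]; [c] commutes with the former and
   anticommutes with the latter, so it anticommutes with [star c]. *)
have ac : star a * c = - (c * star a).
  have e1 : star a * a * g = g - a * star a * g by rewrite aa mulrBl mul1r.
  have e2 : star a * g * a = g - g * a * star a.
    by rewrite -ga -mulrA aa mulrBr mulr1 mulrA.
  have e3 : a * g * star a = a * star a * g by rewrite -mulrA ga mulrA.
  by rewrite /c mulrBr mulrBl !mulrA e1 e2 e3 addlKB opprK addrC opprB.
have gc : star g * c = c * star g.
  rewrite -[LHS]/(star g * c); apply: commrB.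
    by apply: commrM => //; exact: esym.
  by apply: commrM => //; exact: esym.
apply: anticommuting_square_eq0.
have sc : star c = star g * star a - star a * star g by rewrite starB !starM.
clearbody c; rewrite sc mulrBl mulrBr -!mulrA ac gc !mulrN !mulrA gc ac mulNr opprK.
by rewrite addrACA addNr subrr addr0.
Qed.

Definition commutes_with_gens a b x :=
  [/\ x * a = a * x, x * star a = star a * x, x * b = b * x & x * star b = star b * x].

Lemma wcar_anticomm_central a b : wcar a b ->
  commutes_with_gens a b (a * b + b * a).
Proof.
move=> w; split.
- by rewrite wcar_anticomm_comm.
- exact: wcar_anticomm_star.
- by rewrite addrC -(wcar_anticomm_comm (wcar_sym w)).
- by rewrite addrC (wcar_anticomm_star (wcar_sym w)).
Qed.

(** The commutator of [a] with [a * b + b * a] telescopes to [a ^+ 2 * b - b * a ^+ 2], so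
    commutation with [b] follows from the centrality of the anticommutator. *)
Lemma wcar_sqr_central a b : wcar a b -> commutes_with_gens a b (a ^+ 2).
Proof.
move=> w; split.
- by rewrite expr2 mulrA.
- exact: wcar_sqr_star w.
- apply/eqP; rewrite -subr_eq0; apply/eqP.
  have := wcar_anticomm_comm w; rewrite mulrDl mulrDr !mulrA => /eqP.
  rewrite -subr_eq0 => /eqP <-.
  by rewrite !expr2 ?mulrA opprD addrA addrK.
- exact: wcar_sqr_star2 w.
Qed.

Lemma commutes_with_gens_sym a b x :
  commutes_with_gens a b x -> commutes_with_gens b a x.
Proof. by case. Qed.

Lemma commutes_with_gens_star a b x :
  commutes_with_gens a b x -> commutes_with_gens a b (star x).
Proof.
by case=> h1 h2 h3 h4; split; apply: (can_inj (@starK R A)); rewrite !starM !starK.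
Qed.

End Wcar.

(** * Operator norm *)

Section OperatorNorm.
Variable R : realType.
Local Notation C := (Cplx R).
Implicit Types (u v : 'cV[C]_4) (M N : 'M[C]_4).

Lemma sum_CauchySchwarz (I : finType) (x y : I -> R) :
  \sum_i x i * y i <= Num.sqrt (\sum_i x i ^+ 2) * Num.sqrt (\sum_i y i ^+ 2).
Proof.
set X := Num.sqrt _; set Y := Num.sqrt _.
have sX : \sum_i x i ^+ 2 = X ^+ 2 by rewrite sqr_sqrtr // sumr_ge0 // => i _; exact: sqr_ge0.
have sY : \sum_i y i ^+ 2 = Y ^+ 2 by rewrite sqr_sqrtr // sumr_ge0 // => i _; exact: sqr_ge0.
have z (w : I -> R) : \sum_i w i ^+ 2 = 0 ^+ 2 -> forall i, w i = 0.
  rewrite expr0n /= => /eqP; rewrite psumr_eq0 => [/allP h i|i _]; last exact: sqr_ge0.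
  by have := h i (mem_index_enum i); rewrite /= sqrf_eq0 => /eqP.
have [X0|X0] := eqVneq X 0.
  by rewrite big1 ?X0 ?mul0r // => i _; rewrite z ?mul0r // sX X0.
have [Y0|Y0] := eqVneq Y 0.
  by rewrite big1 ?Y0 ?mulr0 // => i _; rewrite (z y) ?mulr0 // sY Y0.
have Xp : 0 < X by rewrite lt_def X0 sqrtr_ge0.
have Yp : 0 < Y by rewrite lt_def Y0 sqrtr_ge0.
(* The weights [Y / X] and [X / Y] are those for which the weighted inequality between geometric and
   arithmetic mean, applied termwise, sums to exactly [X * Y]. *)
have -> : X * Y = \sum_i ((Y / X) / 2 * x i ^+ 2 + (X / Y) / 2 * y i ^+ 2).
  by rewrite big_split -!mulr_sumr /= sX sY; field; rewrite X0 Y0.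
apply: ler_sum => i _; rewrite -subr_ge0.
have -> : Y / X / 2 * x i ^+ 2 + X / Y / 2 * y i ^+ 2 - x i * y i =
          (Y * x i - X * y i) ^+ 2 / (2 * X * Y) by field; rewrite X0 Y0.
by rewrite divr_ge0 ?sqr_ge0 // !mulr_ge0 // ltW.
Qed.

Lemma l2norm_ge0 v : 0 <= l2norm v. Proof. exact: sqrtr_ge0. Qed.

Lemma l2norm_sqr v : l2norm v ^+ 2 = \sum_i cabs (v i ord0) ^+ 2.
Proof. by rewrite sqr_sqrtr // sumr_ge0 // => i _; exact: sqr_ge0. Qed.

Lemma l2norm0 : l2norm (0 : 'cV[C]_4) = 0.
Proof. by rewrite /l2norm big1 ?sqrtr0 // => i _; rewrite mxE cabs0 expr0n. Qed.

Lemma l2norm_eq0 v : l2norm v = 0 -> v = 0.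
Proof.
move=> v0; have := l2norm_sqr v; rewrite v0 expr0n /= => /esym/eqP.
rewrite psumr_eq0 => [/allP h|i _]; last exact: sqr_ge0.
apply/matrixP => i j; rewrite !mxE ord1; have := h i (mem_index_enum i).
by rewrite /= sqrf_eq0 cabs_eq0 => /eqP.
Qed.

Lemma l2normZ (c : C) v : l2norm (c *: v) = cabs c * l2norm v.
Proof.
rewrite /l2norm -[cabs c in RHS]ger0_norm ?cabs_ge0 // -sqrtr_sqr -sqrtrM ?sqr_ge0 //.
by rewrite mulr_sumr; congr Num.sqrt; apply: eq_bigr => i _; rewrite mxE cabsM exprMn.
Qed.

Lemma l2normD u v : l2norm (u + v) <= l2norm u + l2norm v.
Proof.
rewrite -(@ler_pXn2r _ 2) ?nnegrE ?addr_ge0 ?l2norm_ge0 // sqrrD !l2norm_sqr.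
have := sum_CauchySchwarz (fun i => cabs (u i ord0)) (fun i => cabs (v i ord0)).
rewrite -/(l2norm u) -/(l2norm v) => h.
apply: (@le_trans _ _ (\sum_i (cabs (u i ord0) + cabs (v i ord0)) ^+ 2)).
  apply: ler_sum => i _.
  by rewrite mxE ler_pXn2r ?nnegrE ?addr_ge0 ?cabs_ge0 // cabsD.
under eq_bigr do rewrite sqrrD.
by rewrite big_split /= big_split /= sumrMnl !lerD // lerMn2r h orbT.
Qed.

Lemma l2norm_sum (I : finType) (F : I -> 'cV[C]_4) :
  l2norm (\sum_i F i) <= \sum_i l2norm (F i).
Proof.
elim/big_ind2: _ => [|x a y b xa yb|i _]; rewrite ?l2norm0 //.
exact: le_trans (l2normD _ _) (lerD xa yb).
Qed.

Lemma cabs_sum (I : finType) (F : I -> C) : cabs (\sum_i F i) <= \sum_i cabs (F i).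
Proof.
elim/big_ind2: _ => [|x a y b xa yb|i _]; rewrite ?cabs0 //.
exact: le_trans (cabsD _ _) (lerD xa yb).
Qed.

Lemma cabs_le_l2norm v i : cabs (v i ord0) <= l2norm v.
Proof.
rewrite -(@ler_pXn2r _ 2) ?nnegrE ?cabs_ge0 ?l2norm_ge0 // l2norm_sqr.
by rewrite (bigD1 i) //= lerDl sumr_ge0 // => j _; exact: sqr_ge0.
Qed.

Lemma cabs_dot u v : cabs ((u^t* *m v) ord0 ord0) <= l2norm u * l2norm v.
Proof.
rewrite mxE; apply: le_trans (cabs_sum _) _.
apply: le_trans (sum_CauchySchwarz _ _).
by apply: ler_sum => i _; rewrite !mxE cabsM cabs_conj.
Qed.

Lemma l2norm_dot v : (v^t* *m v) ord0 ord0 = (l2norm v ^+ 2)%:C.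
Proof.
rewrite l2norm_sqr mxE (rmorph_sum (real_complex R)) /=; apply: eq_bigr => i _.
by rewrite !mxE mulrC mulC_conj.
Qed.

Lemma l2norm_mul_bound M v :
  l2norm (M *m v) <= (\sum_i \sum_j cabs (M i j)) * l2norm v.
Proof.
have -> : M *m v = \sum_j v j ord0 *: col j M.
  apply/matrixP => i k; rewrite !mxE summxE; apply: eq_bigr => j _.
  by rewrite !mxE ord1 mulrC.
apply: le_trans (l2norm_sum _) _; rewrite exchange_big mulr_suml.
apply: ler_sum => j _; rewrite l2normZ mulrC ler_pM ?l2norm_ge0 ?cabs_ge0 ?cabs_le_l2norm //.
have -> : col j M = \sum_i M i j *: delta_mx i 0.
  apply/matrixP => i k; rewrite !mxE summxE (bigD1 i) //= big1 => [|l li].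
    by rewrite !mxE ord1 !eqxx mulr1 addr0.
  by rewrite !mxE eq_sym (negPf li) mulr0.
apply: le_trans (l2norm_sum _) _; apply: ler_sum => i _; rewrite l2normZ.
rewrite ler_piMr ?cabs_ge0 // /l2norm (bigD1 i) //= big1 => [|l li].
  by rewrite !mxE !eqxx cabs1 expr1n addr0 sqrtr1.
by rewrite !mxE (negPf li) cabs0 expr0n.
Qed.

Let unit_image M := [set l2norm (M *m v) | v in [set v : 'cV[C]_4 | l2norm v <= 1]].

Let unit_image_sup M : has_sup (unit_image M).
Proof.
split; first by exists (l2norm (M *m 0)); exists 0 => //=; rewrite l2norm0.
exists (\sum_i \sum_j cabs (M i j)) => _ [v /= v1 <-].
apply: le_trans (l2norm_mul_bound _ _) _.
by rewrite ler_piMr // !sumr_ge0 // => i _; rewrite sumr_ge0 // => j _; exact: cabs_ge0.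
Qed.

Lemma opnorm_ge0 M : 0 <= opnorm M.
Proof.
apply: (@le_trans _ _ (l2norm (M *m 0))); first exact: l2norm_ge0.
by apply: ub_le_sup; [case: (unit_image_sup M) | exists 0 => //=; rewrite l2norm0].
Qed.

Lemma opnorm_ub M v : l2norm (M *m v) <= opnorm M * l2norm v.
Proof.
have [/eqP v0|v0] := eqVneq (l2norm v) 0.
  by rewrite (l2norm_eq0 (eqP v0)) mulmx0 l2norm0 mulr0.
have vp : 0 < l2norm v by rewrite lt_def v0 l2norm_ge0.
rewrite -ler_pdivrMr // mulrC -[X in X * _]ger0_norm ?invr_ge0 ?l2norm_ge0 //.
rewrite -cabs_real -l2normZ scalemxAr.
apply: ub_le_sup; first by case: (unit_image_sup M).
exists ((l2norm v)^-1%:C *: v) => //=.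
by rewrite l2normZ cabs_real ger0_norm ?invr_ge0 ?l2norm_ge0 // mulVf.
Qed.

Lemma opnorm_le M (K : R) : 0 <= K -> (forall v, l2norm (M *m v) <= K * l2norm v) ->
  opnorm M <= K.
Proof.
move=> K0 h; apply: ge_sup; first by case: (unit_image_sup M).
by move=> _ [v /= v1 <-]; rewrite (le_trans (h v)) // ler_piMr.
Qed.

Lemma opnormD M N : opnorm (M + N) <= opnorm M + opnorm N.
Proof.
apply: opnorm_le; first by rewrite addr_ge0 ?opnorm_ge0.
move=> v; rewrite mulmxDl mulrDl; apply: le_trans (l2normD _ _) _.
by rewrite lerD ?opnorm_ub.
Qed.

Lemma opnormM M N : opnorm (M *m N) <= opnorm M * opnorm N.
Proof.
apply: opnorm_le; first by rewrite mulr_ge0 ?opnorm_ge0.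
move=> v; rewrite -mulmxA; apply: le_trans (opnorm_ub _ _) _.
by rewrite -mulrA ler_wpM2l ?opnorm_ge0 ?opnorm_ub.
Qed.

Lemma opnorm_entry M i j : cabs (M i j) <= opnorm M.
Proof.
have -> : M i j = (M *m (delta_mx j ord0 : 'cV_4)) i ord0 by rewrite -colE mxE.
apply: le_trans (cabs_le_l2norm _ _) _; apply: le_trans (opnorm_ub _ _) _.
rewrite ler_piMr ?opnorm_ge0 // /l2norm (bigD1 j) //= big1 => [|l li].
  by rewrite !mxE !eqxx cabs1 expr1n addr0 sqrtr1.
by rewrite !mxE (negPf li) cabs0 expr0n.
Qed.

Lemma opnorm_le_sum M : opnorm M <= \sum_i \sum_j cabs (M i j).
Proof.
apply: opnorm_le; last exact: l2norm_mul_bound.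
by rewrite !sumr_ge0 // => i _; rewrite sumr_ge0 // => j _; exact: cabs_ge0.
Qed.

Lemma opnorm_eq0 M : opnorm M = 0 -> M = 0.
Proof.
move=> M0; apply/matrixP => i j; rewrite mxE; apply/eqP; rewrite -cabs_eq0.
by rewrite eq_le cabs_ge0 andbT -M0 opnorm_entry.
Qed.

Lemma opnorm0 : opnorm (0 : 'M[C]_4) = 0.
Proof.
apply/eqP; rewrite eq_le opnorm_ge0 andbT; apply: opnorm_le => // v.
by rewrite mul0mx l2norm0 mul0r.
Qed.

Lemma opnormZ (c : C) M : opnorm (c *: M) = cabs c * opnorm M.
Proof.
have h d N : opnorm (d *: N) <= cabs d * opnorm N.
  apply: opnorm_le; first by rewrite mulr_ge0 ?opnorm_ge0 ?cabs_ge0.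
  by move=> v; rewrite -scalemxAl l2normZ -mulrA ler_wpM2l ?cabs_ge0 ?opnorm_ub.
have [->|c0] := eqVneq c 0; first by rewrite scale0r opnorm0 cabs0 mul0r.
apply/eqP; rewrite eq_le h /=.
have cp : 0 < cabs c by rewrite lt_def cabs_eq0 c0 cabs_ge0.
have := h c^-1 (c *: M); rewrite scalerA mulVf // scale1r.
by rewrite -(ler_pM2l cp) mulrA -cabsM mulfV // cabs1 mul1r.
Qed.

Lemma opnormN M : opnorm (- M) = opnorm M.
Proof. by rewrite -scaleN1r opnormZ cabsN cabs1 mul1r. Qed.

Lemma ctmxK M : (M^t*)^t* = M.
Proof. by apply/matrixP => i j; rewrite !mxE conjCK. Qed.

Lemma ctmxM m n p (A : 'M[C]_(m, n)) (B : 'M[C]_(n, p)) : (A *m B)^t* = B^t* *m A^t*.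
Proof. by rewrite trmx_mul map_mxM. Qed.

Let le_of_sqr_le (n s k : R) : 0 <= n -> 0 <= s -> n ^+ 2 <= k -> k <= s * n -> n <= s.
Proof.
move=> n0 s0 nk ks; have [->//|nz] := eqVneq n 0.
have np : 0 < n by rewrite lt_def nz.
by rewrite -(ler_pM2r np) -expr2; exact: le_trans nk ks.
Qed.

Let le_antisym (x y : R) : x <= y -> y <= x -> x = y.
Proof. by move=> xy yx; apply/eqP; rewrite eq_le xy. Qed.

Let sqr_sandwich (n s k : R) : 0 <= n -> n ^+ 2 <= k -> k <= s * n -> s <= n -> k = n ^+ 2.
Proof.
move=> n0 nk ks sn; apply/eqP; rewrite eq_le nk andbT; apply: le_trans ks _.
by rewrite expr2 ler_wpM2r.
Qed.

(** Cauchy-Schwarz gives the lower bound [h]. Combined with submultiplicativity it shows that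
    passing to the adjoint does not change the norm, whence the upper bound. *)
Lemma opnorm_cstar M : opnorm (M^t* *m M) = opnorm M ^+ 2.
Proof.
have h N : opnorm N ^+ 2 <= opnorm (N^t* *m N).
  rewrite -[leRHS]sqr_sqrtr ?opnorm_ge0 // ler_pXn2r ?nnegrE ?opnorm_ge0 ?sqrtr_ge0 //.
  apply: opnorm_le => [|v]; first exact: sqrtr_ge0.
  rewrite -(@ler_pXn2r _ 2) ?nnegrE ?mulr_ge0 ?l2norm_ge0 ?sqrtr_ge0 //.
  rewrite exprMn [X in X * _]sqr_sqrtr ?opnorm_ge0 //.
  have : cabs ((v^t* *m (N^t* *m N *m v)) ord0 ord0) <= l2norm v * (opnorm (N^t* *m N) * l2norm v).
    by apply: le_trans (cabs_dot _ _) _; rewrite ler_wpM2l ?l2norm_ge0 ?opnorm_ub.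
  rewrite -!mulmxA mulmxA -ctmxM l2norm_dot cabs_real ger0_norm ?sqr_ge0 //.
  by rewrite mulrCA -expr2.
have h2 N : opnorm N <= opnorm (N^t*).
  exact: (le_of_sqr_le (opnorm_ge0 N) (opnorm_ge0 (N^t*)) (h N) (opnormM (N^t*) N)).
have h3 : opnorm (M^t*) <= opnorm M by have := h2 (M^t*); rewrite ctmxK.
exact: (sqr_sandwich (opnorm_ge0 M) (h M) (opnormM (M^t*) M) h3).
Qed.

Lemma opnorm_star M : opnorm (M^t*) = opnorm M.
Proof.
have h2 N : opnorm N <= opnorm (N^t*).
  apply: (le_of_sqr_le (opnorm_ge0 N) (opnorm_ge0 (N^t*)) _ (opnormM (N^t*) N)).
  by rewrite opnorm_cstar.
have h3 : opnorm (M^t*) <= opnorm M by have := h2 (M^t*); rewrite ctmxK.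
exact: (le_antisym h3 (h2 M)).
Qed.

End OperatorNorm.

(** * Convergence of matrices and compactness of the domain *)

Section Topology.
Variable R : realType.
Local Notation C := (Cplx R).

Lemma cvg_cabsP (T : Type) (F : set_system T) (FF : Filter F) (f : T -> C) (z : C) :
  f @ F --> z <-> forall e : R, 0 < e -> \forall x \near F, cabs (z - f x) < e.
Proof.
split=> [/cvg_ballP h e e0|h].
  have e1 : 0 < e%:C :> C by rewrite ltcR.
  have := h _ e1; apply: filterS => x /=.
  by rewrite /ball /= -cabsE ltcR.
apply/cvg_ballP => e e0.
have er : e = (complex.Re e)%:C by rewrite RRe_real // gtr0_real.
rewrite er in e0 *; rewrite ltcR in e0.
apply: filterS (h _ e0) => x hx.
by rewrite /ball /= -cabsE ltcR.
Qed.

Lemma cvg_opnormP (T : Type) (F : set_system T) (FF : Filter F)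
    (f : T -> 'M[C]_4) (M : 'M[C]_4) :
  f @ F --> M <-> forall e : R, 0 < e -> \forall x \near F, opnorm (M - f x) < e.
Proof.
split=> [/cvg_ballP h e e0|h].
  (* There are 16 entries; the divisor 17 leaves room for a strict inequality after summation. *)
  have e1 : 0 < (e / 17)%:C :> C by rewrite ltcR divr_gt0.
  have := h _ e1; apply: filterS => x [_ hx].
  apply: le_lt_trans (opnorm_le_sum _) _.
  apply: (@le_lt_trans _ _ (\sum_(i < 4) \sum_(j < 4) (e / 17))).
    apply: ler_sum => i _; apply: ler_sum => j _.
    have := hx i j; rewrite /ball /= -cabsE ltcR => /ltW.
    by rewrite !mxE.
  rewrite !sumr_const !card_ord -mulrnA -mulr_natr.
  by lra.
apply/cvg_ballP => e e0.
have er : e = (complex.Re e)%:C by rewrite RRe_real // gtr0_real.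
rewrite er in e0 *; have e1 := e0; rewrite ltcR in e1.
apply: filterS (h _ e1) => x hx; split => // i j.
rewrite /ball /= -cabsE ltcR; apply: le_lt_trans hx.
by apply: le_trans (opnorm_entry _ i j); rewrite !mxE.
Qed.

Lemma cvg_entries (T : Type) (F : set_system T) (FF : Filter F)
    (f : T -> 'M[C]_4) (M : 'M[C]_4) :
  (forall i j, (fun x => f x i j) @ F --> M i j) -> f @ F --> M.
Proof.
move=> h; apply/cvg_ballP => e e0.
have hij i j : \forall x \near F, ball (M i j) e (f x i j).
  by have /cvg_ballP := h i j; exact.
have : \forall x \near F, forall ij : 'I_4 * 'I_4, ball (M ij.1 ij.2) e (f x ij.1 ij.2).
  by apply: filter_forall => -[i j].
by apply: filterS => x hx; split => // i j; exact: hx (i, j).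
Qed.

Lemma continuous_complex (T : topologicalType) (f g : T -> R) :
  continuous f -> continuous g -> continuous (fun x => f x +i* g x : C).
Proof.
move=> cf cg x; apply/cvg_cabsP => e e0.
have e2 : 0 < e / 2 by rewrite divr_gt0.
have /cvgrPdist_lt hf := cf x; have /cvgrPdist_lt hg := cg x.
near=> y.
have -> : (f x +i* g x) - (f y +i* g y) = (f x - f y)%:C + 'i * (g x - g y)%:C :> C.
  by rewrite [LHS]complexE.
apply: le_lt_trans (cabsD _ _) _; rewrite cabsM cabs_i mul1r !cabs_real.
rewrite (splitr e) ltrD //; near: y; [exact: hf|exact: hg].
Unshelve. all: end_near.
Qed.

Lemma continuous_realc (T : topologicalType) (f : T -> R) :
  continuous f -> continuous (fun x => (f x)%:C : C).
Proof. by move=> cf; apply: continuous_complex => //; move=> x; exact: cvg_cst. Qed.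

Lemma continuous_conj (T : topologicalType) (f : T -> C) :
  continuous f -> continuous (fun x => (f x)^*).
Proof.
move=> cf x; apply/cvg_cabsP => e e0; have /cvg_cabsP h := cf x.
by apply: filterS (h _ e0) => y; rewrite -rmorphB cabs_conj.
Qed.

(** The factors of [dom] are sets coerced to types, so compactness must pass from the set to the
    type: a filter on the type is pushed forward along the inclusion, and its cluster point is
    pulled back. *)
Lemma compact_set_type (X : topologicalType) (K : set X) :
  compact K -> compact [set: K].
Proof.
move=> cK F FF _.
have FK : F (set_val @^-1` K).
  by apply: (@filterS _ F _ setT) => [y _|]; [exact: set_valP|exact: filterT].
have [x [Kx clx]] := cK (set_val @ F) _ FK.
exists (exist _ x (mem_set Kx)); split => // B U FB.
rewrite nbhsE /= => -[V [[W oW <-] /= Wx] VU].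
have FB' : F (set_val @^-1` (set_val @` B)).
  by apply: (@filterS _ F _ B) => // y By; exists y.
have Wx' : nbhs x W by exact: open_nbhs_nbhs.
have [_ [[y By <-] Wy]] := clx _ _ FB' Wx'.
by exists y; split => //; apply: VU.
Qed.

Lemma cexp_continuous : continuous (@cexp R).
Proof.
by apply: continuous_complex => x; [exact: continuous_cos|exact: continuous_sin].
Qed.

Lemma cexp_surj (z : C) : `|z| = 1 -> exists2 phi, is_angle phi & z = cexp phi.
Proof.
case: z => a b; rewrite normc_def /= => -[ab1].
have ab : a ^+ 2 + b ^+ 2 = 1.
  by rewrite -[LHS]sqr_sqrtr ?addr_ge0 ?sqr_ge0 // ab1 expr1n.
have a1 : -1 <= a <= 1.
  have a2 : a ^+ 2 <= 1 by rewrite -ab lerDl sqr_ge0.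
  by move: a2; rewrite expr2; nra.
have sb : Num.sqrt (1 - a ^+ 2) = `|b| by rewrite -ab addrAC subrr add0r sqrtr_sqr.
have [b0|b0] := leP 0 b.
  exists (acos a); last by rewrite /cexp acosK ?in_itv //= sin_acos // sb ger0_norm.
  rewrite /is_angle acos_ge0 //= (le_trans (acos_lepi a1)) //.
  by rewrite ler_peMl ?pi_ge0 // ler1n.
exists (2 * pi - acos a).
  rewrite /is_angle gerBl acos_ge0 // andbT subr_ge0 (le_trans (acos_lepi a1)) //.
  by rewrite ler_peMl ?pi_ge0 // ler1n.
rewrite /cexp (_ : 2 * pi - acos a = - acos a + pi *+ 2); last first.
  by rewrite mulr2n; ring.
by rewrite cosD2pi sinD2pi cosN sinN acosK ?in_itv //= sin_acos // sb ltr0_norm // opprK.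
Qed.

Lemma compact_circle : compact (circle R).
Proof.
have -> : circle R = @cexp R @` `[0, 2 * pi]%classic.
  apply/seteqP; split => [z /= /cexp_surj[phi h ->]|_ [phi _ <-]].
    by exists phi => //=; rewrite in_itv.
  by have /set_mem := cexp_circle phi.
apply: continuous_compact; last exact: segment_compact.
by apply: continuous_subspaceT; exact: cexp_continuous.
Qed.

Lemma compact_dom : compact [set: dom R].
Proof.
have cI : compact [set: Iunit R] by apply: compact_set_type; exact: segment_compact.
have cH : compact [set: Ihalf R] by apply: compact_set_type; exact: segment_compact.
have cC : compact [set: circle R] by apply: compact_set_type; exact: compact_circle.
rewrite /dom; do 5 (rewrite -setXTT; apply: compact_setX; last by []).
exact: cI.
Qed.

End Topology.

#[local] Opaque opnorm.

(** * The supremum norm and uniform limits *)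

Section Supnorm.
Variable R : realType.
Local Notation C := (Cplx R).
Implicit Types f g : dom R -> 'M[C]_4.

Definition point_dom : dom R := pt unit0 half0 half0 0 0 0.

Lemma ler_opnorm_dist (x y z : 'M[C]_4) :
  opnorm (x - z) <= opnorm (x - y) + opnorm (y - z).
Proof. by have := opnormD (x - y) (y - z); rewrite addrA subrK. Qed.

Lemma opnormBC (x y : 'M[C]_4) : opnorm (x - y) = opnorm (y - x).
Proof. by rewrite -opnormN opprB. Qed.

Lemma continuous_opnorm (T : topologicalType) (f : T -> 'M[C]_4) :
  continuous f -> continuous (fun x => opnorm (f x)).
Proof.
move=> cf x; apply/cvgrPdist_lt => e e0; have /cvg_opnormP h := cf x.
apply: filterS (h _ e0) => y; apply: le_lt_trans.
rewrite ler_norml; apply/andP; split.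
  rewrite lerNl opprB lerBlDr -(opnormN (_ - _)) opprB.
  by apply: le_trans (opnormD _ _); rewrite subrK.
by rewrite lerBlDr; apply: le_trans (opnormD _ _); rewrite subrK.
Qed.

Lemma has_sup_supnorm f : continuous f -> has_sup (range (@opnorm R \o f)).
Proof.
move=> cf; split; first by exists (opnorm (f point_dom)), point_dom.
have : compact (range (@opnorm R \o f)).
  apply: continuous_compact; last exact: compact_dom.
  by apply: continuous_subspaceT; exact: continuous_opnorm.
move=> /compact_bounded[M [_ h]]; exists (M + 1) => _ [p _ <-].
apply: le_trans (ler_norm _) _; apply: h; last by exists p.
by rewrite ltrDl.
Qed.

Lemma supnorm_ub f p : continuous f -> opnorm (f p) <= supnorm f.
Proof. by move=> /has_sup_supnorm[_ h]; apply: ub_le_sup => //; exists p. Qed.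

Lemma supnorm_le f (K : R) : (forall p, opnorm (f p) <= K) -> supnorm f <= K.
Proof.
move=> h; apply: ge_sup; first by exists (opnorm (f point_dom)), point_dom.
by move=> _ [p _ <-]; exact: h.
Qed.

Lemma cauchy_real (u : nat -> R) :
  (forall e, 0 < e -> exists N, forall m n, (N <= m)%N -> (N <= n)%N -> `|u m - u n| < e) ->
  exists l : R, u @ \oo --> l.
Proof.
move=> h; suff : cauchy (u @ \oo) by move=> /cauchy_cvgP ?; exists (lim (u @ \oo)).
apply: cauchy_exP => e e0; have [N hN] := h e e0.
exists (u N); exists N => // n /= Nn; exact: hN.
Qed.

Lemma ler_Re_cabs (z : C) : `|complex.Re z| <= cabs z.
Proof. by rewrite -lecR cabsE; exact: normc_ge_Re. Qed.

Lemma ler_Im_cabs (z : C) : `|complex.Im z| <= cabs z.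
Proof.
case: z => a b; rewrite /cabs normc_def /= -sqrtr_sqr ler_wsqrtr //.
by rewrite lerDr sqr_ge0.
Qed.

Lemma cauchy_cplx (u : nat -> C) :
  (forall e : R, 0 < e -> exists N, forall m n, (N <= m)%N -> (N <= n)%N ->
     cabs (u m - u n) < e) ->
  exists l : C, u @ \oo --> l.
Proof.
move=> h.
have [|a ca] := @cauchy_real (fun n => complex.Re (u n)).
  move=> e /h[N hN]; exists N => m n Nm Nn.
  apply: le_lt_trans (hN _ _ Nm Nn); rewrite (le_trans _ (ler_Re_cabs _)) //.
  by case: (u m) (u n) => [? ?] [? ?].
have [|b cb] := @cauchy_real (fun n => complex.Im (u n)).
  move=> e /h[N hN]; exists N => m n Nm Nn.
  apply: le_lt_trans (hN _ _ Nm Nn); rewrite (le_trans _ (ler_Im_cabs _)) //.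
  by case: (u m) (u n) => [? ?] [? ?].
exists (a +i* b); apply/cvg_cabsP => e e0.
have e2 : 0 < e / 2 by rewrite divr_gt0.
move/cvgrPdist_lt: ca => ca; move/cvgrPdist_lt: cb => cb.
near=> n.
have -> : (a +i* b) - u n = (a - complex.Re (u n))%:C + 'i * (b - complex.Im (u n))%:C :> C.
  by rewrite [LHS]complexE; case: (u n).
apply: le_lt_trans (cabsD _ _) _; rewrite cabsM cabs_i mul1r !cabs_real.
rewrite (splitr e) ltrD //; near: n; [exact: ca|exact: cb].
Unshelve. all: end_near.
Qed.

Lemma cauchy_mx (u : nat -> 'M[C]_4) :
  (forall e : R, 0 < e -> exists N, forall m n, (N <= m)%N -> (N <= n)%N ->
     opnorm (u m - u n) < e) ->
  exists l : 'M[C]_4, u @ \oo --> l.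
Proof.
move=> h.
have hij (ij : 'I_4 * 'I_4) : exists l : C, (fun n => u n ij.1 ij.2) @ \oo --> l.
  apply: cauchy_cplx => e /h[N hN]; exists N => m n Nm Nn.
  apply: le_lt_trans (hN _ _ Nm Nn); apply: le_trans (opnorm_entry _ ij.1 ij.2).
  by rewrite !mxE.
have [l hl] := choice hij.
exists (\matrix_(i, j) l (i, j)); apply: cvg_entries => i j; rewrite mxE.
exact: hl (i, j).
Qed.

Lemma uniform_limit (u : nat -> dom R -> 'M[C]_4) : (forall n, continuous (u n)) ->
  (forall e : R, 0 < e -> exists N, forall m n, (N <= m)%N -> (N <= n)%N ->
     forall p, opnorm (u m p - u n p) < e) ->
  exists f, continuous f /\
    forall e : R, 0 < e -> exists N, forall n, (N <= n)%N -> forall p, opnorm (u n p - f p) <= e.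
Proof.
move=> cu h.
have hp p : exists l : 'M[C]_4, (fun n => u n p) @ \oo --> l.
  by apply: cauchy_mx => e /h[N hN]; exists N => m n Nm Nn; exact: hN.
have [f hf] := choice hp.
have unif e : 0 < e -> exists N, forall n, (N <= n)%N -> forall p, opnorm (u n p - f p) <= e.
  move=> e0; have [N hN] := h e e0; exists N => n Nn p.
  apply/ler_addgt0Pr => d d0.
  have /cvg_opnormP/(_ _ d0)[N' _ hN'] := hf p.
  have h1 := hN _ _ Nn (leq_maxl N N') p.
  have h2 := hN' _ (leq_maxr N N').
  have -> : u n p - f p = (u n p - u (maxn N N') p) - (f p - u (maxn N N') p).
    by rewrite opprB addrA subrK.
  by apply: le_trans (opnormD _ _) _; rewrite opnormN ltW // ltrD.
exists f; split => // p; apply/cvg_opnormP => e e0.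
have e3 : 0 < e / 3 by rewrite divr_gt0.
have [N hN] := unif _ e3.
have /cvg_opnormP/(_ _ e3) := cu N p; apply: filterS => q hq.
have h1 := hN _ (leqnn N) p; have h2 := hN _ (leqnn N) q.
have h3 := ler_opnorm_dist (f p) (u N p) (f q); rewrite (opnormBC (f p) (u N p)) in h3.
apply: (le_lt_trans h3).
have h4 := ler_opnorm_dist (u N p) (u N q) (f q).
have e33 : e = e / 3 + (e / 3 + e / 3) by field.
by rewrite [ltRHS]e33; exact: (ler_ltD h1 (le_lt_trans h4 (ltr_leD hq h2))).
Qed.

End Supnorm.

#[local] Opaque supnorm.

Section MatrixLimits.
Variables (R : realType) (T : Type) (F : set_system T) (FF : Filter F).
Local Notation C := (Cplx R).

Lemma cvg_sumC (I : Type) (r : seq I) (f : I -> T -> C) (l : I -> C) :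
  (forall i, f i @ F --> l i) ->
  (fun x => \sum_(i <- r) f i x) @ F --> \sum_(i <- r) l i.
Proof.
move=> h; elim: r => [|i r ih].
  by rewrite big_nil; under eq_fun do rewrite big_nil; exact: cvg_cst.
rewrite big_cons; under eq_fun do rewrite big_cons.
exact: (cvgD (h i) ih).
Qed.

Lemma cvg_entry (f : T -> 'M[C]_4) (M : 'M[C]_4) i j :
  f @ F --> M -> (fun x => f x i j) @ F --> M i j.
Proof.
move=> /cvg_opnormP h; apply/cvg_cabsP => e /h; apply: filterS => x.
by apply: le_lt_trans; apply: le_trans (opnorm_entry _ i j); rewrite !mxE.
Qed.

Lemma cvg_mulmx (f g : T -> 'M[C]_4) (M N : 'M[C]_4) :
  f @ F --> M -> g @ F --> N -> (fun x => f x *m g x) @ F --> M *m N.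
Proof.
move=> fM gN; apply: cvg_entries => i j; rewrite mxE.
under eq_fun do rewrite mxE.
by apply: cvg_sumC => k; apply: cvgM; apply: cvg_entry.
Qed.

Lemma cvg_ctmx (f : T -> 'M[C]_4) (M : 'M[C]_4) :
  f @ F --> M -> (fun x => (f x)^t*) @ F --> M^t*.
Proof.
move=> /cvg_opnormP h; apply/cvg_opnormP => e /h; apply: filterS => x.
suff -> : M^t* - (f x)^t* = (M - f x)^t* by rewrite opnorm_star.
by rewrite linearB /= map_mxB.
Qed.

End MatrixLimits.

(** * The function algebra *)

Section EquivariantAlgebra.
Variable R : realType.
Local Notation C := (Cplx R).
Local Notation Mat := 'M[C]_4.
(* [L p V q] asks the value at [q] to be the value at [p] conjugated by the
   unitary [V].  All boundary conditions have this form: lying in a relative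
   commutant means being fixed by conjugation with a symmetry, where [p = q]. *)
Variable L : dom R -> Mat -> dom R -> Prop.

(** Unitarity is a premise here and not part of [L], so that the function algebra can be formed for
    any family [U], before it is known to be an intertwiner. *)
Definition equivariant (f : dom R -> Mat) :=
  forall p V q, L p V q -> V \is unitarymx -> V^t* *m f p *m V = f q.

Definition is_section (f : dom R -> Mat) := continuous f /\ equivariant f.

Definition balg := {f : dom R -> Mat | is_section f}.
Implicit Types f g : balg.
Local Notation fn := (@sval _ _).

Lemma balgP f g : (forall p, fn f p = fn g p) -> f = g.
Proof.
case: f g => [f hf] [g hg] /= /funext fg; subst g.
by congr exist; exact: Prop_irrelevance.
Qed.

Lemma is_section_cst (c : C) : is_section (fun=> c%:M).
Proof.
split; first by move=> p; exact: cvg_cst.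
move=> p V q _ /unitarymxP VV.
by rewrite mul_mx_scalar -scalemxAl (mulmx1C VV) scalemx1.
Qed.

Lemma is_sectionD u v : is_section u -> is_section v -> is_section (fun p => u p + v p).
Proof.
move=> [cu eu] [cv ev]; split; first by move=> p; apply: cvgD; [exact: cu|exact: cv].
by move=> p V q Lpq uV; rewrite mulmxDr mulmxDl (eu p V q) // (ev p V q).
Qed.

Lemma is_sectionM u v : is_section u -> is_section v -> is_section (fun p => u p *m v p).
Proof.
move=> [cu eu] [cv ev]; split.
  by move=> p; apply: cvg_mulmx; [exact: cu|exact: cv].
move=> p V q Lpq uV; rewrite -(eu p V q) // -(ev p V q) //.
by rewrite !mulmxA mulmxtVK.
Qed.

Lemma is_sectionZ (c : C) u : is_section u -> is_section (fun p => c *: u p).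
Proof.
move=> su; have := is_sectionM (is_section_cst c) su.
by under eq_fun do rewrite mul_scalar_mx.
Qed.

Lemma is_section_star u : is_section u -> is_section (fun p => (u p)^t*).
Proof.
move=> [cu eu]; split; first by move=> p; apply: cvg_ctmx; exact: cu.
by move=> p V q Lpq uV; rewrite -(eu p V q) // !ctmxM ctmxK mulmxA.
Qed.

Definition balg0 : balg := exist _ _ (is_section_cst 0).
Definition balg1 : balg := exist _ _ (is_section_cst 1).
Definition balgD f g : balg := exist _ _ (is_sectionD (svalP f) (svalP g)).
Definition balgM f g : balg := exist _ _ (is_sectionM (svalP f) (svalP g)).
Definition balgZ (c : C) f : balg := exist _ _ (is_sectionZ c (svalP f)).
Definition balg_star f : balg := exist _ _ (is_section_star (svalP f)).
Definition balgN f := balgZ (-1) f.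

HB.instance Definition _ := gen_eqMixin balg.
HB.instance Definition _ := gen_choiceMixin balg.

Fact balg_addA : associative balgD.
Proof. by move=> f g h; apply: balgP => p; exact: addrA. Qed.
Fact balg_addC : commutative balgD.
Proof. by move=> f g; apply: balgP => p; exact: addrC. Qed.
Fact balg_add0 : left_id balg0 balgD.
Proof. by move=> f; apply: balgP => p; rewrite /= raddf0 add0r. Qed.
Fact balg_addN : left_inverse balg0 balgN balgD.
Proof. by move=> f; apply: balgP => p; rewrite /= raddf0 scaleN1r addNr. Qed.
HB.instance Definition _ :=
  GRing.isZmodule.Build balg balg_addA balg_addC balg_add0 balg_addN.

Fact balg_mulA : associative balgM.
Proof. by move=> f g h; apply: balgP => p; exact: mulmxA. Qed.
Fact balg_mul1 : left_id balg1 balgM.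
Proof. by move=> f; apply: balgP => p; exact: mul1mx. Qed.
Fact balg_1mul : right_id balg1 balgM.
Proof. by move=> f; apply: balgP => p; exact: mulmx1. Qed.
Fact balg_mulDl : left_distributive balgM +%R.
Proof. by move=> f g h; apply: balgP => p; exact: mulmxDl. Qed.
Fact balg_mulDr : right_distributive balgM +%R.
Proof. by move=> f g h; apply: balgP => p; exact: mulmxDr. Qed.
Fact balg_1neq0 : balg1 != 0 :> balg.
Proof.
apply/eqP => /(congr1 (fun f : balg => fn f (point_dom R) ord0 ord0)).
by rewrite /= !mxE /= => /eqP; rewrite oner_eq0.
Qed.
HB.instance Definition _ := GRing.Zmodule_isNzRing.Build balg
  balg_mulA balg_mul1 balg_1mul balg_mulDl balg_mulDr balg_1neq0.

Fact balg_scaleA (a b : C) f : balgZ a (balgZ b f) = balgZ (a * b) f.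
Proof. by apply: balgP => p; exact: scalerA. Qed.
Fact balg_scale1 : left_id 1 balgZ.
Proof. by move=> f; apply: balgP => p; exact: scale1r. Qed.
Fact balg_scaleDr : right_distributive balgZ +%R.
Proof. by move=> c f g; apply: balgP => p; exact: scalerDr. Qed.
Fact balg_scaleDl f : {morph balgZ^~ f : a b / a + b}.
Proof. by move=> a b; apply: balgP => p; exact: scalerDl. Qed.
HB.instance Definition _ := GRing.Zmodule_isLmodule.Build C balg
  balg_scaleA balg_scale1 balg_scaleDr balg_scaleDl.
Fact balg_scaleAl (c : C) f g : c *: (f * g) = c *: f * g.
Proof. by apply: balgP => p; exact: scalemxAl. Qed.
HB.instance Definition _ := GRing.Lmodule_isLalgebra.Build C balg balg_scaleAl.
Fact balg_scaleAr (c : C) f g : c *: (f * g) = f * (c *: g).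
Proof. by apply: balgP => p; exact: scalemxAr. Qed.
HB.instance Definition _ := GRing.Lalgebra_isAlgebra.Build C balg balg_scaleAr.

Lemma balgDE f g p : fn (f + g) p = fn f p + fn g p. Proof. by []. Qed.
Lemma balgME f g p : fn (f * g) p = fn f p *m fn g p. Proof. by []. Qed.
Lemma balgZE (c : C) f p : fn (c *: f) p = c *: fn f p. Proof. by []. Qed.
Lemma balgNE f p : fn (- f) p = - fn f p. Proof. exact: scaleN1r. Qed.
Lemma balgBE f g p : fn (f - g) p = fn f p - fn g p.
Proof. by rewrite balgDE balgNE. Qed.
Lemma balg1E p : fn (1 : balg) p = 1%:M. Proof. by []. Qed.
Lemma balg0E p : fn (0 : balg) p = 0. Proof. by rewrite /= raddf0. Qed.

Definition balg_norm f : R := supnorm (fn f).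

Lemma balg_ub f p : opnorm (fn f p) <= balg_norm f.
Proof. exact: supnorm_ub (svalP f).1. Qed.

Lemma balg_norm_ge0 f : 0 <= balg_norm f.
Proof. exact: le_trans (opnorm_ge0 _) (balg_ub f (point_dom R)). Qed.

Fact balg_starK : involutive balg_star.
Proof. by move=> f; apply: balgP => p; exact: ctmxK. Qed.
Fact balg_starD : {morph balg_star : f g / f + g}.
Proof. by move=> f g; apply: balgP => p; rewrite /= linearD /= map_mxD. Qed.
Fact balg_starZ (c : C) f : balg_star (c *: f) = c^* *: balg_star f.
Proof. by apply: balgP => p; rewrite /= linearZ /= map_mxZ. Qed.
Fact balg_starM f g : balg_star (f * g) = balg_star g * balg_star f.
Proof. by apply: balgP => p; exact: ctmxM. Qed.
Fact balg_norm_eq0 f : balg_norm f = 0 -> f = 0.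
Proof.
move=> f0; apply: balgP => p; rewrite balg0E; apply: opnorm_eq0; apply/eqP.
by rewrite eq_le opnorm_ge0 andbT -f0 balg_ub.
Qed.
Fact balg_normD f g : balg_norm (f + g) <= balg_norm f + balg_norm g.
Proof.
apply: supnorm_le => p; apply: le_trans (opnormD _ _) _.
by rewrite lerD ?balg_ub.
Qed.
Fact balg_normZ (c : C) f : balg_norm (c *: f) = cabs c * balg_norm f.
Proof.
have h d g : balg_norm (d *: g) <= cabs d * balg_norm g.
  apply: supnorm_le => p; rewrite balgZE opnormZ.
  by rewrite ler_wpM2l ?cabs_ge0 ?balg_ub.
have [->|c0] := eqVneq c 0.
  rewrite cabs0 mul0r; apply/eqP; rewrite eq_le balg_norm_ge0 andbT.
  by apply: le_trans (h _ _) _; rewrite cabs0 mul0r.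
have cp : 0 < cabs c by rewrite lt_def cabs_eq0 c0 cabs_ge0.
apply/eqP; rewrite eq_le h /=.
have := h c^-1 (c *: f); rewrite scalerA mulVf // scale1r.
by rewrite -(ler_pM2l cp) mulrA -cabsM mulfV // cabs1 mul1r.
Qed.
Fact balg_normM f g : balg_norm (f * g) <= balg_norm f * balg_norm g.
Proof.
apply: supnorm_le => p; apply: le_trans (opnormM _ _) _.
by rewrite ler_pM ?opnorm_ge0 ?balg_ub.
Qed.
Fact balg_norm_cstar f : balg_norm (balg_star f * f) = balg_norm f ^+ 2.
Proof.
apply/eqP; rewrite eq_le; apply/andP; split.
  apply: supnorm_le => p; rewrite balgME opnorm_cstar.
  by rewrite ler_pXn2r ?nnegrE ?opnorm_ge0 ?balg_norm_ge0 ?balg_ub.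
rewrite -[leRHS]sqr_sqrtr ?balg_norm_ge0 // ler_pXn2r ?nnegrE ?sqrtr_ge0 ?balg_norm_ge0 //.
apply: supnorm_le => p.
rewrite -(@ler_pXn2r _ 2) ?nnegrE ?opnorm_ge0 ?sqrtr_ge0 //.
by rewrite sqr_sqrtr ?balg_norm_ge0 // -opnorm_cstar; exact: (balg_ub (balg_star f * f)).
Qed.
Fact balg_complete (u : nat -> balg) :
  (forall e : R, 0 < e -> exists N : nat, forall m n : nat,
     (N <= m)%N -> (N <= n)%N -> balg_norm (u m - u n) < e) ->
  exists l : balg, (fun n => balg_norm (u n - l)) @ \oo --> (0 : R).
Proof.
move=> h; have [||l [cl ul]] := @uniform_limit R (fun n => fn (u n)).
- by move=> n; case: (svalP (u n)).
- move=> e /h[N hN]; exists N => m n Nm Nn p.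
  by apply: le_lt_trans (hN _ _ Nm Nn); rewrite -balgBE balg_ub.
have el : equivariant l.
  move=> p V q Lpq uV; apply/eqP; rewrite -subr_eq0; apply/eqP.
  apply: opnorm_eq0; apply/eqP; rewrite eq_le opnorm_ge0 andbT.
  (* [k] bounds the effect of conjugation by [V]; approximation up to [e / (1 + k)] makes the errors
     at [q] and at [p] add up to [e]. *)
  have [k k0 kE] : exists2 k : R, 0 <= k & opnorm (V^t*) * opnorm V = k.
    by exists (opnorm (V^t*) * opnorm V); rewrite ?mulr_ge0 ?opnorm_ge0.
  have K0 : 0 < 1 + k by rewrite ltr_wpDr.
  apply/ler_addgt0Pr => e e0; rewrite add0r.
  have [N /(_ _ (leqnn N)) hN] := ul _ (divr_gt0 e0 K0).
  have -> : V^t* *m l p *m V - l q = (fn (u N) q - l q) - V^t* *m (fn (u N) p - l p) *m V.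
    rewrite mulmxBr mulmxBl; have [_ eu] := svalP (u N).
    by rewrite (eu p V q) // addlKB opprK addrC.
  apply: le_trans (opnormD _ _) _; rewrite opnormN.
  have h1 : opnorm (V^t* *m (fn (u N) p - l p) *m V) <= k * (e / (1 + k)).
    apply: le_trans (opnormM _ _) _; have := hN p.
    move: (e / _) => d hd; rewrite -kE mulrAC ler_wpM2r ?opnorm_ge0 //.
    by apply: le_trans (opnormM _ _) _; rewrite ler_wpM2l ?opnorm_ge0.
  apply: le_trans (lerD (hN q) h1) _.
  by rewrite -{1}[e / _]mul1r -mulrDl mulrCA divff ?mulr1 ?gt_eqF.
exists (exist _ l (conj cl el)); apply/cvgrPdist_le => e e0.
have [N hN] := ul e e0; exists N => // n /= Nn.
rewrite sub0r normrN ger0_norm ?balg_norm_ge0 //.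
by apply: supnorm_le => p; rewrite balgBE; exact: hN.
Qed.

Definition balg_cstar : cstarType R :=
  @CStarType R balg balg_star balg_norm balg_starK balg_starD balg_starZ balg_starM
    balg_norm_eq0 balg_normD balg_normZ balg_normM balg_norm_cstar balg_complete.

End EquivariantAlgebra.

(** * Kronecker products and the boundary conditions *)

Section TwoByTwo.
Variable R : realType.
Local Notation C := (Cplx R).
Implicit Types (a b c d : C) (A B : 'M[C]_2).

Lemma mx2E A : A = mx2 (A 0 0) (A 0 1) (A 1 0) (A 1 1).
Proof.
apply/matrixP => i j; rewrite mxE.
by case: i => -[|[|//]] hi; case: j => -[|[|//]] hj; congr (A _ _); exact: val_inj.
Qed.

Lemma mx2M a b c d a' b' c' d' :
  mx2 a b c d *m mx2 a' b' c' d' =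
  mx2 (a * a' + b * c') (a * b' + b * d') (c * a' + d * c') (c * b' + d * d').
Proof.
apply/matrixP => i j; rewrite !mxE !big_ord_recl big_ord0 addr0 !mxE /=.
by case: i => -[|[|//]] hi; case: j => -[|[|//]] hj.
Qed.

Lemma mx2D a b c d a' b' c' d' :
  mx2 a b c d + mx2 a' b' c' d' = mx2 (a + a') (b + b') (c + c') (d + d').
Proof.
apply/matrixP => i j; rewrite !mxE.
by case: i => -[|[|//]] hi; case: j => -[|[|//]] hj.
Qed.

Lemma mx2Z k a b c d : k *: mx2 a b c d = mx2 (k * a) (k * b) (k * c) (k * d).
Proof.
apply/matrixP => i j; rewrite !mxE.
by case: i => -[|[|//]] hi; case: j => -[|[|//]] hj.
Qed.

Lemma mx2_ctmx a b c d : (mx2 a b c d)^t* = mx2 a^* c^* b^* d^*.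
Proof.
apply/matrixP => i j; rewrite !mxE.
by case: i => -[|[|//]] hi; case: j => -[|[|//]] hj.
Qed.

Lemma mx2_scalar a : a%:M = mx2 a 0 0 a.
Proof.
apply/matrixP => i j; rewrite !mxE.
by case: i => -[|[|//]] hi; case: j => -[|[|//]] hj.
Qed.

Lemma mx2_0 : 0 = mx2 0 0 0 0 :> 'M[C]_2.
Proof. by rewrite -mx2_scalar raddf0. Qed.

Lemma mx2_inj a b c d a' b' c' d' : mx2 a b c d = mx2 a' b' c' d' ->
  [/\ a = a', b = b', c = c' & d = d'].
Proof.
by move/matrixP => h; split; [move: (h 0 0)|move: (h 0 1)|move: (h 1 0)|move: (h 1 1)];
  rewrite !mxE.
Qed.

Lemma kronE a b c d B :
  kron (mx2 a b c d) B = block_mx (a *: B) (b *: B) (c *: B) (d *: B).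
Proof.
have un (i : 'I_2) : @mxtens_unindex 2 2 (lshift 2 i) = (ord0, i).
  by case: i => -[|[|//]] hi; congr (_, _); exact: val_inj.
have un1 (i : 'I_2) : @mxtens_unindex 2 2 (rshift 2 i) = (1, i).
  by case: i => -[|[|//]] hi; congr (_, _); exact: val_inj.
have sl (i : 'I_2) : fintype.split (lshift 2 i) = inl i := unsplitK (inl i).
have sr (i : 'I_2) : fintype.split (rshift 2 i) = inr i := unsplitK (inr i).
apply/matrixP => i j; rewrite /kron [LHS]mxE.
by case: (split_ordP (i : 'I_(2 + 2))) => i' ->; case: (split_ordP (j : 'I_(2 + 2))) => j' ->;
  rewrite ?un ?un1 !mxE ?sl ?sr !mxE ?sl ?sr !mxE.
Qed.

Lemma kronM A A' B B' : kron A B *m kron A' B' = kron (A *m A') (B *m B').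
Proof. by rewrite /kron (@tensmx_mul C 2 2 2 2 2 2). Qed.

Lemma kron_ctmx A B : (kron A B)^t* = kron (A^t*) (B^t*).
Proof. by apply/matrixP => i j; rewrite !mxE rmorphM. Qed.

Lemma kron1 : kron 1%:M 1%:M = 1%:M :> 'M[C]_4.
Proof.
rewrite mx2_scalar kronE -mx2_scalar !scale1r !scale0r.
by rewrite -scalar_mx_block.
Qed.

Lemma kronZl k A B : k *: kron A B = kron (k *: A) B.
Proof. by apply/matrixP => i j; rewrite !mxE mulrA. Qed.

Lemma kronZr k A B : k *: kron A B = kron A (k *: B).
Proof. by apply/matrixP => i j; rewrite !mxE mulrCA. Qed.

Lemma kronDl A A' B : kron A B + kron A' B = kron (A + A') B.
Proof. by apply/matrixP => i j; rewrite !mxE mulrDl. Qed.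

Lemma kronDr A B B' : kron A B + kron A B' = kron A (B + B').
Proof. by apply/matrixP => i j; rewrite !mxE mulrDr. Qed.

Lemma kronNl A B : - kron A B = kron (- A) B.
Proof. by rewrite -scaleN1r kronZl scaleN1r. Qed.

Implicit Types (X Y Z T : 'M[C]_2).

Lemma blkM X Y Z T X' Y' Z' T' :
  (block_mx X Y Z T : 'M[C]_4) *m (block_mx X' Y' Z' T' : 'M[C]_4) =
  block_mx (X *m X' + Y *m Z') (X *m Y' + Y *m T')
           (Z *m X' + T *m Z') (Z *m Y' + T *m T').
Proof. exact: (mulmx_block X Y Z T X' Y' Z' T'). Qed.

Lemma blkD X Y Z T X' Y' Z' T' :
  (block_mx X Y Z T : 'M[C]_4) + (block_mx X' Y' Z' T' : 'M[C]_4) =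
  block_mx (X + X') (Y + Y') (Z + Z') (T + T').
Proof. exact: (add_block_mx X Y Z T X' Y' Z' T'). Qed.

Lemma blkE (M : 'M[C]_4) : exists X Y Z T, M = block_mx X Y Z T.
Proof.
exists (ulsubmx (M : 'M[C]_(2 + 2))), (ursubmx (M : 'M[C]_(2 + 2))),
  (dlsubmx (M : 'M[C]_(2 + 2))), (drsubmx (M : 'M[C]_(2 + 2))).
by rewrite submxK.
Qed.

Lemma kron_blocks (M : 'M[C]_4) : exists X Y Z T : 'M[C]_2,
  M = kron (mx2 1 0 0 0) X + kron (mx2 0 1 0 0) Y
    + kron (mx2 0 0 1 0) Z + kron (mx2 0 0 0 1) T.
Proof.
have [X [Y [Z [T ->]]]] := blkE M; exists X, Y, Z, T.
by rewrite !kronE !scale1r !scale0r !blkD !addr0 !add0r.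
Qed.

Lemma block_inj (X Y Z T X' Y' Z' T' : 'M[C]_2) :
  block_mx X Y Z T = block_mx X' Y' Z' T' :> 'M[C]_4 -> [/\ X = X', Y = Y', Z = Z' & T = T'].
Proof. exact: (@eq_block_mx _ 2 2 2 2). Qed.

Definition sigz : 'M[C]_2 := mx2 1 0 0 (-1).
Definition sigx : 'M[C]_2 := mx2 0 1 1 0.

(** Turning membership in a subalgebra into commutation with a symmetry brings the condition into
    the form required by [equivariant]. *)
Lemma in_M2M2P (M : 'M[C]_4) :
  in_M2M2 M <-> kron sigz 1%:M *m M = M *m kron sigz 1%:M.
Proof.
rewrite /sigz kronE !scale1r !scale0r scaleN1r.
split=> [[X [Y ->]]|].
  by rewrite !blkM !mul0mx !mulmx0 !addr0 !add0r !mul1mx !mulmx1 mulNmx mulmxN mul1mx mulmx1.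
have [X [Y [Z [T ->]]]] := blkE M.
rewrite !blkM !mul0mx !mulmx0 !addr0 !add0r !mul1mx !mulmx1 !mulNmx !mulmxN !mul1mx !mulmx1.
have h0 (N : 'M[C]_2) : N = - N -> N = 0.
  move=> /eqP; rewrite -subr_eq0 opprK -mulr2n -scaler_nat scaler_eq0 pnatr_eq0 /=.
  by move/eqP.
move=> /block_inj[_ /h0 -> /esym/h0 -> _].
by exists X, T.
Qed.

Lemma comm_sigz A : sigz *m A = A *m sigz -> exists a d, A = mx2 a 0 0 d.
Proof.
rewrite (mx2E A) !mx2M !(mul0r, mulr0, mul1r, mulr1, addr0, add0r, mulN1r, mulrN1).
have h0 (z : C) : z = - z -> z = 0.
  by move=> /eqP; rewrite -subr_eq0 opprK -mulr2n mulrn_eq0 /= => /eqP.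
move=> /mx2_inj[_ /h0 -> /esym/h0 -> _].
by exists (A 0 0), (A 1 1).
Qed.

(** [sigz] and [sigx] together commute only with scalars, so each block of [M] must be a scalar. *)
Lemma in_M2_tens1P (M : 'M[C]_4) :
  in_M2_tens1 M <-> kron 1%:M sigz *m M = M *m kron 1%:M sigz /\
                    kron 1%:M sigx *m M = M *m kron 1%:M sigx.
Proof.
split=> [[X ->]|]; first by rewrite !kronM !mul1mx !mulmx1.
have [X [Y [Z [T ->]]]] := blkE M.
rewrite [1%:M]mx2_scalar !kronE !scale1r !scale0r !blkM.
rewrite !mul0mx !mulmx0 !addr0 !add0r.
move=> [/block_inj[hX hY hZ hT] /block_inj[hX' hY' hZ' hT']].
have sc (N : 'M[C]_2) : sigz *m N = N *m sigz -> sigx *m N = N *m sigx ->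
    exists a : C, N = a *: 1%:M.
  move=> /comm_sigz[a [d ->]]; rewrite !mx2M.
  rewrite !(mul0r, mulr0, mul1r, mulr1, addr0, add0r) => /mx2_inj[_ ad _ _].
  by exists a; rewrite scalemx1 mx2_scalar ad.
have [x ->] := sc X hX hX'; have [y ->] := sc Y hY hY'.
have [z ->] := sc Z hZ hZ'; have [t ->] := sc T hT hT'.
by exists (mx2 x y z t); rewrite kronE.
Qed.

End TwoByTwo.

Section KronMore.
Variable R : realType.
Local Notation C := (Cplx R).

Lemma kronNr (A B : 'M[C]_2) : kron A (- B) = - kron A B.
Proof. by apply/matrixP => i j; rewrite !mxE mulrN. Qed.

Lemma kron0l (B : 'M[C]_2) : kron 0 B = 0.
Proof. by apply/matrixP => i j; rewrite !mxE mul0r. Qed.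

Lemma flipT_kron (A B : 'M[C]_2) : flipT R *m kron A B = kron B A *m flipT R.
Proof.
have fE i j k l : flipT R (@mxtens_index 2 2 (i, j)) (@mxtens_index 2 2 (k, l)) =
    ((j, i) == (k, l))%:R.
  by rewrite mxE !mxtens_indexK.
apply/matrixP => i j.
case: (@mxtens_indexP 2 2 i) => i1 i2; case: (@mxtens_indexP 2 2 j) => j1 j2.
rewrite [LHS]mxE [RHS]mxE.
rewrite (bigD1 (@mxtens_index 2 2 (i2, i1))) //= fE eqxx mul1r big1 ?addr0; last first.
  move=> k; case: (@mxtens_indexP 2 2 k) => k1 k2 kN; rewrite fE.
  by case: eqP => [e|_]; [rewrite e eqxx in kN|rewrite mul0r].
rewrite (bigD1 (@mxtens_index 2 2 (j2, j1))) //= fE eqxx mulr1 big1 ?addr0; last first.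
  move=> k; case: (@mxtens_indexP 2 2 k) => k1 k2 kN; rewrite fE.
  case: eqP => [[e1 e2]|_]; last by rewrite mulr0.
  by rewrite e1 e2 eqxx in kN.
by rewrite !(@tensmxE _ 2 2 2 2) mulrC.
Qed.


End KronMore.

#[local] Opaque kron mx2.

(** * The symmetries behind the conditions with [nu1] and [nu2] *)

Section Symmetries.
Variable R : realType.
Local Notation C := (Cplx R).
Implicit Types (phi : R) (M : 'M[C]_4).

Lemma cexpD (x y : R) : cexp (x + y) = cexp x * cexp y.
Proof.
rewrite /cexp cosD sinD; apply/eqP; rewrite eq_complex /=; apply/andP.
by split; apply/eqP; ring.
Qed.

Lemma cexp_conj_mul phi : cexp phi * (cexp phi)^* = 1.
Proof.
rewrite mulC_conj; apply/eqP; rewrite eq_complex /=; apply/andP; split => //.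
have -> : cabs (cexp phi) = 1.
  have /set_mem := cexp_circle phi; rewrite /circle /= => h.
  by apply: (@complexI R); rewrite cabsE.
by rewrite expr1n.
Qed.

Lemma cexp_half phi : cexp (phi / 2) * cexp (phi / 2) = cexp phi.
Proof. by rewrite -cexpD -splitr. Qed.

(* The symmetry whose eigenvectors are the columns of [Vmx phi]. *)
Definition symm phi : 'M[C]_2 := mx2 0 (cexp (phi / 2)) (cexp (phi / 2))^* 0.

Lemma symm_sqr phi : symm phi *m symm phi = 1%:M.
Proof.
rewrite mx2M mx2_scalar !(mul0r, mulr0, addr0, add0r) cexp_conj_mul.
by rewrite mulrC cexp_conj_mul.
Qed.

Lemma symm_ctmx phi : (symm phi)^t* = symm phi.
Proof. by rewrite mx2_ctmx conjCK !conjC0. Qed.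

Lemma sigz_sqr : sigz R *m sigz R = 1%:M.
Proof. by rewrite mx2M mx2_scalar !(mul0r, mulr0, addr0, add0r, mulr1, mulrN1, opprK). Qed.

Lemma sigz_ctmx : (sigz R)^t* = sigz R.
Proof. by rewrite mx2_ctmx conjC1 conjC0 rmorphN1. Qed.

Let s2 : C := (Num.sqrt 2)^-1%:C.

Let s2_sqr : s2 * s2 = 2^-1.
Proof.
rewrite -realcM -invfM -expr2 sqr_sqrtr ?ler0n // realcV.
by congr (_^-1); rewrite -[2 in LHS]/(1 + 1) realcD.
Qed.

Let s2_conj : s2^* = s2. Proof. exact: conj_realc. Qed.

Lemma Vmx_sandwich a b c d phi : Vmx phi *m mx2 a b c d *m (Vmx phi)^t* =
  2^-1 *: mx2 (a - b - c + d) (cexp (phi / 2) * (a + b - c - d))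
     ((cexp (phi / 2))^* * (a - b + c - d)) (a + b + c + d).
Proof.
rewrite /Vmx -/s2 !mx2Z mx2_ctmx !rmorphM !rmorphN !rmorph1 /= s2_conj !mx2M -s2_sqr.
set e := cexp _; have ee : e * e^* = 1 by exact: cexp_conj_mul.
congr mx2.
- rewrite -[X in _ = s2 * s2 * X]mul1r -ee; ring.
- ring.
- ring.
- ring.
Qed.

Lemma Vmx_unitary phi : Vmx phi *m (Vmx phi)^t* = 1%:M.
Proof.
have := Vmx_sandwich 1 0 0 1 phi; rewrite -mx2_scalar mulmx1 => ->.
by rewrite mx2Z mx2_scalar; congr mx2; field.
Qed.

Lemma Vmx_sigz phi : Vmx phi *m sigz R *m (Vmx phi)^t* = symm phi.
Proof. by rewrite Vmx_sandwich mx2Z; congr mx2; field. Qed.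

Lemma Vmx_sigx phi : Vmx phi *m sigx R *m (Vmx phi)^t* = - sigz R.
Proof. by rewrite Vmx_sandwich mx2Z -[RHS]scaleN1r /sigz mx2Z; congr mx2; field. Qed.


(** Conjugation by [Vmx phi] takes [sigx] to [- sigz] whatever the angle, so the phases of [Wmx]
    cancel. *)
Lemma WmxE phi : Wmx phi = kron (mx2 1 0 0 0) 1%:M - kron (mx2 0 0 0 1) (sigz R).
Proof.
rewrite /Wmx /Smx mulmxDr mulmxDl !kronM !mul1mx !mulmx1 Vmx_unitary.
by rewrite -/(sigx R) Vmx_sigx kronNr.
Qed.

Lemma ctmx1 n : (1%:M : 'M[C]_n)^t* = 1%:M.
Proof. by rewrite trmx1 map_mx1. Qed.

Lemma Wmx_ctmx phi : (Wmx phi)^t* = Wmx phi.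
Proof.
by rewrite WmxE linearB /= map_mxB !kron_ctmx sigz_ctmx ctmx1 !mx2_ctmx !conjC0 !conjC1.
Qed.

Lemma sandwich_sub (P Q X : 'M[C]_4) :
  (P - Q) *m X *m (P - Q) = P *m X *m P - P *m X *m Q - (Q *m X *m P - Q *m X *m Q).
Proof.
by rewrite mulmxBl mulmxBr !mulmxBl !opprB addrACA [RHS]addrACA [- _ - _]addrC.
Qed.

Lemma kron_sub_sqr (E F Z : 'M[C]_2) :
  E *m E = E -> F *m F = F -> E *m F = 0 -> F *m E = 0 -> E + F = 1%:M -> Z *m Z = 1%:M ->
  (kron E 1%:M - kron F Z) *m (kron E 1%:M - kron F Z) = 1%:M.
Proof.
move=> EE FF EF FE EF1 ZZ; have := sandwich_sub (kron E 1%:M) (kron F Z) 1%:M.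
rewrite !mulmx1 => ->; rewrite !kronM EE FF EF FE !kron0l mulmx1 ZZ.
by rewrite subr0 sub0r opprK kronDl EF1 kron1.
Qed.

Lemma kron_sub_sandwich (E F S Z : 'M[C]_2) :
  E *m S *m E = 0 -> F *m S *m F = 0 -> E *m S *m F + F *m S *m E = S ->
  (kron E 1%:M - kron F Z) *m kron S 1%:M *m (kron E 1%:M - kron F Z) = - kron S Z.
Proof.
move=> e1 e2 e3; rewrite sandwich_sub !kronM e1 e2 !kron0l !mul1mx !mulmx1 sub0r subr0.
by rewrite -opprD kronDl e3.
Qed.

Lemma Wmx_unitary phi : Wmx phi *m (Wmx phi)^t* = 1%:M.
Proof.
rewrite Wmx_ctmx WmxE; apply: kron_sub_sqr; last exact: sigz_sqr;
  by rewrite ?mx2M ?mx2D ?(mul0r, mulr0, addr0, add0r, mulr1) -?mx2_0 -?mx2_scalar.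
Qed.

Lemma Wmx_symm phi phi1 :
  Wmx phi *m kron (symm phi1) 1%:M *m (Wmx phi)^t* = - kron (symm phi1) (sigz R).
Proof.
rewrite Wmx_ctmx WmxE; apply: kron_sub_sandwich;
  by rewrite !mx2M !(mul0r, mulr0, addr0, add0r, mulr1, mul1r) -?mx2_0 ?mx2D ?(addr0, add0r).
Qed.

Lemma conj_comp (W K X : 'M[C]_4) :
  W *m K *m X *m (W *m K)^t* = W *m (K *m X *m K^t*) *m W^t*.
Proof. by rewrite ctmxM !mulmxA. Qed.

Lemma kron_unitary (A B : 'M[C]_2) :
  A *m A^t* = 1%:M -> B *m B^t* = 1%:M -> kron A B *m (kron A B)^t* = 1%:M.
Proof. by move=> hA hB; rewrite kron_ctmx kronM hA hB kron1. Qed.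

Lemma nu1_unitary phi1 phi2 : nu1 phi1 phi2 *m (nu1 phi1 phi2)^t* = 1%:M.
Proof.
rewrite /nu1 ctmxM mulmxA -[X in X *m _]mulmxA kron_unitary ?Vmx_unitary //.
  by rewrite mulmx1 Wmx_unitary.
by rewrite ctmx1 mulmx1.
Qed.

Lemma nu1_sigz phi1 phi2 :
  nu1 phi1 phi2 *m kron (sigz R) 1%:M *m (nu1 phi1 phi2)^t* = - kron (symm phi1) (sigz R).
Proof.
rewrite /nu1 conj_comp -[RHS](Wmx_symm phi2); congr (_ *m _ *m _).
by rewrite kron_ctmx !kronM ctmx1 !mulmx1 Vmx_sigz.
Qed.


Lemma flipT_sqr : flipT R *m (flipT R)^t* = 1%:M.
Proof.
apply/matrixP => i j.
rewrite [LHS]mxE (bigD1 (@mxtens_index 2 2 ((@mxtens_unindex 2 2 i).2, (@mxtens_unindex 2 2 i).1))) //=.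
have fE k : flipT R i k = ((((@mxtens_unindex 2 2 i).2, (@mxtens_unindex 2 2 i).1))
    == @mxtens_unindex 2 2 k)%:R by rewrite mxE.
rewrite fE mxtens_indexK eqxx mul1r big1 ?addr0; last first.
  move=> k kN; rewrite fE; case: eqP => [e|_]; last by rewrite mul0r.
  by rewrite e mxtens_unindexK eqxx in kN.
rewrite !mxE mxtens_indexK conjC_nat; congr (_%:R); congr nat_of_bool.
rewrite xpair_eqE /= -!val_eqE /=.
case: i j {fE} => -[|[|[|[|//]]]] hi; case => -[|[|[|[|//]]]] hj //.
Qed.

Lemma nu2_unitary phi2 : nu2 phi2 *m (nu2 phi2)^t* = 1%:M.
Proof.
rewrite /nu2 ctmxM mulmxA -[X in X *m _]mulmxA kron_unitary ?Vmx_unitary //.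
  by rewrite mulmx1 flipT_sqr.
by rewrite ctmx1 mulmx1.
Qed.

Lemma nu2_sigz phi2 :
  nu2 phi2 *m kron (sigz R) 1%:M *m (nu2 phi2)^t* = kron 1%:M (symm phi2).
Proof.
rewrite /nu2 conj_comp.
have -> : kron (Vmx phi2) 1%:M *m kron (sigz R) 1%:M *m (kron (Vmx phi2) 1%:M)^t*
    = kron (symm phi2) 1%:M.
  by rewrite kron_ctmx !kronM ctmx1 !mulmx1 Vmx_sigz.
by rewrite flipT_kron -mulmxA flipT_sqr mulmx1.
Qed.

(** Conjugating the commutation relation back eliminates [nu1] and [nu2] from the boundary
    conditions; only their symmetries [J] remain. *)
Lemma in_M2M2_conj (V J M : 'M[C]_4) : V *m V^t* = 1%:M ->
  V *m kron (sigz R) 1%:M *m V^t* = J ->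
  in_M2M2 (V^t* *m M *m V) <-> J *m M = M *m J.
Proof.
move=> VV <-; have VV' := mulmx1C VV; rewrite in_M2M2P; set K := kron _ _.
move: K => K; set N := V^t* *m M *m V.
have n1 : V *m N = M *m V by rewrite /N !mulmxA VV mul1mx.
have n2 : N *m V^t* = V^t* *m M by rewrite /N -mulmxA VV mulmx1.
have n3 : K *m N = V^t* *m (V *m K *m V^t* *m M) *m V.
  by rewrite /N !mulmxA VV' mul1mx.
have n4 : N *m K = V^t* *m (M *m (V *m K *m V^t*)) *m V.
  by rewrite /N !mulmxA -(mulmxA _ (V^t*) V) VV' mulmx1.
clearbody N; split=> h; last by rewrite n3 n4 h.
by rewrite -mulmxA -n2 mulmxA -(mulmxA V K) h mulmxA n1 !mulmxA.
Qed.

Lemma symmetry_fixed (J M : 'M[C]_4) : J^t* = J -> J *m J = 1%:M ->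
  (J^t* *m M *m J = M) <-> J *m M = M *m J.
Proof.
move=> sJ JJ; rewrite sJ; split=> [{2}<-|->]; last by rewrite -mulmxA JJ mulmx1.
by rewrite -mulmxA JJ mulmx1.
Qed.

End Symmetries.

#[local] Transparent kron mx2.

(** * Continuity of the generators *)

Section EntrywiseContinuity.
Variables (R : realType) (T : topologicalType).
Local Notation C := (Cplx R).

Definition entrywise m n (F : T -> 'M[C]_(m, n)) :=
  forall i j, continuous (fun x => F x i j).

Lemma entrywise_mx2 (a b c d : T -> C) : continuous a -> continuous b ->
  continuous c -> continuous d -> entrywise (fun x => mx2 (a x) (b x) (c x) (d x)).
Proof.
move=> ca cb cc cd i j; under eq_fun do rewrite mxE.
case: (i == ord0); case: (j == ord0); [exact: ca|exact: cb|exact: cc|exact: cd].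
Qed.

Lemma continuousC_mul (f g : T -> C) :
  continuous f -> continuous g -> continuous (fun x => f x * g x).
Proof. move=> cf cg x; exact: (cvgM (cf x) (cg x)). Qed.

Lemma continuousC_opp (f : T -> C) : continuous f -> continuous (fun x => - f x).
Proof. move=> cf x; exact: (cvgN (cf x)). Qed.

Lemma continuousC_cst (c : C) : continuous (fun _ : T => c).
Proof. by move=> x; exact: cvg_cst. Qed.

Lemma entrywise_kron (F G : T -> 'M[C]_2) : entrywise F -> entrywise G ->
  entrywise (fun x => kron (F x) (G x)).
Proof.
move=> cF cG i j; rewrite /kron; under eq_fun do rewrite mxE.
exact: (continuousC_mul (cF _ _) (cG _ _)).
Qed.

Lemma entrywise_scale m n (c : T -> C) (F : T -> 'M[C]_(m, n)) :
  continuous c -> entrywise F -> entrywise (fun x => c x *: F x).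
Proof.
move=> cc cF i j; under eq_fun do rewrite mxE.
exact: (continuousC_mul cc (cF i j)).
Qed.

Lemma entrywise_add m n (F G : T -> 'M[C]_(m, n)) :
  entrywise F -> entrywise G -> entrywise (fun x => F x + G x).
Proof.
move=> cF cG i j; under eq_fun do rewrite mxE.
move=> x; exact: (cvgD (cF i j x) (cG i j x)).
Qed.

Lemma entrywise_cst m n (M : 'M[C]_(m, n)) : entrywise (fun=> M).
Proof. by move=> i j; exact: continuousC_cst. Qed.

Lemma entrywise_continuous (F : T -> 'M[C]_4) : entrywise F -> continuous F.
Proof. by move=> cF x; apply: cvg_entries => i j; exact: cF. Qed.

Lemma continuous_rsqrt (f : T -> R) : continuous f -> continuous (fun x => rsqrt (f x)).
Proof.
move=> cf; apply: continuous_realc => x.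
by apply: continuous_comp; [exact: cf|exact: sqrt_continuous].
Qed.
End EntrywiseContinuity.

Section Generators.
Variable R : realType.
Local Notation C := (Cplx R).
Implicit Types p : dom R.

Definition cr p : R := val p.1.1.1.1.1.
Definition cx1 p : R := val p.1.1.1.1.2.
Definition cx2 p : R := val p.1.1.1.2.
Definition cw p : C := val p.1.1.2.
Definition cw1 p : C := val p.1.2.
Definition cw2 p : C := val p.2.

Lemma val_continuous (X : topologicalType) (K : set X) : continuous (fun x : K => val x).
Proof. exact: initial_continuous. Qed.

Let val_comp (T X : topologicalType) (K : set X) (f : T -> K) :
  continuous f -> continuous (fun x => val (f x)).
Proof.
by move=> cf x; apply: continuous_comp; [exact: cf|exact: val_continuous].
Qed.

Let fst_comp (T X Y : topologicalType) (f : T -> X * Y) :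
  continuous f -> continuous (fun x => (f x).1).
Proof. by move=> cf x; apply: continuous_comp; [exact: cf|exact: cvg_fst]. Qed.

Let snd_comp (T X Y : topologicalType) (f : T -> X * Y) :
  continuous f -> continuous (fun x => (f x).2).
Proof. by move=> cf x; apply: continuous_comp; [exact: cf|exact: cvg_snd]. Qed.

Let id_cont (T : topologicalType) : continuous (fun x : T => x).
Proof. by move=> x; exact: cvg_id. Qed.

Lemma cr_continuous : continuous cr.
Proof. apply: val_comp; do 5 apply: fst_comp; exact: id_cont. Qed.
Lemma cx1_continuous : continuous cx1.
Proof. apply: val_comp; apply: snd_comp; do 4 apply: fst_comp; exact: id_cont. Qed.
Lemma cx2_continuous : continuous cx2.
Proof. apply: val_comp; apply: snd_comp; do 3 apply: fst_comp; exact: id_cont. Qed.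
Lemma cw_continuous : continuous cw.
Proof. apply: val_comp; apply: snd_comp; do 2 apply: fst_comp; exact: id_cont. Qed.
Lemma cw1_continuous : continuous cw1.
Proof. apply: val_comp; apply: snd_comp; apply: fst_comp; exact: id_cont. Qed.
Lemma cw2_continuous : continuous cw2.
Proof. apply: val_comp; apply: snd_comp; exact: id_cont. Qed.

Definition offdiag (w : C) (x : R) : 'M[C]_2 := mx2 0 (w * rsqrt x) (rsqrt (1 - x)) 0.
Definition offdiag' (w : C) (x : R) : 'M[C]_2 :=
  mx2 0 (rsqrt (1 - x)) (- (w^* * rsqrt x)) 0.

Lemma gen1E p : gen1 p = kron (offdiag (cw1 p) (cx1 p)) 1%:M.
Proof. by case: p => [[[[[r x1] x2] w] w1] w2]. Qed.

Lemma gen2E p : gen2 p =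
  rsqrt (1 - cr p ^+ 2) *: kron (sigz R) (offdiag (cw2 p) (cx2 p)) +
  ((cr p)%:C * cw p) *: kron (offdiag' (cw1 p) (cx1 p)) 1%:M.
Proof. by case: p => [[[[[r x1] x2] w] w1] w2]. Qed.

Let continuousR_sub (T : topologicalType) (f : T -> R) :
  continuous f -> continuous (fun x => 1 - f x).
Proof. move=> cf x; exact: (cvgB (cvg_cst _) (cf x)). Qed.

Let continuousR_sqr (T : topologicalType) (f : T -> R) :
  continuous f -> continuous (fun x => f x ^+ 2).
Proof.
move=> cf x; under eq_fun do rewrite expr2.
exact: (cvgM (cf x) (cf x)).
Qed.

Lemma entrywise_offdiag (T : topologicalType) (w : T -> C) (x : T -> R) :
  continuous w -> continuous x -> entrywise (fun s => offdiag (w s) (x s)).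
Proof.
move=> cw' cx; apply: entrywise_mx2; [exact: continuousC_cst| | |exact: continuousC_cst].
  exact: (continuousC_mul cw' (continuous_rsqrt cx)).
exact: (continuous_rsqrt (continuousR_sub cx)).
Qed.

Lemma entrywise_offdiag' (T : topologicalType) (w : T -> C) (x : T -> R) :
  continuous w -> continuous x -> entrywise (fun s => offdiag' (w s) (x s)).
Proof.
move=> cw' cx; apply: entrywise_mx2; [exact: continuousC_cst| | |exact: continuousC_cst].
  exact: (continuous_rsqrt (continuousR_sub cx)).
exact: (continuousC_opp (continuousC_mul (continuous_conj cw') (continuous_rsqrt cx))).
Qed.

Lemma gen1_continuous : continuous (@gen1 R).
Proof.
rewrite (_ : @gen1 R = fun p => kron (offdiag (cw1 p) (cx1 p)) 1%:M); last first.
  by apply/funext => p; exact: gen1E.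
apply: entrywise_continuous; apply: entrywise_kron; last exact: entrywise_cst.
by apply: entrywise_offdiag; [exact: cw1_continuous|exact: cx1_continuous].
Qed.

Lemma gen2_continuous : continuous (@gen2 R).
Proof.
rewrite (funext gen2E); apply: entrywise_continuous; apply: entrywise_add.
  apply: entrywise_scale.
    exact: (continuous_rsqrt (continuousR_sub (continuousR_sqr cr_continuous))).
  apply: entrywise_kron; first exact: entrywise_cst.
  by apply: entrywise_offdiag; [exact: cw2_continuous|exact: cx2_continuous].
apply: entrywise_scale.
  exact: (continuousC_mul (continuous_realc cr_continuous) cw_continuous).
apply: entrywise_kron; last exact: entrywise_cst.
by apply: entrywise_offdiag'; [exact: cw1_continuous|exact: cx1_continuous].
Qed.

Lemma cis_surj (w : circle R) : exists2 phi, is_angle phi & w = cis phi.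
Proof.
have [phi h e] := cexp_surj (set_valP w); exists phi => //; exact: val_inj.
Qed.

Lemma pt_surj p : exists phi phi1 phi2, [/\ is_angle phi, is_angle phi1, is_angle phi2 &
  p = pt p.1.1.1.1.1 p.1.1.1.1.2 p.1.1.1.2 phi phi1 phi2].
Proof.
case: p => [[[[[r x1] x2] w] w1] w2].
have [phi h ->] := cis_surj w; have [phi1 h1 ->] := cis_surj w1.
by have [phi2 h2 ->] := cis_surj w2; exists phi, phi1, phi2.
Qed.

End Generators.

#[local] Opaque kron mx2.

(** * Boundary conditions as equivariance *)

Section BoundaryRelation.
Variable R : realType.
Local Notation C := (Cplx R).
Variable U : Iunit R -> Ihalf R -> R -> R -> R -> 'M[C]_4.

(** The identification of points and the membership at [unit1] are separate constructors, and the
    membership needs two symmetries, [BcR1z] and [BcR1x]. The matrices in [BcNu2] and [BcNu1] are,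
    up to sign, the conjugates of [kron sigz 1] by [nu2] and [nu1]. *)
Inductive bc_rel : dom R -> 'M[C]_4 -> dom R -> Prop :=
| BcX1 r1 x2 phi phi1 phi2 of is_angle phi & is_angle phi1 & is_angle phi2 :
    bc_rel (pt r1 half0 x2 phi phi1 phi2) 1%:M (pt r1 half0 x2 phi 0 phi2)
| BcX2 r1 x1 phi phi1 phi2 of is_angle phi & is_angle phi1 & is_angle phi2 :
    bc_rel (pt r1 x1 half0 phi phi1 phi2) 1%:M (pt r1 x1 half0 phi phi1 0)
| BcR1 x1 x2 phi phi1 phi2 of is_angle phi & is_angle phi1 & is_angle phi2 :
    bc_rel (pt unit1 x1 x2 phi phi1 phi2) 1%:M (pt unit1 x1 half0 phi phi1 0)
| BcR1z x1 phi phi1 of is_angle phi & is_angle phi1 :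
    bc_rel (pt unit1 x1 half0 phi phi1 0) (kron 1%:M (sigz R)) (pt unit1 x1 half0 phi phi1 0)
| BcR1x x1 phi phi1 of is_angle phi & is_angle phi1 :
    bc_rel (pt unit1 x1 half0 phi phi1 0) (kron 1%:M (sigx R)) (pt unit1 x1 half0 phi phi1 0)
| BcR0 x1 x2 phi phi1 phi2 of is_angle phi & is_angle phi1 & is_angle phi2 :
    bc_rel (pt unit0 x1 x2 phi phi1 phi2) 1%:M (pt unit0 x1 x2 0 phi1 phi2)
| BcNu2 r1 x1 phi phi1 phi2 of is_angle phi & is_angle phi1 & is_angle phi2 :
    bc_rel (pt r1 x1 half1 phi phi1 phi2) (kron 1%:M (symm phi2)) (pt r1 x1 half1 phi phi1 phi2)
| BcNu1 x2 phi phi1 phi2 of is_angle phi & is_angle phi1 & is_angle phi2 :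
    bc_rel (pt unit0 half1 x2 phi phi1 phi2) (kron (symm phi1) (sigz R))
      (pt unit0 half1 x2 phi phi1 phi2)
| BcU r1 x2 phi phi1 phi2 t psi of is_angle phi & is_angle phi1 & is_angle phi2 &
    is_t_psi r1 x2 phi phi1 phi2 t psi :
    bc_rel (pt r1 half1 x2 phi phi1 phi2) (U r1 x2 phi phi1 phi2) (pt unit0 half1 t 0 phi1 psi).

Lemma angle0 : is_angle (0 : R).
Proof. by rewrite /is_angle lexx /= mulr_ge0 ?pi_ge0. Qed.

Lemma sigx_sqr : sigx R *m sigx R = 1%:M.
Proof. by rewrite mx2M mx2_scalar !(mul0r, mulr0, addr0, add0r, mulr1). Qed.

Lemma sigx_ctmx : (sigx R)^t* = sigx R.
Proof. by rewrite mx2_ctmx conjC1 conjC0. Qed.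

Lemma kron_symmetry (A B : 'M[C]_2) : A^t* = A -> B^t* = B ->
  A *m A = 1%:M -> B *m B = 1%:M ->
  (kron A B)^t* = kron A B /\ kron A B *m kron A B = 1%:M.
Proof. by move=> sA sB AA BB; rewrite kron_ctmx sA sB kronM AA BB kron1. Qed.

Definition sym_1z := kron_symmetry (ctmx1 R 2) (sigz_ctmx R) (mulmx1 _) (sigz_sqr R).
Definition sym_1x := kron_symmetry (ctmx1 R 2) sigx_ctmx (mulmx1 _) sigx_sqr.
Definition sym_1s phi := kron_symmetry (ctmx1 R 2) (symm_ctmx phi) (mulmx1 _) (symm_sqr phi).
Definition sym_sz phi := kron_symmetry (symm_ctmx phi) (sigz_ctmx R) (symm_sqr phi) (sigz_sqr R).

Lemma conj1 (M : 'M[C]_4) : 1%:M^t* *m M *m 1%:M = M.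
Proof. by rewrite ctmx1 mul1mx mulmx1. Qed.

Lemma symmetry_unitary (J : 'M[C]_4) : J^t* = J /\ J *m J = 1%:M -> J \is unitarymx.
Proof. by case=> sJ JJ; apply/unitarymxP; rewrite sJ. Qed.

Lemma one_unitary : (1%:M : 'M[C]_4) \is unitarymx.
Proof. by apply/unitarymxP; rewrite ctmx1 mulmx1. Qed.

Hypothesis hU : is_intertwiner U.

Lemma boundaryP f : boundary_conditions U f <-> equivariant bc_rel f.
Proof.
split=> [bc p V q|eq r1 x1 x2 phi phi1 phi2 a a1 a2].
  case=> [r1 x2 phi phi1 phi2 a a1 a2|r1 x1 phi phi1 phi2 a a1 a2|
      x1 x2 phi phi1 phi2 a a1 a2|x1 phi phi1 a a1|x1 phi phi1 a a1|
      x1 x2 phi phi1 phi2 a a1 a2|r1 x1 phi phi1 phi2 a a1 a2|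
      x2 phi phi1 phi2 a a1 a2|r1 x2 phi phi1 phi2 t psi a a1 a2 tp] _.
  - by rewrite conj1; case: (bc r1 half0 x2 phi phi1 phi2 a a1 a2).
  - by rewrite conj1; case: (bc r1 x1 half0 phi phi1 phi2 a a1 a2) => _ [].
  - by rewrite conj1; case: (bc unit1 x1 x2 phi phi1 phi2 a a1 a2) => _ [_ []].
  - have [_ [_ [_ [/in_M2_tens1P[h _] _]]]] := bc unit1 x1 half0 phi phi1 0 a a1 angle0.
    by have [s1 s2] := sym_1z; apply/(symmetry_fixed _ s1 s2).
  - have [_ [_ [_ [/in_M2_tens1P[_ h] _]]]] := bc unit1 x1 half0 phi phi1 0 a a1 angle0.
    by have [s1 s2] := sym_1x; apply/(symmetry_fixed _ s1 s2).
  - by rewrite conj1; have [_ [_ [_ [_ [h _]]]]] := bc unit0 x1 x2 phi phi1 phi2 a a1 a2.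
  - have [_ [_ [_ [_ [_ [h _]]]]]] := bc r1 x1 half1 phi phi1 phi2 a a1 a2.
    have [s1 s2] := sym_1s phi2; apply/(symmetry_fixed _ s1 s2).
    exact/(in_M2M2_conj _ (nu2_unitary phi2) (nu2_sigz phi2)).
  - have [_ [_ [_ [_ [_ [_ [h _]]]]]]] := bc unit0 half1 x2 phi phi1 phi2 a a1 a2.
    have [s1 s2] := sym_sz phi1; apply/(symmetry_fixed _ s1 s2).
    have := (in_M2M2_conj _ (nu1_unitary phi1 phi2) (nu1_sigz phi1 phi2)).1 h.
    by rewrite mulNmx mulmxN => /oppr_inj.
  - by have [_ [_ [_ [_ [_ [_ [_ h]]]]]]] := bc r1 half1 x2 phi phi1 phi2 a a1 a2; exact: h.
have e1 p q : bc_rel p 1%:M q -> f p = f q.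
  by move=> /eq /(_ one_unitary); rewrite conj1.
have eJ p J : bc_rel p J p -> J^t* = J /\ J *m J = 1%:M -> J *m f p = f p *m J.
  by move=> /eq h /[dup] /symmetry_unitary/h {}h [s1 s2]; apply/(symmetry_fixed _ s1 s2).
do ?split.
- by apply: e1; constructor.
- by apply: e1; constructor.
- by apply: e1; constructor.
- apply/in_M2_tens1P; split; apply: eJ; [exact: BcR1z|exact: sym_1z|exact: BcR1x|exact: sym_1x].
- by apply: e1; constructor.
- apply/(in_M2M2_conj _ (nu2_unitary phi2) (nu2_sigz phi2)).
  by apply: eJ; [exact: BcNu2|exact: sym_1s].
- apply/(in_M2M2_conj _ (nu1_unitary phi1 phi2) (nu1_sigz phi1 phi2)).
  rewrite mulNmx mulmxN; congr (- _).
  by apply: eJ; [exact: BcNu1|exact: sym_sz].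
- move=> t psi tp; apply: eq; first exact: BcU.
  by case: (hU r1 x2 a a1 a2).
Qed.

(** At 1/2 both entries have the same modulus, so the matrix is a multiple of a self-adjoint
    unitary. This is the source of the commutant conditions at [half1]. *)
Lemma offdiag_half (phi : R) : offdiag (cexp phi) 2^-1 =
  (rsqrt 2^-1 * cexp (phi / 2)) *: symm phi.
Proof.
rewrite /offdiag /symm mx2Z (_ : 1 - 2^-1 = 2^-1 :> R); last by field.
rewrite !mulr0; congr mx2; first by rewrite -(cexp_half phi); ring.
by rewrite -mulrA cexp_conj_mul mulr1.
Qed.

Lemma rsqrt0 : rsqrt (0 : R) = 0. Proof. by rewrite /rsqrt sqrtr0. Qed.

Lemma offdiag0 (w w' : C) : offdiag w 0 = offdiag w' 0.
Proof. by rewrite /offdiag rsqrt0 !mulr0. Qed.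

Lemma offdiag'0 (w w' : C) : offdiag' w 0 = offdiag' w' 0.
Proof. by rewrite /offdiag' rsqrt0 !mulr0. Qed.

Lemma sigz_offdiag (w : C) x : sigz R *m offdiag w x = - (offdiag w x *m sigz R).
Proof.
by rewrite !mx2M -[RHS]scaleN1r mx2Z; congr mx2; ring.
Qed.

Lemma symm_sigz (phi : R) : symm phi *m sigz R = - (sigz R *m symm phi).
Proof. by rewrite !mx2M -[RHS]scaleN1r mx2Z; congr mx2; ring. Qed.

Lemma comm_mx_scale (J A : 'M[C]_4) (a : C) :
  J *m A = A *m J -> J *m (a *: A) = (a *: A) *m J.
Proof. by move=> h; rewrite -scalemxAr -scalemxAl h. Qed.

Lemma comm_mx_comb (J A B : 'M[C]_4) (a b : C) : J *m A = A *m J -> J *m B = B *m J ->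
  J *m (a *: A + b *: B) = (a *: A + b *: B) *m J.
Proof. by move=> hA hB; rewrite mulmxDr mulmxDl !comm_mx_scale. Qed.

Lemma crE r x1 x2 a b c : cr (@pt R r x1 x2 a b c) = val r. Proof. by []. Qed.
Lemma cx1E r x1 x2 a b c : cx1 (@pt R r x1 x2 a b c) = val x1. Proof. by []. Qed.
Lemma cx2E r x1 x2 a b c : cx2 (@pt R r x1 x2 a b c) = val x2. Proof. by []. Qed.
Lemma cwE r x1 x2 a b c : cw (@pt R r x1 x2 a b c) = cexp a. Proof. by []. Qed.
Lemma cw1E r x1 x2 a b c : cw1 (@pt R r x1 x2 a b c) = cexp b. Proof. by []. Qed.
Lemma cw2E r x1 x2 a b c : cw2 (@pt R r x1 x2 a b c) = cexp c. Proof. by []. Qed.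
Lemma val_unit0 : val (unit0 : Iunit R) = 0. Proof. by []. Qed.
Lemma val_unit1 : val (unit1 : Iunit R) = 1. Proof. by []. Qed.
Lemma val_half0 : val (half0 : Ihalf R) = 0. Proof. by []. Qed.
Lemma val_half1 : val (half1 : Ihalf R) = 2^-1. Proof. by []. Qed.
Definition ptE := (crE, cx1E, cx2E, cwE, cw1E, cw2E, val_unit0, val_unit1, val_half0, val_half1).

Lemma gen1_equivariant : equivariant bc_rel (@gen1 R).
Proof.
move=> p V q; case=> [r1 x2 phi phi1 phi2 a a1 a2|r1 x1 phi phi1 phi2 a a1 a2|
      x1 x2 phi phi1 phi2 a a1 a2|x1 phi phi1 a a1|x1 phi phi1 a a1|
      x1 x2 phi phi1 phi2 a a1 a2|r1 x1 phi phi1 phi2 a a1 a2|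
      x2 phi phi1 phi2 a a1 a2|r1 x2 phi phi1 phi2 t psi a a1 a2 tp] _;
  rewrite ?conj1 ?gen1E ?ptE.
- by rewrite (offdiag0 (cexp phi1) (cexp 0)).
- by [].
- by [].
- have [s1 s2] := sym_1z; apply/(symmetry_fixed _ s1 s2).
  by rewrite !kronM !mul1mx !mulmx1.
- have [s1 s2] := sym_1x; apply/(symmetry_fixed _ s1 s2).
  by rewrite !kronM !mul1mx !mulmx1.
- by [].
- have [s1 s2] := sym_1s phi2; apply/(symmetry_fixed _ s1 s2).
  by rewrite !kronM !mul1mx !mulmx1.
- have [s1 s2] := sym_sz phi1; apply/(symmetry_fixed _ s1 s2).
  by rewrite offdiag_half -kronZl -scalemxAr -scalemxAl !kronM mul1mx mulmx1.
by have [_ _ h] := hU r1 x2 a a1 a2; have [+ _] := h t psi tp; rewrite !gen1E !ptE.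
Qed.

Lemma gen2_equivariant : equivariant bc_rel (@gen2 R).
Proof.
have u0 : rsqrt (1 - (1 : R) ^+ 2) = 0 by rewrite expr1n subrr rsqrt0.
move=> p V q; case=> [r1 x2 phi phi1 phi2 a a1 a2|r1 x1 phi phi1 phi2 a a1 a2|
      x1 x2 phi phi1 phi2 a a1 a2|x1 phi phi1 a a1|x1 phi phi1 a a1|
      x1 x2 phi phi1 phi2 a a1 a2|r1 x1 phi phi1 phi2 a a1 a2|
      x2 phi phi1 phi2 a a1 a2|r1 x2 phi phi1 phi2 t psi a a1 a2 tp] _;
  rewrite ?conj1 ?gen2E ?ptE.
- by rewrite (offdiag'0 (cexp phi1) (cexp 0)).
- by rewrite (offdiag0 (cexp phi2) (cexp 0)).
- by rewrite u0 !scale0r.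
- have [s1 s2] := sym_1z; apply/(symmetry_fixed _ s1 s2).
  rewrite u0 !scale0r !add0r -scalemxAr -scalemxAl.
  by rewrite !kronM !mul1mx !mulmx1.
- have [s1 s2] := sym_1x; apply/(symmetry_fixed _ s1 s2).
  rewrite u0 !scale0r !add0r -scalemxAr -scalemxAl.
  by rewrite !kronM !mul1mx !mulmx1.
- by rewrite !mul0r !scale0r.
- have [s1 s2] := sym_1s phi2; apply/(symmetry_fixed _ s1 s2).
  rewrite offdiag_half -kronZr; apply: comm_mx_comb; last by rewrite !kronM !mul1mx !mulmx1.
  by apply: comm_mx_scale; rewrite !kronM mul1mx mulmx1.
- have [s1 s2] := sym_sz phi1; apply/(symmetry_fixed _ s1 s2).
  rewrite mul0r !scale0r !addr0 -scalemxAr -scalemxAl !kronM.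
  (* The symmetry anticommutes with [gen2] in each tensor factor separately, and the two signs
     cancel. *)
  by rewrite symm_sigz sigz_offdiag kronNr -kronNl opprK.
by have [_ _ h] := hU r1 x2 a a1 a2; have [_ +] := h t psi tp; rewrite !gen2E !ptE.
Qed.

End BoundaryRelation.

(** * Determinants over the center *)

Section Span.
Variables (Z : comNzRingType) (X : nzRingType) (iota : {rmorphism Z -> X}).
Local Notation "L ^i" := (map_mx iota L) (at level 8, format "L ^i").

(* [W] generates the algebra over its central subring [Z].  The determinant of a matrix of
   right multiplication by [h] is a left multiple of [h], see [acts_det]. *)
Definition acts n (W : 'cV[X]_n) (h : X) :=
  exists L : 'M[Z]_n, W *m h%:M = L^i *m W.

Definition iota_comm (x : X) := forall z, iota z * x = x * iota z.

Definition iota_comm_col n (W : 'cV[X]_n) := forall z i, iota z * W i 0 = W i 0 * iota z.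

Lemma actsD n (W : 'cV[X]_n) h k : acts W h -> acts W k -> acts W (h + k).
Proof.
move=> [L hL] [K hK]; exists (L + K).
by rewrite raddfD /= mulmxDr map_mxD mulmxDl hL hK.
Qed.

Lemma actsM n (W : 'cV[X]_n) h k : acts W h -> acts W k -> acts W (h * k).
Proof.
move=> [L hL] [K hK]; exists (L *m K).
by rewrite scalar_mxM mulmxA hL -mulmxA hK mulmxA map_mxM.
Qed.

Lemma mul_iota_col n (W : 'cV[X]_n) z : iota_comm_col W ->
  W *m (iota z)%:M = (z%:M)^i *m W.
Proof.
move=> cW; apply/matrixP => i j; rewrite map_scalar_mx mul_scalar_mx !mxE big_ord1 [j]ord1.
by rewrite mxE eqxx mulr1n cW.
Qed.

Lemma acts_iota n (W : 'cV[X]_n) z : iota_comm_col W -> acts W (iota z).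
Proof. by move=> cW; exists z%:M; rewrite mul_iota_col. Qed.

(* If [W] lists the monomials in some generators, [double W e] lists those in one more. *)
Definition double n (W : 'cV[X]_n) (e : X) : 'cV[X]_(n + n) := col_mx W (W *m e%:M).

Lemma iota_comm_double n (W : 'cV[X]_n) e :
  iota_comm e -> iota_comm_col W -> iota_comm_col (double W e).
Proof.
move=> ce cW z i; rewrite /double mxE; case: (fintype.split i) => k; first exact: cW.
rewrite !mxE big_ord1 ?mxE ?eqxx ?mulr1n mulrA cW -!mulrA; congr (_ * _).
exact: ce.
Qed.

(** Since [e * h = iota z - h * e], right multiplication by [h] sends the new half [W * e] back into
    the span of both halves, with block row [z, - L]. *)
Lemma acts_double n (W : 'cV[X]_n) (e h : X) z : iota_comm_col W ->
  e * h + h * e = iota z -> acts W h -> acts (double W e) h.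
Proof.
move=> cW eh [L hL]; exists (block_mx L 0 z%:M (- L)).
rewrite map_block_mx mul_block_col mul_col_mx map_mx0 mul0mx addr0 hL; congr col_mx.
rewrite -mulmxA -scalar_mxM (_ : e * h = iota z - h * e); last by rewrite -eh addrK.
rewrite raddfB /= mulmxBr mul_iota_col // scalar_mxM mulmxA hL.
by rewrite map_mxN mulNmx mulmxA.
Qed.

Lemma acts_double_self n (W : 'cV[X]_n) (e : X) z : iota_comm_col W ->
  e * e = iota z -> acts (double W e) e.
Proof.
move=> cW ee; exists (block_mx 0 1%:M z%:M 0).
rewrite map_block_mx mul_block_col mul_col_mx !map_mx0 !mul0mx addr0 add0r.
by rewrite map_mx1 mul1mx -mulmxA -scalar_mxM ee mul_iota_col.
Qed.

(** Cramer's rule: multiplication by the adjugate of [L] leaves [\det L] times [W] on the right, and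
    the row in which [W] is 1 exhibits the cofactor [y]. *)
Lemma acts_det n (W : 'cV[X]_n) h (L : 'M[Z]_n) i : W i 0 = 1 ->
  W *m h%:M = L^i *m W -> exists y, iota (\det L) = y * h.
Proof.
move=> W1 hL; exists (((\adj L)^i *m W) i 0).
have := congr1 (fun M => (\adj L)^i *m M) hL.
rewrite mulmxA [in RHS]mulmxA -map_mxM mul_adj_mx map_scalar_mx mul_scalar_mx.
move=> /matrixP/(_ i 0); rewrite [RHS]mxE W1 mulr1 => <-.
by rewrite mxE big_ord1 ?mxE ?eqxx ?mulr1n.
Qed.

(** A generator acts from the doubling that introduces it, because its square is central, and keeps
    acting under later doublings, because the anticommutators are central. *)
Lemma four_generators (e1 e2 e3 e4 : X) :
  (forall x, x \in [:: e1; e2; e3; e4] -> iota_comm x) ->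
  (forall x y, x \in [:: e1; e2; e3; e4] -> y \in [:: e1; e2; e3; e4] ->
     exists z, x * y + y * x = iota z) ->
  (forall x, x \in [:: e1; e2; e3; e4] -> exists z, x * x = iota z) ->
  exists W : 'cV[X]_16, [/\ iota_comm_col W, W 0 0 = 1 &
    forall x, x \in [:: e1; e2; e3; e4] -> acts W x].
Proof.
move=> ce ac sq.
have [i1 i2 i3 i4] : [/\ e1 \in [:: e1; e2; e3; e4], e2 \in [:: e1; e2; e3; e4],
    e3 \in [:: e1; e2; e3; e4] & e4 \in [:: e1; e2; e3; e4]].
  by rewrite !inE !eqxx !orbT.
pose W0 : 'cV[X]_1 := 1%:M.
have c0 : iota_comm_col W0 by move=> z i; rewrite ord1 mxE eqxx mulr1 mul1r.
pose W1 := double W0 e1; have c1 : iota_comm_col W1 := iota_comm_double (ce _ i1) c0.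
pose W2 := double W1 e2; have c2 : iota_comm_col W2 := iota_comm_double (ce _ i2) c1.
pose W3 := double W2 e3; have c3 : iota_comm_col W3 := iota_comm_double (ce _ i3) c2.
pose W4 := double W3 e4; have c4 : iota_comm_col W4 := iota_comm_double (ce _ i4) c3.
have step (n : nat) (W : 'cV[X]_n) e x : iota_comm_col W -> e \in [:: e1; e2; e3; e4] ->
    x \in [:: e1; e2; e3; e4] -> acts W x -> acts (double W e) x.
  by move=> cW ie ix ax; have [z hz] := ac e x ie ix; exact: acts_double hz ax.
have self (n : nat) (W : 'cV[X]_n) e : iota_comm_col W -> e \in [:: e1; e2; e3; e4] ->
    acts (double W e) e.
  by move=> cW ie; have [z hz] := sq e ie; exact: acts_double_self hz.
exists W4; split=> //.
  have l n (A B : 'cV[X]_n) (i : 'I_(n + n)) (k : 'I_n) : val i = val k ->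
      col_mx A B i 0 = A k 0.
    by move=> ik; rewrite (_ : i = lshift _ k) ?col_mxEu //; exact: val_inj.
  transitivity (W3 (@ord0 7) 0); first exact: l.
  transitivity (W2 (@ord0 3) 0); first exact: l.
  transitivity (W1 (@ord0 1) 0); first exact: l.
  transitivity (W0 (@ord0 0) 0); first exact: l.
  by rewrite mxE eqxx.
move=> x; rewrite !inE => /or4P[] /eqP->.
- exact: (step 8 W3 e4 e1 c3 i4 i1 (step 4 W2 e3 e1 c2 i3 i1
           (step 2 W1 e2 e1 c1 i2 i1 (self 1 W0 e1 c0 i1)))).
- exact: (step 8 W3 e4 e2 c3 i4 i2 (step 4 W2 e3 e2 c2 i3 i2 (self 2 W1 e2 c1 i2))).
- exact: (step 8 W3 e4 e3 c3 i4 i3 (self 4 W2 e3 c2 i3)).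
- exact: (self 8 W3 e4 c3 i4).
Qed.

End Span.

(** * Lower bounds for determinants *)

Section DetBound.
Variable R : realType.
Local Notation C := (Cplx R).

Lemma cabs_prod (s : seq C) (d : R) : 0 <= d -> (forall x, x \in s -> d <= cabs x) ->
  d ^+ size s <= cabs (\prod_(x <- s) x).
Proof.
move=> d0; elim: s => [|x s ih] h; first by rewrite big_nil cabs1.
rewrite big_cons cabsM exprS ler_pM ?exprn_ge0 //; first by apply: h; rewrite inE eqxx.
by apply: ih => y ys; apply: h; rewrite inE ys orbT.
Qed.

(** Up to sign the determinant is the product of the roots of the characteristic polynomial. *)
Lemma det_bound n (L : 'M[C]_n.+1) (d : R) : 0 <= d ->
  (forall mu, eigenvalue L mu -> d <= cabs mu) -> d ^+ n.+1 <= cabs (\det L).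
Proof.
move=> d0 h; have [s] := closed_field_poly_normal (char_poly L).
rewrite (monicP (char_poly_monic L)) scale1r => cE.
have sz : size s = n.+1.
  by have := size_char_poly L; rewrite cE size_prod_XsubC => -[].
have -> : cabs (\det L) = cabs (\prod_(x <- s) x).
  have := char_poly_det L; rewrite -horner_coef0 cE horner_prod.
  under eq_bigr do rewrite hornerXsubC sub0r.
  move=> e.
  have e' : (-1) ^+ n.+1 * \det L = \prod_(x <- s) - x by rewrite e.
  have ab k : cabs ((-1) ^+ k : C) = 1.
    by elim: k => [|k ih]; rewrite ?cabs1 // exprS cabsM ih cabsN cabs1 mulr1.
  rewrite -[LHS]mul1r -(ab n.+1) -cabsM e'.
  elim: (s) => [|x s' ih]; first by rewrite !big_nil.
  by rewrite !big_cons !cabsM cabsN ih.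
rewrite -sz; apply: cabs_prod => // x xs; apply: h.
rewrite eigenvalue_root_char cE; by rewrite root_prod_XsubC.
Qed.

(** Sixteen spanning matrices form a basis, so an eigenvector of [L] gives a nonzero [X] with
    [X *m F = mu *: X]. A nonzero column of the adjoint of [X] is then an eigenvector of the adjoint
    of [F] for the conjugate of [mu], and the lower bound on [F^t*] applies to it. *)
Lemma spanning_det_bound (w : 'I_16 -> 'M[C]_4) (F : 'M[C]_4) (L : 'M[C]_16) (d : R) :
  0 <= d ->
  (forall M, exists c : 'I_16 -> C, M = \sum_i c i *: w i) ->
  (forall i, w i *m F = \sum_j L i j *: w j) ->
  (forall v, d * l2norm v <= l2norm (F^t* *m v)) ->
  d ^+ 16 <= cabs (\det L).
Proof.
move=> d0 span hL hF; apply: (@det_bound 15) => // mu /eigenvalueP[v vL v0].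
pose Wm : 'M[C]_(16, 4 * 4) := \matrix_i mxvec (w i).
have lin (c : 'rV_16) : c *m Wm = mxvec (\sum_i c 0 i *: w i).
  rewrite mulmx_sum_row linear_sum; apply: eq_bigr => i _.
  by rewrite linearZ /= rowK.
have full : row_full Wm.
  apply/row_fullP.
  have hM (k : 'I_(4 * 4)) : exists c : 'rV[C]_16, c *m Wm = delta_mx 0 k.
    have [c hc] := span (vec_mx (delta_mx 0 k)); exists (\row_i c i).
    rewrite lin -[RHS]vec_mxK hc; congr mxvec; apply: eq_bigr => i _.
    by rewrite mxE.
  have [c hc] := choice hM.
  exists (\matrix_k c k); apply/row_matrixP => k.
  by rewrite row_mul rowK hc row1.
(* [Wm] is square, as 16 is [4 * 4]; full rank by columns is full rank by rows. *)
have free : row_free Wm.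
  by move: full; rewrite /row_full /row_free => /eqP ->.
have inj (c : 'rV_16) : \sum_i c 0 i *: w i = 0 -> c = 0.
  move=> c0; apply/eqP; rewrite -(mulmx_free_eq0 _ free) lin c0.
  by rewrite linear0.
set X := \sum_i v 0 i *: w i.
have X0 : X != 0 by apply: contra_neq v0; exact: inj.
have XF : X *m F = mu *: X.
  rewrite /X mulmx_suml scaler_sumr.
  under eq_bigr do rewrite -scalemxAl hL scaler_sumr.
  rewrite exchange_big /=; apply: eq_bigr => j _.
  under eq_bigr do rewrite scalerA.
  rewrite -scaler_suml scalerA; congr (_ *: _).
  by have /matrixP/(_ 0 j) := vL; rewrite !mxE => ->.
have [j Xj] : exists j, col j (X^t*) != 0.
  apply: contrapT => /forallNP h; case/eqP: X0.
  rewrite -[X]ctmxK; apply/matrixP => a b; rewrite !mxE.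
  have /negP/negPn/eqP/matrixP/(_ b 0) := h a.
  by rewrite !mxE => ->; rewrite conjC0.
have := hF (col j (X^t*)).
have -> : F^t* *m col j (X^t*) = mu^* *: col j (X^t*).
  have -> : F^t* *m col j (X^t*) = col j ((X *m F)^t*) by rewrite ctmxM !colE mulmxA.
  by rewrite XF; apply/matrixP => a b; rewrite !mxE rmorphM.
rewrite l2normZ cabs_conj ler_pM2r // lt_def l2norm_ge0 andbT.
by apply: contra_neq Xj; exact: l2norm_eq0.
Qed.

End DetBound.

(** * Characters of archimedean preorders *)

Section ArchimedeanPreorder.
Variables (R : realType) (Z : comNzRingType) (i : {rmorphism R -> Z}) (Zr : set Z).
Implicit Types (T : set Z) (x y f : Z) (r s e : R).

Hypothesis ZrD : forall x y, Zr x -> Zr y -> Zr (x + y).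
Hypothesis ZrM : forall x y, Zr x -> Zr y -> Zr (x * y).
Hypothesis Zri : forall r, Zr (i r).

(** An archimedean quadratic preorder. The ambient ring [Z] is complex in the application, so the
    real elements are given as a subset [Zr], later the fixed points of the involution. *)
Record preorder T : Prop := Preorder {
  pre_real : T `<=` Zr;
  preD : forall x y, T x -> T y -> T (x + y);
  preM : forall x y, T x -> T y -> T (x * y);
  pre_sqr : forall x, Zr x -> T (x * x);
  pre_nneg : forall r, 0 <= r -> T (i r);
  pre_arch : forall x, Zr x -> exists r, T (i r - x) }.

Definition proper_pre T := preorder T /\ ~ T (-1).

Let ZrN x : Zr x -> Zr (- x).
Proof.
move=> h; have -> : - x = i (-1) * x by ring.
exact: ZrM.
Qed.

Definition adjoin T f : set Z := [set x | exists a b, [/\ T a, T b & x = a + f * b]].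

Lemma adjoin_preorder T f : preorder T -> Zr f -> preorder (adjoin T f).
Proof.
move=> pT Zf; have T0 : T 0 by rewrite -(rmorph0 i); exact: (pre_nneg pT).
have sub : T `<=` adjoin T f by move=> x Tx; exists x, 0; split => //; ring.
split.
- move=> _ [a [b [Ta Tb ->]]].
  by apply: ZrD; [|apply: ZrM => //]; exact: (pre_real pT).
- move=> _ _ [a [b [Ta Tb ->]]] [c [d [Tc Td ->]]].
  by exists (a + c), (b + d); split; [exact: (preD pT)|exact: (preD pT)|ring].
- move=> _ _ [a [b [Ta Tb ->]]] [c [d [Tc Td ->]]].
  (* [f * f] belongs to [T] as a square, so the product of the two terms in [f] falls back into
     [T]. *)
  exists (a * c + (f * f) * (b * d)), (a * d + c * b); split; [| |ring].
    apply: (preD pT); first exact: (preM pT).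
    by apply: (preM pT); [exact: (pre_sqr pT)|exact: (preM pT)].
  by apply: (preD pT); exact: (preM pT).
- by move=> x Zx; apply: sub; exact: (pre_sqr pT).
- by move=> r r0; apply: sub; exact: (pre_nneg pT).
- by move=> x /(pre_arch pT)[r Tr]; exists r; exact: sub.
Qed.

Lemma bigcup_preorder (F : set (set Z)) : F !=set0 -> total_on F subset ->
  (forall T, F T -> proper_pre T) -> proper_pre (\bigcup_(T in F) T).
Proof.
move=> [T0 FT0] tot h.
have two T1 T2 x y : F T1 -> F T2 -> T1 x -> T2 y -> exists T, [/\ F T, T x & T y].
  move=> F1 F2 x1 y2; have [s|s] := tot _ _ F1 F2.
    by exists T2; split => //; exact: s.
  by exists T1; split => //; exact: s.
have [p0 _] := h _ FT0.
split; last by move=> [T FT T1]; case: (h _ FT).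
split.
- by move=> x [T FT Tx]; have [pT _] := h _ FT; exact: (pre_real pT).
- move=> x y [T1 F1 x1] [T2 F2 y2]; have [T [FT Tx Ty]] := two _ _ _ _ F1 F2 x1 y2.
  by exists T => //; have [pT _] := h _ FT; exact: (preD pT).
- move=> x y [T1 F1 x1] [T2 F2 y2]; have [T [FT Tx Ty]] := two _ _ _ _ F1 F2 x1 y2.
  by exists T => //; have [pT _] := h _ FT; exact: (preM pT).
- by move=> x Zx; exists T0 => //; exact: (pre_sqr p0).
- by move=> r r0; exists T0 => //; exact: (pre_nneg p0).
- by move=> x Zx; have [r Tr] := pre_arch p0 Zx; exists r; exists T0.
Qed.

Lemma maximal_pre T0 : proper_pre T0 ->
  exists T, [/\ proper_pre T, T0 `<=` T & forall T', proper_pre T' -> T `<=` T' -> T' `<=` T].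
Proof.
(* Zorn's lemma also has to cover the empty chain; adding [T0] to every candidate provides its
   bound. *)
move=> p0; pose P X := proper_pre (T0 `|` X).
have [|X [PX maxX]] := @Zorn_bigcup Z P.
  move=> F FP tot; rewrite /P.
  have [->|/set0P[X FX]] := eqVneq F set0; first by rewrite bigcup_set0 setU0.
  have -> : T0 `|` \bigcup_(X in F) X = \bigcup_(T in [set T0 `|` X | X in F]) T.
    apply/seteqP; split=> [x [T0x|[Y FY Yx]]|x [_ [Y FY <-]] [T0x|Yx]].
    - by exists (T0 `|` X); [exists X|left].
    - by exists (T0 `|` Y); [exists Y|right].
    - by left.
    - by right; exists Y.
  apply: bigcup_preorder; first by exists (T0 `|` X), X.
    move=> _ _ [Y FY <-] [Y' FY' <-].
    by have [s|s] := tot _ _ FY FY'; [left|right]; exact: setUS.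
  by move=> _ [Y FY <-]; exact: FP.
exists (T0 `|` X); split; [exact: PX|by move=> x; left|].
move=> T' pT' sT; apply: contrapT => nsub; apply: (maxX T').
  split; first by apply: subset_trans sT; exact: subsetUr.
  by move=> h; apply: nsub => x /h; right.
rewrite /P; suff -> : T0 `|` T' = T' by [].
apply/seteqP; split=> [x [Tx|//]|x]; last by right.
by apply: sT; left.
Qed.

Section Maximal.
Variable T : set Z.
Hypothesis pT : preorder T.
Hypothesis nT : ~ T (-1).
Hypothesis maxT : forall T', proper_pre T' -> T `<=` T' -> T' `<=` T.

(** Otherwise both [f] and [- f] could be adjoined only at the price of -1, and the two
    representations of -1 combine into one inside [T]. *)
Lemma maximal_total f : Zr f -> T f \/ T (- f).
Proof.
have T0 : T 0 by rewrite -(rmorph0 i); exact: (pre_nneg pT).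
have T1 : T 1 by rewrite -(rmorph1 i); exact: (pre_nneg pT).
have key g : Zr g -> T g \/ adjoin T g (-1).
  move=> Zg; have [h|h] := pselect (adjoin T g (-1)); first by right.
  left; apply: (maxT (conj (adjoin_preorder pT Zg) h)).
    by move=> x Tx; exists x, 0; split => //; ring.
  by exists 0, 1; split => //; ring.
move=> Zf; have [|[a [b [Ta Tb e1]]]] := key f Zf; first by left.
have [|[c [d [Tc Td e2]]]] := key (- f) (ZrN Zf); first by right.
(* This is the product of [1 + a = - (f * b)] and [1 + c = f * d]. *)
case: nT; have -> : -1 = a + c + a * c + (f * f) * (b * d).
  have -> : a = -1 - f * b by rewrite e1; ring.
  have -> : c = -1 - (- f) * d by rewrite e2; ring.
  ring.
apply: (preD pT); last by apply: (preM pT); [exact: (pre_sqr pT)|exact: (preM pT)].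
by apply: (preD pT); [exact: (preD pT)|exact: (preM pT)].
Qed.

Lemma maximal_real r : T (i r) -> 0 <= r.
Proof.
move=> Tr; rewrite leNgt; apply/negP => r0; apply: nT.
have -> : -1 = i (- r^-1) * i r.
  by rewrite -rmorphM mulNr mulVf ?rmorphN1 // lt_eqF.
by apply: (preM pT) => //; apply: (pre_nneg pT); rewrite oppr_ge0 invr_le0 ltW.
Qed.

Lemma maximal_scale r x : 0 <= r -> T x -> T (i r * x).
Proof. by move=> r0 Tx; apply: (preM pT) => //; exact: (pre_nneg pT). Qed.

(** The value at [x] of the character attached to [T]. The margin [e] allows for infinitesimals,
    which [T] may contain with only one sign. *)
Definition approx x r := forall e, 0 < e -> T (x - i (r - e)) /\ T (i (r + e) - x).

(** The [r] with [x - i r] in [T] form the lower half of a Dedekind cut. The archimedean property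
    makes it nonempty and bounded, and totality of [T] supplies the upper estimate at its
    supremum. *)
Lemma approx_exists x : Zr x -> exists r, approx x r.
Proof.
move=> Zx; pose S := [set r | T (x - i r)].
have [M hM] := pre_arch pT Zx.
have [m hm] := pre_arch pT (ZrN Zx).
have ub : ubound S M.
  move=> r Sr; rewrite -subr_ge0; apply: maximal_real.
  have -> : i (M - r) = (i M - x) + (x - i r) by ring.
  exact: (preD pT).
have hS : has_sup S.
  split; last by exists M.
  by exists (- m); rewrite /S /=; have -> : x - i (- m) = i m - - x by ring.
exists (sup S) => e e0; split.
  have [r Sr hr] := sup_adherent e0 hS.
  have -> : x - i (sup S - e) = (x - i r) + i (r - (sup S - e)) by ring.
  by apply: (preD pT) => //; apply: (pre_nneg pT); rewrite subr_ge0 ltW.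
have Zxe : Zr (x - i (sup S + e)) by apply: ZrD => //; exact: ZrN.
have [h|h] := maximal_total Zxe; last first.
  by have <- : - (x - i (sup S + e)) = i (sup S + e) - x by ring.
have := ub_le_sup hS.2 h.
by rewrite gerDl leNgt e0.
Qed.

Lemma approx_uniq x r s : approx x r -> approx x s -> r = s.
Proof.
have le a b : approx x a -> approx x b -> a <= b.
  move=> ha hb; apply/ler_addgt0Pr => e e0.
  have e2 : 0 < e / 2 by rewrite divr_gt0.
  have [h1 _] := ha _ e2; have [_ h2] := hb _ e2.
  rewrite -subr_ge0; apply: maximal_real.
  have -> : i (b + e - a) = (x - i (a - e / 2)) + (i (b + e / 2) - x).
    by rewrite [X in i (b + X - a)](splitr e); ring.
  exact: (preD pT).
by move=> hr hs; apply/eqP; rewrite eq_le !le.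
Qed.

Lemma approx_real r : approx (i r) r.
Proof.
move=> e e0; split.
  by rewrite -rmorphB; apply: (pre_nneg pT); rewrite opprB addrCA subrr addr0 ltW.
by rewrite -rmorphB; apply: (pre_nneg pT); rewrite addrAC subrr add0r ltW.
Qed.

Lemma approxD x y r s : approx x r -> approx y s -> approx (x + y) (r + s).
Proof.
move=> hx hy e e0; have e2 : 0 < e / 2 by rewrite divr_gt0.
have [h1 h2] := hx _ e2; have [h3 h4] := hy _ e2; split.
  have -> : x + y - i (r + s - e) = (x - i (r - e / 2)) + (y - i (s - e / 2)).
    by rewrite [X in i (_ - X)](splitr e); ring.
  exact: (preD pT).
have -> : i (r + s + e) - (x + y) = (i (r + e / 2) - x) + (i (s + e / 2) - y).
  by rewrite [X in i (_ + X)](splitr e); ring.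
exact: (preD pT).
Qed.

Lemma approxN x r : approx x r -> approx (- x) (- r).
Proof.
move=> hx e e0; have [h1 h2] := hx e e0; split.
  by have -> : - x - i (- r - e) = i (r + e) - x by ring.
by have -> : i (- r + e) - - x = x - i (r - e) by ring.
Qed.

Lemma approx_scale_nneg x r c : 0 <= c -> approx x r -> approx (i c * x) (c * r).
Proof.
move=> c0 hx e e0; have c1 : 0 < c + 1 by rewrite ltr_wpDl.
have d0 : 0 < e / (c + 1) by rewrite divr_gt0.
have [h1 h2] := hx _ d0.
have ee : 0 <= e - c * (e / (c + 1)).
  have -> : e - c * (e / (c + 1)) = e / (c + 1) by field; rewrite gt_eqF.
  exact: ltW.
split.
  have -> : i c * x - i (c * r - e) =
      i c * (x - i (r - e / (c + 1))) + i (e - c * (e / (c + 1))) by ring.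
  by apply: (preD pT); [exact: maximal_scale|exact: (pre_nneg pT)].
have -> : i (c * r + e) - i c * x =
    i c * (i (r + e / (c + 1)) - x) + i (e - c * (e / (c + 1))) by ring.
by apply: (preD pT); [exact: maximal_scale|exact: (pre_nneg pT)].
Qed.

Lemma approx_scale x r c : approx x r -> approx (i c * x) (c * r).
Proof.
move=> hx; have [c0|/ltW c0] := leP 0 c; first exact: approx_scale_nneg.
have := approxN (approx_scale_nneg (c := - c) _ hx); rewrite oppr_ge0 => /(_ c0).
have -> : - (i (- c) * x) = i c * x by ring.
by have -> : - (- c * r) = c * r by ring.
Qed.

(** With [d] the square root of [e], the elements [2 * (d * d + u * v)] and [2 * (d * d - u * v)]
    are sums of products of [d + u], [d - u], [d + v] and [d - v], all of which lie in [T]. *)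
Lemma approxM0 u v : approx u 0 -> approx v 0 -> approx (u * v) 0.
Proof.
move=> hu hv e e0; pose d := Num.sqrt e; have d0 : 0 < d by rewrite sqrtr_gt0.
have dd : e = d * d by rewrite -expr2 sqr_sqrtr // ltW.
have := hu _ d0; have := hv _ d0; rewrite !sub0r !add0r => -[h1 h2] [h3 h4].
have half x : T (i 2 * x) -> T x.
  move=> h; have -> : x = i 2^-1 * (i 2 * x).
    by rewrite mulrA -rmorphM mulVf ?rmorph1 ?mul1r // pnatr_eq0.
  by apply: maximal_scale => //; rewrite invr_ge0.
split; apply: half; rewrite dd.
  have -> : i 2 * (u * v - i (- (d * d))) =
    (u - i (- d)) * (v - i (- d)) + (i d - u) * (i d - v) by rewrite (_ : 2 = 1 + 1 :> R) //; ring.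
  by apply: (preD pT); exact: (preM pT).
have -> : i 2 * (i (d * d) - u * v) =
    (u - i (- d)) * (i d - v) + (i d - u) * (v - i (- d)) by rewrite (_ : 2 = 1 + 1 :> R) //; ring.
by apply: (preD pT); exact: (preM pT).
Qed.

Lemma approxM x y r s : approx x r -> approx y s -> approx (x * y) (r * s).
Proof.
move=> hx hy.
have c z t : approx z t -> approx (z - i t) 0.
  by move=> h; rewrite -(subrr t); apply: approxD => //; apply: approxN; exact: approx_real.
have := approxM0 (c _ _ hx) (c _ _ hy).
move=> /approxD/(_ (approx_scale r hy)) /approxD/(_ (approx_scale s hx)).
move=> /approxD/(_ (approxN (approx_real (r * s)))).
have -> : (x - i r) * (y - i s) + i r * y + i s * x - i (r * s) = x * y by ring.
by have -> : 0 + r * s + s * r - r * s = r * s by ring.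
Qed.

Lemma approx_ge0 x r : T x -> approx x r -> 0 <= r.
Proof.
move=> Tx hx; apply/ler_addgt0Pr => e e0; have [_ h] := hx e e0.
apply: maximal_real; rewrite -[i _](subrK x).
exact: (preD pT).
Qed.

End Maximal.

(** Adjoin [- g]. If -1 becomes a member, its representation is the algebraic certificate; otherwise
    a maximal proper extension defines a character that is nonnegative at [- g]. *)
Lemma preorder_character T0 g : preorder T0 -> Zr g ->
  (exists a b, [/\ T0 a, T0 b & g * b = 1 + a]) \/
  exists chi : Z -> R, [/\ forall r, chi (i r) = r,
    (forall x y, Zr x -> Zr y -> chi (x + y) = chi x + chi y),
    (forall x y, Zr x -> Zr y -> chi (x * y) = chi x * chi y),
    (forall x, T0 x -> 0 <= chi x) & chi g <= 0].
Proof.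
move=> p0 Zg; have p1 := adjoin_preorder p0 (ZrN Zg).
have [[a [b [Ta Tb e]]]|n1] := pselect (adjoin T0 (- g) (-1)).
  left; exists a, b; split => //.
  have -> : a = -1 - (- g) * b by rewrite e; ring.
  by ring.
right; have [T [[pT nT] sT maxT]] := maximal_pre (conj p1 n1).
have sub : T0 `<=` adjoin T0 (- g).
  move=> x Tx; exists x, 0; split => //; last by ring.
  by rewrite -(rmorph0 i); exact: (pre_nneg p0).
(* Outside [Zr] the value 0 is a placeholder, so that choice yields a total function. *)
have ex x : exists r, Zr x -> approx T x r.
  have [Zx|nZ] := pselect (Zr x); last by exists 0.
  by have [r hr] := approx_exists pT nT maxT Zx; exists r.
have [chi hchi] := choice ex.
exists chi; split.
- by move=> r; apply: (approx_uniq pT nT) (hchi _ _) (approx_real pT _).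
- move=> x y Zx Zy; apply: (approx_uniq pT nT) (hchi _ _) (approxD pT _ _); first exact: ZrD.
    exact: hchi.
  exact: hchi.
- move=> x y Zx Zy; apply: (approx_uniq pT nT) (hchi _ _) (approxM pT _ _); first exact: ZrM.
    exact: hchi.
  exact: hchi.
- move=> x Tx; apply: (approx_ge0 pT nT (x := x)); first exact/sT/sub.
  by apply: hchi; exact: (pre_real p0).
rewrite -oppr_ge0; apply: (approx_ge0 pT nT (x := - g)).
  apply: sT; exists 0, 1; split; rewrite -?(rmorph0 i) -?(rmorph1 i);
    by [apply: (pre_nneg p0) | ring].
by apply: approxN; exact: hchi.
Qed.

End ArchimedeanPreorder.

Lemma addr_perm (V : zmodType) (a b c d : V) : a + b + (c + d) = a + d + (b + c).
Proof. by rewrite -!addrA; congr (_ + _); rewrite addrA addrC. Qed.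

(** * Fibres over the center *)

Section PointwiseRelations.
Variable R : realType.
Local Notation C := (Cplx R).

Lemma mul_comb (a b c d : C) (X Y V W : 'M[C]_4) :
  (a *: X + b *: Y) *m (c *: V + d *: W) =
  (a * c) *: (X *m V) + (b * d) *: (Y *m W) + ((a * d) *: (X *m W) + (b * c) *: (Y *m V)).
Proof.
rewrite mulmxDl !mulmxDr -!scalemxAl -!scalemxAr !scalerA.
exact: addr_perm.
Qed.

Lemma comb_mul (s r s' r' : C) (Z P Q Z' P' Q' : 'M[C]_2) :
  (s *: kron Z Q + r *: kron P 1%:M) *m (s' *: kron Z' Q' + r' *: kron P' 1%:M) =
  (s * s') *: kron (Z *m Z') (Q *m Q') + (r * r') *: kron (P *m P') 1%:M +
  ((s * r') *: kron (Z *m P') Q + (r * s') *: kron (P *m Z') Q').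
Proof.
rewrite mul_comb (kronM Z Z') (kronM P P' 1%:M) (kronM Z P' Q) (kronM P Z' 1%:M).
by rewrite [1%:M *m 1%:M]mul1mx (mulmx1 Q) (mul1mx Q').
Qed.

Lemma comb_ctmx (s r : C) (Z P Q : 'M[C]_2) :
  (s *: kron Z Q + r *: kron P 1%:M)^t* =
  s^* *: kron (Z^t*) (Q^t*) + r^* *: kron (P^t*) 1%:M.
Proof.
rewrite linearD /= !linearZ /= map_mxD !map_mxZ !kron_ctmx.
by rewrite [(1%:M)^t*]ctmx1.
Qed.

Section Point.
Variable p : dom R.
Let x1 := cx1 p.
Let x2 := cx2 p.
Let r := cr p.
Let w := cw p.
Let w1 := cw1 p.
Let w2 := cw2 p.

Lemma circle_conj (z : circle R) : val z * (val z)^* = 1.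
Proof.
rewrite mulC_conj; have h := set_valP z.
have -> : cabs (val z) = 1 by apply: (@complexI R); rewrite cabsE; exact: h.
by rewrite expr1n.
Qed.

Let ww : w * w^* = 1. Proof. exact: circle_conj. Qed.
Let ww1 : w1 * w1^* = 1. Proof. exact: circle_conj. Qed.
Let ww2 : w2 * w2^* = 1. Proof. exact: circle_conj. Qed.

Lemma Ihalf_bounds (x : Ihalf R) : 0 <= val x <= 2^-1.
Proof. by case: x => x /= /set_mem; rewrite /Ihalf /= in_itv. Qed.

Lemma Iunit_bounds (x : Iunit R) : 0 <= val x <= 1.
Proof. by case: x => x /= /set_mem; rewrite /Iunit /= in_itv. Qed.

Lemma rsqrt_sqr (x : R) : 0 <= x -> rsqrt x * rsqrt x = x%:C.
Proof. by move=> x0; rewrite -realcM -expr2 sqr_sqrtr. Qed.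

Lemma rsqrt_conj (x : R) : (rsqrt x)^* = rsqrt x.
Proof. exact: conj_realc. Qed.

Let q1 : rsqrt x1 * rsqrt x1 = x1%:C.
Proof. by apply: rsqrt_sqr; case/andP: (Ihalf_bounds p.1.1.1.1.2). Qed.
Let q2 : rsqrt x2 * rsqrt x2 = x2%:C.
Proof. by apply: rsqrt_sqr; case/andP: (Ihalf_bounds p.1.1.1.2). Qed.

Lemma half_le1 (x : R) : x <= 2^-1 -> 0 <= 1 - x.
Proof. lra. Qed.

Let q1' : rsqrt (1 - x1) * rsqrt (1 - x1) = 1 - x1%:C.
Proof.
rewrite rsqrt_sqr ?realcB //; apply: half_le1.
by case/andP: (Ihalf_bounds p.1.1.1.1.2).
Qed.
Let q2' : rsqrt (1 - x2) * rsqrt (1 - x2) = 1 - x2%:C.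
Proof.
rewrite rsqrt_sqr ?realcB //; apply: half_le1.
by case/andP: (Ihalf_bounds p.1.1.1.2).
Qed.
Let qr : rsqrt (1 - r ^+ 2) * rsqrt (1 - r ^+ 2) = 1 - r%:C * r%:C.
Proof.
rewrite rsqrt_sqr ?realcB ?expr2 ?realcM // subr_ge0 -expr2.
by case/andP: (Iunit_bounds p.1.1.1.1.1) => h0 h1; rewrite expr_le1.
Qed.

Section OffDiagonal.
Variables (u a b : C) (x : C).
Hypotheses (uu : u * u^* = 1) (ca : a^* = a) (cb : b^* = b).
Hypotheses (aa : a * a = x) (bb : b * b = 1 - x).
Local Notation O := (mx2 0 (u * a) b 0).
Local Notation P := (mx2 0 b (- (u^* * a)) 0).

Let uau : u * a * (u^* * a) = x.
Proof. by rewrite mulrACA uu mul1r aa. Qed.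

Lemma O_star : O^t* = mx2 0 b (u^* * a) 0.
Proof. by rewrite mx2_ctmx rmorphM /= ca cb conjC0. Qed.

Lemma P_star : P^t* = mx2 0 (- (u * a)) b 0.
Proof. by rewrite mx2_ctmx rmorphN rmorphM /= conjCK ca cb conjC0. Qed.

Lemma O_rel : O^t* *m O + O *m O^t* = 1%:M.
Proof.
rewrite O_star !mx2M mx2D mx2_scalar; congr mx2; rewrite ?(mul0r, mulr0, add0r, addr0) //.
  by rewrite uau bb subrK.
by rewrite [_ * (u * a)]mulrC uau bb addrC subrK.
Qed.

Lemma P_rel : P^t* *m P + P *m P^t* = 1%:M.
Proof.
rewrite P_star !mx2M mx2D mx2_scalar; congr mx2; rewrite ?(mul0r, mulr0, add0r, addr0) //.
  by rewrite mulrNN uau bb addrC subrK.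
by rewrite mulrNN [u^* * a * _]mulrC uau bb subrK.
Qed.

Lemma OP_rel : O^t* *m P = - (P *m O^t*).
Proof.
by rewrite O_star !mx2M -[RHS]scaleN1r mx2Z; congr mx2; ring.
Qed.

Lemma OP_anti : O *m P + P *m O = (1 - x - x)%:M.
Proof.
rewrite !mx2M mx2D mx2_scalar; congr mx2; rewrite ?(mul0r, mulr0, add0r, addr0) //.
  by rewrite mulrN uau bb addrC.
by rewrite mulNr [u^* * a * _]mulrC uau bb.
Qed.

Lemma O_sqr : O *m O = (u * (a * b))%:M.
Proof.
by rewrite !mx2M mx2_scalar; congr mx2; ring.
Qed.

Lemma P_sqr : P *m P = (- (u^* * (a * b)))%:M.
Proof.
by rewrite !mx2M mx2_scalar; congr mx2; ring.
Qed.

Lemma sigz_P : sigz R *m P + P *m sigz R = 0.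
Proof. by rewrite !mx2M mx2D mx2_0; congr mx2; ring. Qed.

Lemma sigz_P_star : sigz R *m P^t* + P^t* *m sigz R = 0.
Proof. by rewrite P_star !mx2M mx2D mx2_0; congr mx2; ring. Qed.

Lemma sigz_O : sigz R *m O + O *m sigz R = 0.
Proof. by rewrite !mx2M mx2D mx2_0; congr mx2; ring. Qed.

Lemma sigz_O_star : sigz R *m O^t* + O^t* *m sigz R = 0.
Proof. by rewrite O_star !mx2M mx2D mx2_0; congr mx2; ring. Qed.

End OffDiagonal.

Lemma assemble (a b b' c c' d d' : C) (X X' Y Y' U U' V V' : 'M[C]_4) :
  a + b = 1 -> b' = b -> c' = c -> d' = d ->
  X + X' = 1%:M -> Y + Y' = 1%:M -> U + U' = 0 -> V + V' = 0 ->
  a *: X + b' *: Y + (c *: U + d *: V) + (a *: X' + b *: Y' + (d' *: V' + c' *: U')) = 1%:M.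
Proof.
move=> ab -> -> -> XX YY UU VV; rewrite addrACA (addrACA (a *: X)) -!scalerDr XX YY.
by rewrite -scalerDl ab scale1r [X in _ + (_ + X)]addrC addrACA -!scalerDr UU VV !scaler0 !addr0.
Qed.

Section AbstractGenerators.
Variables (Z O P Q : 'M[C]_2) (s t u : C) (c al pp qq : C).
Hypotheses (Zs : Z^t* = Z) (ZZ : Z *m Z = 1%:M).
Hypotheses (OO : O^t* *m O + O *m O^t* = 1%:M) (PP : P^t* *m P + P *m P^t* = 1%:M).
Hypotheses (QQ : Q^t* *m Q + Q *m Q^t* = 1%:M) (OP : O^t* *m P = - (P *m O^t*)).
Hypotheses (ZP : Z *m P + P *m Z = 0) (ZPs : Z *m P^t* + P^t* *m Z = 0).
Hypotheses (ZO : Z *m O + O *m Z = 0) (ZOs : Z *m O^t* + O^t* *m Z = 0).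
Hypotheses (ss : s^* = s) (tu : t^* = u) (st : s * s + t * u = 1).
Hypotheses (anti : O *m P + P *m O = c%:M) (O2 : O *m O = al%:M).
Hypotheses (P2 : P *m P = pp%:M) (Q2 : Q *m Q = qq%:M).
Let G1 := kron O 1%:M.
Let G2 := s *: kron Z Q + t *: kron P 1%:M.

Lemma G1_rel : G1^t* *m G1 + G1 *m G1^t* = 1%:M.
Proof.
rewrite /G1 kron_ctmx ctmx1 (kronM _ O 1%:M 1%:M) (kronM O _ 1%:M 1%:M) mul1mx kronDl OO.
exact: kron1.
Qed.

(** The cross terms vanish since [Z] anticommutes with [P] and with its adjoint; what remains is the
    sum of the relations for [Q] and [P], weighted by [s * s] and [t * u]. *)
Lemma G2_rel : G2^t* *m G2 + G2 *m G2^t* = 1%:M.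
Proof.
rewrite /G2 comb_ctmx !comb_mul Zs ss ZZ tu.
apply: assemble; first exact: st.
- exact: mulrC.
- exact: mulrC.
- exact: mulrC.
- by rewrite kronDr QQ kron1.
- by rewrite kronDl PP kron1.
- by rewrite kronDl ZP kron0l.
- by rewrite kronDl addrC ZPs kron0l.
Qed.

Lemma G12_rel : G1^t* *m G2 = - (G2 *m G1^t*).
Proof.
rewrite /G1 /G2 kron_ctmx ctmx1 mulmxDr mulmxDl -!scalemxAr -!scalemxAl.
rewrite (kronM _ Z 1%:M) (kronM _ P 1%:M) (kronM Z _ Q) (kronM P _ 1%:M).
rewrite [1%:M *m 1%:M]mul1mx (mul1mx Q) (mulmx1 Q) OP.
have -> : O^t* *m Z = - (Z *m O^t*) by apply/eqP; rewrite -addr_eq0 addrC ZOs.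
by rewrite -!kronNl !scalerN -opprD.
Qed.

Lemma kron_scalar (a : C) : kron a%:M 1%:M = a%:M :> 'M[C]_4.
Proof. by rewrite -[a%:M in LHS]scalemx1 -kronZl kron1 scalemx1. Qed.

Lemma kron_scalar' (a : C) : kron 1%:M a%:M = a%:M :> 'M[C]_4.
Proof. by rewrite -[a%:M in LHS]scalemx1 -kronZr kron1 scalemx1. Qed.

Lemma G1_sqr : G1 *m G1 = al%:M.
Proof.
by rewrite /G1 (kronM O O 1%:M) mul1mx O2 kron_scalar.
Qed.

Lemma G2_sqr : G2 *m G2 = (s * s * qq + t * t * pp)%:M.
Proof.
rewrite /G2 comb_mul ZZ Q2 P2 kron_scalar kron_scalar' [t * s]mulrC.
rewrite -scalerDr kronDl ZP kron0l scaler0 addr0.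
by rewrite !scale_scalar_mx -raddfD.
Qed.

Lemma G12_anti : G1 *m G2 + G2 *m G1 = (t * c)%:M.
Proof.
rewrite /G1 /G2 mulmxDr mulmxDl -!scalemxAr -!scalemxAl.
rewrite (kronM _ Z 1%:M) (kronM _ P 1%:M) (kronM Z _ Q) (kronM P _ 1%:M).
rewrite [1%:M *m 1%:M]mul1mx (mul1mx Q) (mulmx1 Q) addrACA -!scalerDr !kronDl.
rewrite (addrC (O *m Z)) ZO anti kron0l scaler0 add0r kron_scalar.
by rewrite scale_scalar_mx.
Qed.

End AbstractGenerators.

Lemma gen1_rel : (gen1 p)^t* *m gen1 p + gen1 p *m (gen1 p)^t* = 1%:M.
Proof.
rewrite gen1E; apply: G1_rel; apply: O_rel q1 q1' => //; exact: rsqrt_conj.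
Qed.

Let s := rsqrt (1 - r ^+ 2).
Let t := r%:C * w.

Let st : s * s + t * t^* = 1.
Proof. by rewrite qr /t rmorphM /= conj_realc mulrACA ww mulr1 subrK. Qed.

Lemma gen2_rel : (gen2 p)^t* *m gen2 p + gen2 p *m (gen2 p)^t* = 1%:M.
Proof.
rewrite gen2E; apply: G2_rel.
- exact: sigz_ctmx.
- exact: sigz_sqr.
- by apply: P_rel q1 q1' => //; exact: rsqrt_conj.
- by apply: O_rel q2 q2' => //; exact: rsqrt_conj.
- exact: sigz_P.
- by apply: sigz_P_star; exact: rsqrt_conj.
- exact: rsqrt_conj.
- by [].
- exact: st.
Qed.

Lemma gen12_rel : (gen1 p)^t* *m gen2 p = - (gen2 p *m (gen1 p)^t*).
Proof.
rewrite gen1E gen2E; apply: G12_rel.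
- by apply: OP_rel; exact: rsqrt_conj.
- by apply: sigz_O_star; exact: rsqrt_conj.
Qed.

(** The values of the two squares and the anticommutator at [p]. They are kept in the form phase
    times modulus, from which [polar_inj] recovers the coordinates. *)
Definition alphav : C := w1 * (rsqrt x1 * rsqrt (1 - x1)).
Definition betav : C := s * s * (w2 * (rsqrt x2 * rsqrt (1 - x2))) +
  t * t * (- (w1^* * (rsqrt x1 * rsqrt (1 - x1)))).
Definition gammav : C := t * (1 - x1%:C - x1%:C).

Lemma gen1_sqr : gen1 p *m gen1 p = alphav%:M.
Proof. by rewrite gen1E; apply: G1_sqr; exact: O_sqr. Qed.

Lemma gen2_sqr : gen2 p *m gen2 p = betav%:M.
Proof.
rewrite gen2E; apply: G2_sqr; [exact: sigz_sqr|exact: sigz_P|exact: P_sqr|exact: O_sqr].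
Qed.

Lemma gen12_anti : gen1 p *m gen2 p + gen2 p *m gen1 p = gammav%:M.
Proof.
rewrite gen1E gen2E; apply: G12_anti; first exact: sigz_O.
by apply: OP_anti q1 q1'.
Qed.

End Point.
End PointwiseRelations.

(** * Product algebras and generated *-algebras *)

Section ProductAlgebra.
Variables (R : realType) (A B : cstarType R).
Local Notation C := (Cplx R).
Local Notation X := (A * B)%type.
Implicit Types x y : X.

Definition prod_star x : X := (star x.1, star x.2).
Definition prod_norm x : R := Num.max (cnorm x.1) (cnorm x.2).

Lemma prod_norm_le x (K : R) : (prod_norm x <= K) = (cnorm x.1 <= K) && (cnorm x.2 <= K).
Proof. exact: ge_max. Qed.
Lemma prod_norm_lt x (K : R) : (prod_norm x < K) = (cnorm x.1 < K) && (cnorm x.2 < K).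
Proof. exact: gt_max. Qed.
Lemma prod_norm1 x : cnorm x.1 <= prod_norm x. Proof. by rewrite le_max lexx. Qed.
Lemma prod_norm2 x : cnorm x.2 <= prod_norm x. Proof. by rewrite le_max lexx orbT. Qed.
Lemma prod_norm_ge0 x : 0 <= prod_norm x.
Proof. exact: le_trans (cnorm_ge0 _) (prod_norm1 x). Qed.

Fact prod_starK : involutive prod_star.
Proof. by case=> a b; rewrite /prod_star /= !starK. Qed.
Fact prod_starD : {morph prod_star : x y / x + y}.
Proof. by case=> a b [c d]; rewrite /prod_star /= !starD. Qed.
Fact prod_starZ (c : C) x : prod_star (c *: x) = c^* *: prod_star x.
Proof. by case: x => a b; rewrite /prod_star /= !starZ. Qed.
Fact prod_starM x y : prod_star (x * y) = prod_star y * prod_star x.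
Proof. by case: x y => a b [c d]; rewrite /prod_star /= !starM. Qed.
Fact prod_norm_eq0 x : prod_norm x = 0 -> x = 0.
Proof.
move=> x0; have [] : cnorm x.1 = 0 /\ cnorm x.2 = 0.
  by split; apply/eqP; rewrite eq_le cnorm_ge0 andbT -x0 ?prod_norm1 ?prod_norm2.
by case: x {x0} => a b /= /cnorm_eq0 -> /cnorm_eq0 ->.
Qed.
Fact prod_normD x y : prod_norm (x + y) <= prod_norm x + prod_norm y.
Proof.
rewrite prod_norm_le; apply/andP; split; apply: le_trans (ler_cnormD _ _) _.
  by rewrite lerD ?prod_norm1.
by rewrite lerD ?prod_norm2.
Qed.
Fact prod_normZ (c : C) x : prod_norm (c *: x) = cabs c * prod_norm x.
Proof. by rewrite /prod_norm /= !cnormZ maxr_pMr ?cabs_ge0. Qed.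
Fact prod_normM x y : prod_norm (x * y) <= prod_norm x * prod_norm y.
Proof.
rewrite prod_norm_le; apply/andP; split; apply: le_trans (ler_cnormM _ _) _.
  by rewrite ler_pM ?cnorm_ge0 ?prod_norm1.
by rewrite ler_pM ?cnorm_ge0 ?prod_norm2.
Qed.
Fact prod_norm_cstar x : prod_norm (prod_star x * x) = prod_norm x ^+ 2.
Proof.
rewrite /prod_norm /= !cnorm_cstar.
case: (leP (cnorm x.1) (cnorm x.2)) => h.
  by rewrite max_r // ler_pXn2r ?nnegrE ?cnorm_ge0.
by rewrite max_l // ler_pXn2r ?nnegrE ?cnorm_ge0 // ltW.
Qed.
Fact prod_complete (u : nat -> X) :
  (forall e : R, 0 < e -> exists N : nat, forall m n : nat,
     (N <= m)%N -> (N <= n)%N -> prod_norm (u m - u n) < e) ->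
  exists l : X, (fun n => prod_norm (u n - l)) @ \oo --> (0 : R).
Proof.
move=> h.
have [|a ha] := @complete_dist R A (fun n => (u n).1).
  by move=> e /h[N hN]; exists N => m n Nm Nn; apply: le_lt_trans (hN _ _ Nm Nn); exact: (prod_norm1 (u m - u n)).
have [|b hb] := @complete_dist R B (fun n => (u n).2).
  by move=> e /h[N hN]; exists N => m n Nm Nn; apply: le_lt_trans (hN _ _ Nm Nn); exact: (prod_norm2 (u m - u n)).
exists (a, b); apply/cvgrPdist_lt => e e0.
have [N hN] := ha e e0; have [M hM] := hb e e0.
exists (maxn N M) => // n /=; rewrite geq_max => /andP[Nn Mn].
by rewrite sub0r normrN ger0_norm ?prod_norm_ge0 // prod_norm_lt hN ?hM.
Qed.

Definition prod_cstar : cstarType R :=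
  @CStarType R X prod_star prod_norm prod_starK prod_starD prod_starZ prod_starM
    prod_norm_eq0 prod_normD prod_normZ prod_normM prod_norm_cstar prod_complete.

Lemma prod_wcar (a1 a2 : A) (b1 b2 : B) : wcar a1 a2 -> wcar b1 b2 ->
  wcar (A := prod_cstar) (a1, b1) (a2, b2).
Proof.
move=> [h1 h2 h3] [k1 k2 k3]; split.
- by rewrite -[RHS]/((1, 1) : X) -h1 -k1.
- by rewrite -[RHS]/((1, 1) : X) -h2 -k2.
by rewrite -[RHS]/((- (a2 * star a1), - (b2 * star b1)) : X) -h3 -k3.
Qed.
End ProductAlgebra.

Section GeneratedAlgebra.
Variables (R : realType).
Local Notation C := (Cplx R).

(** Membership replaces noncommutative polynomials: in a product algebra, a generated element is the
    pair of evaluations of one and the same polynomial. *)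
Inductive genalg (E : cstarType R) (a1 a2 : E) : E -> Prop :=
| GenScal (c : C) : genalg a1 a2 (c *: 1)
| Gen1 : genalg a1 a2 a1
| Gen1s : genalg a1 a2 (star a1)
| Gen2 : genalg a1 a2 a2
| Gen2s : genalg a1 a2 (star a2)
| GenD x y : genalg a1 a2 x -> genalg a1 a2 y -> genalg a1 a2 (x + y)
| GenM x y : genalg a1 a2 x -> genalg a1 a2 y -> genalg a1 a2 (x * y).

Section Closure.
Variables (E : cstarType R) (a1 a2 : E).
Local Notation ga := (genalg a1 a2).

Lemma Gen_1 : ga 1. Proof. by rewrite -(scale1r 1); exact: GenScal. Qed.
Lemma GenZ (c : C) x : ga x -> ga (c *: x).
Proof. by move=> gx; rewrite -[x]mul1r scalerAl; apply: GenM => //; exact: GenScal. Qed.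
Lemma GenN x : ga x -> ga (- x).
Proof. by rewrite -scaleN1r; exact: GenZ. Qed.
Lemma GenB x y : ga x -> ga y -> ga (x - y).
Proof. by move=> gx gy; apply: GenD => //; exact: GenN. Qed.
Lemma Gen_sqr x : ga x -> ga (x ^+ 2).
Proof. by move=> gx; rewrite expr2; exact: GenM. Qed.

Lemma Gen_star x : ga x -> ga (star x).
Proof.
elim=> [c|||||y z _ ihy _ ihz|y z _ ihy _ ihz]; rewrite ?starK.
- by rewrite starZ star1; exact: GenScal.
- exact: Gen1s.
- exact: Gen1.
- exact: Gen2s.
- exact: Gen2.
- by rewrite starD; exact: GenD.
- by rewrite starM; exact: GenM.
Qed.

Lemma Gen_comm x y : commutes_with_gens a1 a2 x -> ga y -> x * y = y * x.
Proof.
move=> [h1 h2 h3 h4]; elim=> // [c|y' z _ ihy _ ihz|y' z _ ihy _ ihz].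
- by rewrite -scalerAr -scalerAl mulr1 mul1r.
- by rewrite mulrDr mulrDl ihy ihz.
- by rewrite mulrA ihy -!mulrA ihz.
Qed.
End Closure.

Lemma Gen_hom_eq (E E' : cstarType R) (a1 a2 x : E) (f g : {lrmorphism E -> E'}) :
  {morph f : x / star x} -> {morph g : x / star x} -> f a1 = g a1 -> f a2 = g a2 ->
  genalg a1 a2 x -> f x = g x.
Proof.
move=> fs gs e1 e2; elim=> [c|||||y z _ ihy _ ihz|y z _ ihy _ ihz]; rewrite ?fs ?gs ?e1 ?e2 //.
- by rewrite !linearZ /= !rmorph1.
- by rewrite !rmorphD /= ihy ihz.
- by rewrite !rmorphM /= ihy ihz.
Qed.

Section Lift.
Variables (A B : cstarType R) (a1 a2 : A) (b1 b2 : B).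
Local Notation gX := (@genalg (prod_cstar A B) (a1, b1) (a2, b2)).

(** The partner [a] is the value in [A] of some expression for [b]; that it depends on [b] alone is
    a consequence of the norm inequality. *)
Lemma Gen_lift b : genalg b1 b2 b -> exists a : A, gX (a, b).
Proof.
elim=> [c|||||y z _ [a ga] _ [a' ga']|y z _ [a ga] _ [a' ga']].
- by exists (c *: 1); exact: (@GenScal (prod_cstar A B) (a1, b1) (a2, b2) c).
- by exists a1; exact: Gen1.
- by exists (star a1); exact: (@Gen1s (prod_cstar A B) (a1, b1) (a2, b2)).
- by exists a2; exact: Gen2.
- by exists (star a2); exact: (@Gen2s (prod_cstar A B) (a1, b1) (a2, b2)).
- by exists (a + a'); exact: (GenD ga ga').
- by exists (a * a'); exact: (GenM ga ga').
Qed.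

End Lift.

End GeneratedAlgebra.

Lemma addr_rot (V : zmodType) (a b c d : V) : a + b + c + d = c + d + a + b.
Proof. by rewrite -[LHS]addrA addrC addrA. Qed.

Lemma addr_swap2 (V : zmodType) (a b c d : V) : a + b + c + d = b + a + d + c.
Proof. by rewrite -!addrA [d + c]addrC addrCA. Qed.

Lemma addr_mid (V : zmodType) (a b c d : V) : a + b + c + d = a + d + (b + c).
Proof. by rewrite -!addrA; congr (_ + _); rewrite addrA addrC. Qed.

(** * Commutants in the algebra of matrices of size 4 *)

Section SecondFactor.
Variable R : realType.
Local Notation C := (Cplx R).
Local Notation E11 := (mx2 1 0 0 0 : 'M[C]_2).
Local Notation E12 := (mx2 0 1 0 0 : 'M[C]_2).
Local Notation E21 := (mx2 0 0 1 0 : 'M[C]_2).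
Local Notation E22 := (mx2 0 0 0 1 : 'M[C]_2).

(** Expansion in the matrix units of the second tensor factor, as opposed to [kron_blocks]. It suits
    [kron (symm phi) (sigz R)], because [sigz] multiplies these units by signs. *)
Definition kron4 (X Y Z T : 'M[C]_2) : 'M[C]_4 :=
  kron X E11 + kron Y E12 + kron Z E21 + kron T E22.

Lemma kron4E x y z t x' y' z' t' x2 y2 z2 t2 x3 y3 z3 t3 :
  kron4 (mx2 x y z t) (mx2 x' y' z' t') (mx2 x2 y2 z2 t2) (mx2 x3 y3 z3 t3) =
  block_mx (mx2 x x' x2 x3) (mx2 y y' y2 y3) (mx2 z z' z2 z3) (mx2 t t' t2 t3).
Proof.
rewrite /kron4 !kronE !blkD !mx2Z !mx2D.
by rewrite !(mulr0, mulr1, addr0, add0r).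
Qed.

Lemma kron4_exists (M : 'M[C]_4) : exists X Y Z T, M = kron4 X Y Z T.
Proof.
have [A [B [D [E ->]]]] := blkE M.
exists (mx2 (A 0 0) (B 0 0) (D 0 0) (E 0 0)), (mx2 (A 0 1) (B 0 1) (D 0 1) (E 0 1)),
  (mx2 (A 1 0) (B 1 0) (D 1 0) (E 1 0)), (mx2 (A 1 1) (B 1 1) (D 1 1) (E 1 1)).
by rewrite kron4E -!mx2E.
Qed.

Lemma kron4_inj (X Y Z T X' Y' Z' T' : 'M[C]_2) :
  kron4 X Y Z T = kron4 X' Y' Z' T' -> [/\ X = X', Y = Y', Z = Z' & T = T'].
Proof.
rewrite (mx2E X) (mx2E Y) (mx2E Z) (mx2E T) (mx2E X') (mx2E Y') (mx2E Z') (mx2E T').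
rewrite !kron4E => /block_inj[] /mx2_inj[-> -> -> ->] /mx2_inj[-> -> -> ->].
by move=> /mx2_inj[-> -> -> ->] /mx2_inj[-> -> -> ->].
Qed.

Lemma symm_comm (phi : R) (F : 'M[C]_2) : symm phi *m F = F *m symm phi ->
  exists a b : C, F = a%:M + b *: symm phi.
Proof.
rewrite (mx2E F) !mx2M !(mul0r, mulr0, addr0, add0r) => /mx2_inj[h1 h2 _ _].
set e := cexp (phi / 2) in h1 h2 *; have ee : e * e^* = 1 by exact: cexp_conj_mul.
exists (F 0 0), (F 1 0 * e); rewrite mx2_scalar mx2Z mx2D -/e; congr mx2.
- by rewrite mulr0 addr0.
- rewrite add0r -mulrA mulrC -mulrA [e * (F 1 0)]h1 [F 0 1 * _]mulrC mulrA ee mul1r //.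
- by rewrite add0r -mulrA ee mulr1.
rewrite mulr0 addr0; have e0 : e != 0.
  by apply: contra_eq_neq ee => ->; rewrite mul0r eq_sym oner_neq0.
by apply: (mulfI e0); rewrite h2 mulrC.
Qed.

Lemma symm_anticomm (phi : R) (F : 'M[C]_2) : symm phi *m F = - (F *m symm phi) ->
  exists a b : C, F = (a%:M + b *: symm phi) *m sigz R.
Proof.
move=> h; have [|a [b hF]] := @symm_comm phi (F *m sigz R).
  by rewrite mulmxA h mulNmx -!mulmxA symm_sigz mulmxN opprK.
by exists a, b; rewrite -hF -mulmxA sigz_sqr mulmx1.
Qed.

(** Comparing signs, the coefficients of the diagonal units commute with [symm phi], while those of
    the off-diagonal units anticommute with it and hence carry a factor [sigz]. *)
Lemma kron4_comm_sz (phi : R) (M : 'M[C]_4) :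
  kron (symm phi) (sigz R) *m M = M *m kron (symm phi) (sigz R) ->
  exists X Y Z T, M = kron4 X Y Z T /\
  [/\ exists a b : C, X = a%:M + b *: symm phi,
      exists a b : C, Y = (a%:M + b *: symm phi) *m sigz R,
      exists a b : C, Z = (a%:M + b *: symm phi) *m sigz R &
      exists a b : C, T = a%:M + b *: symm phi].
Proof.
have [X [Y [Z [T ->]]]] := kron4_exists M => h; exists X, Y, Z, T; split => //.
have e11 : sigz R *m E11 = E11 by rewrite mx2M; congr mx2; ring.
have e12 : sigz R *m E12 = E12 by rewrite mx2M; congr mx2; ring.
have e21 : sigz R *m E21 = - E21 by rewrite mx2M -[RHS]scaleN1r mx2Z; congr mx2; ring.
have e22 : sigz R *m E22 = - E22 by rewrite mx2M -[RHS]scaleN1r mx2Z; congr mx2; ring.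
have f11 : E11 *m sigz R = E11 by rewrite mx2M; congr mx2; ring.
have f12 : E12 *m sigz R = - E12 by rewrite mx2M -[RHS]scaleN1r mx2Z; congr mx2; ring.
have f21 : E21 *m sigz R = E21 by rewrite mx2M; congr mx2; ring.
have f22 : E22 *m sigz R = - E22 by rewrite mx2M -[RHS]scaleN1r mx2Z; congr mx2; ring.
set S := symm phi in h *.
have l : kron S (sigz R) *m kron4 X Y Z T = kron4 (S *m X) (S *m Y) (- (S *m Z)) (- (S *m T)).
  rewrite /kron4 !mulmxDr (kronM S X) (kronM S Y) (kronM S Z) (kronM S T) e11 e12 e21 e22.
  by rewrite !kronNr -!kronNl.
have r : kron4 X Y Z T *m kron S (sigz R) = kron4 (X *m S) (- (Y *m S)) (Z *m S) (- (T *m S)).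
  rewrite /kron4 !mulmxDl (kronM X S) (kronM Y S) (kronM Z S) (kronM T S) f11 f12 f21 f22.
  by rewrite !kronNr -!kronNl.
move: h; rewrite l r => /kron4_inj[h1 h2 h3 h4]; split.
- exact: symm_comm.
- exact: symm_anticomm.
- by apply: symm_anticomm; rewrite -h3 opprK.
- by apply: symm_comm; exact: oppr_inj.
Qed.

Lemma kron_swapZ (k : C) (A B : 'M[C]_2) : kron A (k *: B) = kron (k *: A) B.
Proof. by rewrite -kronZr kronZl. Qed.

Lemma kron4_comm_1s (phi : R) (X Y Z T : 'M[C]_2) :
  kron 1%:M (symm phi) *m kron4 X Y Z T = kron4 X Y Z T *m kron 1%:M (symm phi) ->
  kron4 X Y Z T = kron X 1%:M + cexp (phi / 2) *: kron Z (symm phi).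
Proof.
set v := cexp (phi / 2); have vv : v * v^* = 1 by exact: cexp_conj_mul.
have sE : symm phi = mx2 0 v v^* 0 by [].
have e11 : symm phi *m E11 = v^* *: E21 by rewrite sE mx2M mx2Z; congr mx2; ring.
have e12 : symm phi *m E12 = v^* *: E22 by rewrite sE mx2M mx2Z; congr mx2; ring.
have e21 : symm phi *m E21 = v *: E11 by rewrite sE mx2M mx2Z; congr mx2; ring.
have e22 : symm phi *m E22 = v *: E12 by rewrite sE mx2M mx2Z; congr mx2; ring.
have f11 : E11 *m symm phi = v *: E12 by rewrite sE mx2M mx2Z; congr mx2; ring.
have f12 : E12 *m symm phi = v^* *: E11 by rewrite sE mx2M mx2Z; congr mx2; ring.
have f21 : E21 *m symm phi = v *: E22 by rewrite sE mx2M mx2Z; congr mx2; ring.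
have f22 : E22 *m symm phi = v^* *: E21 by rewrite sE mx2M mx2Z; congr mx2; ring.
have l : kron 1%:M (symm phi) *m kron4 X Y Z T = kron4 (v *: Z) (v *: T) (v^* *: X) (v^* *: Y).
  rewrite /kron4 !mulmxDr (kronM _ X) (kronM _ Y) (kronM _ Z) (kronM _ T) !mul1mx.
  by rewrite e11 e12 e21 e22 !kron_swapZ; exact: addr_rot.
have r : kron4 X Y Z T *m kron 1%:M (symm phi) = kron4 (v^* *: Y) (v *: X) (v^* *: T) (v *: Z).
  rewrite /kron4 !mulmxDl (kronM X) (kronM Y) (kronM Z) (kronM T) !mulmx1.
  by rewrite f11 f12 f21 f22 !kron_swapZ; exact: addr_swap2.
rewrite l r => /kron4_inj[h1 h2 _ _].
have v0 : v != 0 by apply: contra_eq_neq vv => ->; rewrite mul0r eq_sym oner_neq0.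
have -> : T = X by apply: (scalerI v0).
have -> : Y = (v * v) *: Z by rewrite -scalerA h1 scalerA vv scale1r.
have -> : v *: kron Z (symm phi) = kron ((v * v) *: Z) E12 + kron Z E21.
  rewrite kronZr sE mx2Z vv -kron_swapZ kronDr mx2Z mx2D; congr (kron _ (mx2 _ _ _ _)); ring.
have -> : kron X 1%:M = kron X E11 + kron X E22.
  by rewrite kronDr mx2D mx2_scalar !addr0 add0r.
by rewrite /kron4; exact: addr_mid.
Qed.

End SecondFactor.

Section FullMatrixAlgebra.
Variable R : realType.
Local Notation C := (Cplx R).

(** For [O] the given matrix, the product of its adjoint with [O] is diagonal with entries [1 - x]
    and [x]. These differ, so subtracting [x] isolates the first diagonal matrix unit, and [O]
    carries it to the others. *)
Lemma full_mx2 (S : 'M[C]_2 -> Prop) (w a b x : C) :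
  (forall A B, S A -> S B -> S (A + B)) -> (forall A B, S A -> S B -> S (A *m B)) ->
  (forall (c : C) A, S A -> S (c *: A)) -> (forall A, S A -> S (A^t*)) -> S 1%:M ->
  w * w^* = 1 -> a^* = a -> b^* = b -> a * a = x -> b * b = 1 - x ->
  b != 0 -> 1 - x - x != 0 -> S (mx2 0 (w * a) b 0) -> forall X, S X.
Proof.
move=> SD SM SZ Ss S1 ww ca cb aa bb b0 x0 SO X.
set O := mx2 0 _ _ 0 in SO.
have S11 : S (mx2 1 0 0 0).
  have -> : mx2 1 0 0 0 = (1 - x - x)^-1 *: (O^t* *m O + (- x) *: 1%:M).
    rewrite (O_star w ca cb) mx2M mx2_scalar !mx2Z mx2D mx2Z.
    rewrite !(mulr0, mul0r, add0r, addr0, mulr1) bb mulVf //.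
    by rewrite mulrACA aa [w^* * w]mulrC ww mul1r subrr mulr0.
  by apply: (SZ); apply: (SD); [apply: (SM) => //; exact: Ss|exact: SZ].
have S22 : S (mx2 0 0 0 1).
  have -> : mx2 0 0 0 1 = 1%:M + (-1) *: mx2 1 0 0 0 :> 'M[C]_2.
    by rewrite mx2_scalar mx2Z mx2D; congr mx2; ring.
  by apply: (SD) => //; exact: SZ.
have S21 : S (mx2 0 0 1 0).
  have -> : mx2 0 0 1 0 = b^-1 *: (O *m mx2 1 0 0 0).
    by rewrite mx2M mx2Z !(mulr0, mul0r, add0r, addr0, mulr1) mulVf.
  by apply: (SZ); exact: SM.
have S12 : S (mx2 0 1 0 0).
  by have := Ss _ S21; rewrite mx2_ctmx conjC0 conjC1.
rewrite (mx2E X).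
have -> : mx2 (X 0 0) (X 0 1) (X 1 0) (X 1 1) =
  (X 0 0) *: mx2 1 0 0 0 + (X 0 1) *: mx2 0 1 0 0 + ((X 1 0) *: mx2 0 0 1 0 + (X 1 1) *: mx2 0 0 0 1).
  by rewrite !mx2Z !mx2D; congr mx2; ring.
by apply: (SD); apply: (SD); exact: SZ.
Qed.
End FullMatrixAlgebra.

(** * Values of generated sections at a point *)

Section PointImage.
Variable R : realType.
Local Notation C := (Cplx R).
Variable L : dom R -> 'M[C]_4 -> dom R -> Prop.
Hypotheses (eq1 : equivariant L (@gen1 R)) (eq2 : equivariant L (@gen2 R)).
Local Notation fn := (@sval _ _).
Local Notation B := (balg_cstar L).

Definition gsec1 : B := exist _ _ (conj (@gen1_continuous R) eq1).
Definition gsec2 : B := exist _ _ (conj (@gen2_continuous R) eq2).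

Lemma gsec_wcar : wcar gsec1 gsec2.
Proof.
split; apply: balgP => p.
- exact: gen1_rel.
- exact: gen2_rel.
by rewrite balgNE; exact: gen12_rel.
Qed.

Definition img p (M : 'M[C]_4) := exists2 y : B, genalg gsec1 gsec2 y & fn y p = M.

Section AtPoint.
Variable p : dom R.

Lemma imgD M N : img p M -> img p N -> img p (M + N).
Proof. by move=> [y gy <-] [z gz <-]; exists (y + z) => //; exact: GenD. Qed.
Lemma imgM M N : img p M -> img p N -> img p (M *m N).
Proof. by move=> [y gy <-] [z gz <-]; exists (y * z) => //; exact: GenM. Qed.
Lemma imgZ (c : C) M : img p M -> img p (c *: M).
Proof. by move=> [y gy <-]; exists (c *: y) => //; exact: GenZ. Qed.
Lemma img_star M : img p M -> img p (M^t*).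
Proof. by move=> [y gy <-]; exists (star y) => //; exact: Gen_star. Qed.
Lemma img_1 : img p 1%:M.
Proof. by exists 1 => //; exact: Gen_1. Qed.
Lemma img_gen1 : img p (gen1 p). Proof. by exists gsec1 => //; exact: Gen1. Qed.
Lemma img_gen2 : img p (gen2 p). Proof. by exists gsec2 => //; exact: Gen2. Qed.

Let half_neq (x : R) : 0 <= x -> x < 2^-1 ->
  rsqrt (1 - x) != 0 /\ 1 - x%:C - x%:C != 0 :> C.
Proof.
move=> x0 x1; split.
  by rewrite /rsqrt realc_eq0 gt_eqF // sqrtr_gt0; lra.
by rewrite -[1]/(1%:C) -!realcB realc_eq0 gt_eqF //; lra.
Qed.

Let b1 := Ihalf_bounds p.1.1.1.1.2.
Let b2 := Ihalf_bounds p.1.1.1.2.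

Lemma img_left : cx1 p < 2^-1 -> forall X, img p (kron X 1%:M).
Proof.
move=> x1; have /andP[x10 _] := b1; have [q0 q1] := half_neq x10 x1.
apply: (@full_mx2 R (fun X => img p (kron X 1%:M)) (cw1 p) (rsqrt (cx1 p)) (rsqrt (1 - cx1 p)) (cx1 p)%:C).
- by move=> X Y hX hY; rewrite -kronDl; exact: imgD.
- by move=> X Y hX hY; rewrite -[1%:M]mul1mx -kronM; exact: imgM.
- by move=> c X hX; rewrite -kronZl; exact: imgZ.
- by move=> X hX; rewrite -[1%:M]ctmx1 -kron_ctmx; exact: img_star.
- by rewrite kron1; exact: img_1.
- exact: circle_conj.
- exact: rsqrt_conj.
- exact: rsqrt_conj.
- exact: rsqrt_sqr.
- rewrite rsqrt_sqr ?realcB //.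
  by move: x1; lra.
- exact: q0.
- exact: q1.
- by have := img_gen1; rewrite gen1E.
Qed.

Lemma img_right : img p (kron 1%:M (offdiag (cw2 p) (cx2 p))) -> cx2 p < 2^-1 ->
  forall X, img p (kron 1%:M X).
Proof.
move=> h x2; have /andP[x20 _] := b2; have [q0 q1] := half_neq x20 x2.
apply: (@full_mx2 R (fun X => img p (kron 1%:M X)) (cw2 p) (rsqrt (cx2 p)) (rsqrt (1 - cx2 p)) (cx2 p)%:C).
- by move=> X Y hX hY; rewrite -kronDr; exact: imgD.
- by move=> X Y hX hY; rewrite -[1%:M]mul1mx -kronM; exact: imgM.
- by move=> c X hX; rewrite -kronZr; exact: imgZ.
- by move=> X hX; rewrite -[1%:M]ctmx1 -kron_ctmx; exact: img_star.
- by rewrite kron1; exact: img_1.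
- exact: circle_conj.
- exact: rsqrt_conj.
- exact: rsqrt_conj.
- exact: rsqrt_sqr.
- rewrite rsqrt_sqr ?realcB //.
  by move: x2; lra.
- exact: q0.
- exact: q1.
- exact: h.
Qed.

(** The second summand of [gen2] is already available by [img_left] and can be subtracted. Since
    [cr p < 1], the coefficient of the first summand is invertible, and its factor [sigz] squares to
    1. *)
Lemma img_offdiag2 : cx1 p < 2^-1 -> cr p < 1 ->
  img p (kron 1%:M (offdiag (cw2 p) (cx2 p))).
Proof.
move=> x1 r1; have hl := img_left x1.
have := img_gen2; rewrite gen2E; set s := rsqrt _; set O2 := offdiag _ _; set t := _ * cw p.
move=> h; have s0 : s != 0.
  have /andP[r0 _] := Iunit_bounds p.1.1.1.1.1.
  rewrite /s /rsqrt realc_eq0 gt_eqF // sqrtr_gt0 subr_gt0 expr_lt1 //.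
have -> : kron 1%:M O2 = kron (sigz R) 1%:M *m (s^-1 *: ((s *: kron (sigz R) O2 +
    t *: kron (offdiag' (cw1 p) (cx1 p)) 1%:M) + (- t) *: kron (offdiag' (cw1 p) (cx1 p)) 1%:M)).
  rewrite scaleNr addrK scalerA mulVf // scale1r (kronM (sigz R)) sigz_sqr mul1mx.
  by [].
by apply: imgM => //; apply: imgZ; apply: imgD => //; exact: imgZ.
Qed.

Lemma img_kron X Y : img p (kron X 1%:M) -> img p (kron 1%:M Y) -> img p (kron X Y).
Proof.
move=> hX hY; have -> : kron X Y = kron X 1%:M *m kron 1%:M Y; last exact: imgM.
by rewrite (kronM X) mulmx1 mul1mx.
Qed.

Lemma img_generic : cx1 p < 2^-1 -> cr p < 1 -> cx2 p < 2^-1 -> forall M, img p M.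
Proof.
move=> x1 r1 x2 M; have hl := img_left x1; have hr := img_right (img_offdiag2 x1 r1) x2.
have [X [Y [Z [T ->]]]] := kron_blocks M.
by do 3 (apply: imgD; last by apply: img_kron); apply: img_kron.
Qed.

Lemma img_sum_symm (X : 'M[C]_2) (a b : C) phi :
  img p (kron X 1%:M) -> img p (kron 1%:M (symm phi)) ->
  img p (kron X (a%:M + b *: symm phi)).
Proof.
move=> hX hS; apply: img_kron => //; rewrite -kronDr; apply: imgD.
  by rewrite kron_scalar' -scalemx1; apply: imgZ; exact: img_1.
by rewrite -kronZr; exact: imgZ.
Qed.

Lemma offdiag_symm_scale phi : rsqrt (2^-1 : R) * cexp (phi / 2) != 0.
Proof.
rewrite mulf_neq0 //.
  by rewrite /rsqrt realc_eq0 gt_eqF // sqrtr_gt0 invr_gt0.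
apply: contra_eq_neq (cexp_conj_mul (phi / 2)) => ->.
by rewrite mul0r eq_sym oner_neq0.
Qed.

Lemma img_boundary2 phi M : cx1 p < 2^-1 -> cr p < 1 -> cx2 p = 2^-1 -> cw2 p = cexp phi ->
  kron 1%:M (symm phi) *m M = M *m kron 1%:M (symm phi) -> img p M.
Proof.
move=> x1 r1 x2 w2; have hl := img_left x1; have := img_offdiag2 x1 r1.
rewrite x2 w2 offdiag_half -kronZr => hS.
have {}hS : img p (kron 1%:M (symm phi)).
  have := imgZ (rsqrt 2^-1 * cexp (phi / 2))^-1 hS.
  by rewrite scalerA mulVf ?offdiag_symm_scale // scale1r.
have [X [Y [Z [T ->]]]] := kron_blocks M => h.
have : [/\ symm phi *m X = X *m symm phi, symm phi *m Y = Y *m symm phi,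
  symm phi *m Z = Z *m symm phi & symm phi *m T = T *m symm phi].
  move: h; rewrite !mulmxDr !mulmxDl !(kronM 1%:M) !mul1mx.
  rewrite !(kronM _ 1%:M) !mulmx1 !kronE !scale1r !scale0r !blkD !addr0 !add0r.
  by move/block_inj.
move=> [/symm_comm[a [b ->]] /symm_comm[a' [b' ->]] /symm_comm[c [d ->]] /symm_comm[c' [d' ->]]].
by do 3 (apply: imgD; last by apply: img_sum_symm); apply: img_sum_symm.
Qed.

Lemma gen2_r0 : cr p = 0 -> gen2 p = kron (sigz R) (offdiag (cw2 p) (cx2 p)).
Proof.
move=> r0; rewrite gen2E r0 expr0n /= subr0 mul0r scale0r addr0 /rsqrt sqrtr1.
exact: scale1r.
Qed.

Lemma img_symm1 phi1 : cx1 p = 2^-1 -> cw1 p = cexp phi1 -> img p (kron (symm phi1) 1%:M).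
Proof.
move=> x1 w1; have := img_gen1; rewrite gen1E x1 w1 offdiag_half -kronZl => hS.
have := imgZ (rsqrt 2^-1 * cexp (phi1 / 2))^-1 hS.
by rewrite scalerA mulVf ?offdiag_symm_scale // scale1r.
Qed.

Lemma img_sum_symm1 (X : 'M[C]_2) (a b : C) phi1 : img p (kron (symm phi1) 1%:M) ->
  img p (kron 1%:M X) -> img p (kron (a%:M + b *: symm phi1) X).
Proof.
move=> hS hX; apply: img_kron => //; rewrite -kronDl; apply: imgD.
  by rewrite kron_scalar -scalemx1; apply: imgZ; exact: img_1.
by rewrite -kronZl; exact: imgZ.
Qed.

Lemma img_sum_symm1z (X : 'M[C]_2) (a b : C) phi1 : img p (kron (symm phi1) 1%:M) ->
  img p (kron (sigz R) X) -> img p (kron ((a%:M + b *: symm phi1) *m sigz R) X).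
Proof.
move=> hS hX; have -> : kron ((a%:M + b *: symm phi1) *m sigz R) X =
    kron (a%:M + b *: symm phi1) 1%:M *m kron (sigz R) X.
  by rewrite (kronM _ (sigz R) 1%:M) mul1mx.
by apply: imgM => //; apply: img_sum_symm1 => //; rewrite kron1; exact: img_1.
Qed.

(** Here [gen1] yields only [kron (symm phi1) 1%:M], and [gen2] ties [sigz] to the second factor:
    the diagonal units of that factor are available alone, the off-diagonal ones only together with
    [sigz]. This matches the form found in [kron4_comm_sz]. *)
Lemma img_boundary1 phi1 M : cr p = 0 -> cx1 p = 2^-1 -> cw1 p = cexp phi1 -> cx2 p < 2^-1 ->
  kron (symm phi1) (sigz R) *m M = M *m kron (symm phi1) (sigz R) -> img p M.
Proof.
move=> r0 x1 w1 x2 h; have hS := img_symm1 x1 w1.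
have hg := img_gen2; rewrite (gen2_r0 r0) in hg.
have /andP[x20 _] := b2; have [q0 q1] := half_neq x20 x2.
set O := offdiag _ _ in hg.
have OE : O = mx2 0 (cw2 p * rsqrt (cx2 p)) (rsqrt (1 - cx2 p)) 0 by [].
have h11 : img p (kron 1%:M (mx2 1 0 0 0)).
  have -> : kron 1%:M (mx2 1 0 0 0) = (1 - (cx2 p)%:C - (cx2 p)%:C)^-1 *:
      ((kron (sigz R) O)^t* *m kron (sigz R) O + (- (cx2 p)%:C) *: 1%:M).
    rewrite kron_ctmx (kronM _ (sigz R)) sigz_ctmx sigz_sqr -kron1 kronZr kronDr kronZr.
    congr kron; rewrite OE O_star; [|exact: rsqrt_conj|exact: rsqrt_conj].
    rewrite mx2M mx2_scalar !mx2Z mx2D mx2Z !(mulr0, mul0r, add0r, addr0, mulr1).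
    rewrite rsqrt_sqr; last by move: x2; lra.
    rewrite realcB mulVf // mulrACA rsqrt_sqr // [_^* * _]mulrC.
    have -> : cw2 p * (cw2 p)^* = 1 by exact: circle_conj.
    by rewrite mul1r subrr mulr0.
  apply: imgZ; apply: imgD; last by apply: imgZ; exact: img_1.
  by apply: imgM => //; exact: img_star.
have h22 : img p (kron 1%:M (mx2 0 0 0 1)).
  have -> : kron 1%:M (mx2 0 0 0 1) = 1%:M + (-1) *: kron 1%:M (mx2 1 0 0 0) :> 'M[C]_4.
    rewrite -kron1 kronZr kronDr; congr kron.
    by rewrite mx2_scalar mx2Z mx2D; congr mx2; ring.
  by apply: imgD; [exact: img_1|exact: imgZ].
have h21 : img p (kron (sigz R) (mx2 0 0 1 0)).
  have -> : kron (sigz R) (mx2 0 0 1 0) =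
      (rsqrt (1 - cx2 p))^-1 *: (kron (sigz R) O *m kron 1%:M (mx2 1 0 0 0)).
    rewrite (kronM _ 1%:M) mulmx1 kronZr; congr kron.
    by rewrite OE mx2M mx2Z !(mulr0, mul0r, add0r, addr0, mulr1) mulVf.
  by apply: imgZ; exact: imgM.
have h12 : img p (kron (sigz R) (mx2 0 1 0 0)).
  by have := img_star h21; rewrite kron_ctmx sigz_ctmx mx2_ctmx conjC0 conjC1.
have [X [Y [Z [T [-> [[a [b ->]] [a' [b' ->]] [c [d ->]] [c' [d' ->]]]]]]]] := kron4_comm_sz h.
apply: imgD; [apply: imgD; [apply: imgD|]|].
- exact: img_sum_symm1.
- exact: img_sum_symm1z.
- exact: img_sum_symm1z.
- exact: img_sum_symm1.
Qed.

(** The two commutation relations leave the span of 1, [kron (symm phi1) 1%:M],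
    [kron (sigz R) (symm phi2)] and the product of the last two. *)
Lemma img_boundary12 phi1 phi2 M : cr p = 0 -> cx1 p = 2^-1 -> cw1 p = cexp phi1 ->
  cx2 p = 2^-1 -> cw2 p = cexp phi2 ->
  kron (symm phi1) (sigz R) *m M = M *m kron (symm phi1) (sigz R) ->
  kron 1%:M (symm phi2) *m M = M *m kron 1%:M (symm phi2) -> img p M.
Proof.
move=> r0 x1 w1 x2 w2 h h'; have hS := img_symm1 x1 w1.
have := img_gen2; rewrite (gen2_r0 r0) x2 w2 offdiag_half -kronZr => hg.
have {}hg : img p (kron (sigz R) (symm phi2)).
  have := imgZ (rsqrt 2^-1 * cexp (phi2 / 2))^-1 hg.
  by rewrite scalerA mulVf ?offdiag_symm_scale // scale1r.
have [X [Y [Z [T [e [[a [b eX]] _ [c [d eZ]] _]]]]]] := kron4_comm_sz h.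
rewrite e in h' *; rewrite (kron4_comm_1s h') eX eZ; apply: imgD.
  by apply: img_sum_symm1 => //; rewrite kron1; exact: img_1.
by apply: imgZ; exact: img_sum_symm1z.
Qed.

End AtPoint.
End PointImage.

(** * Polar coordinates and normal forms of points *)

Section Polar.
Variable R : realType.
Local Notation C := (Cplx R).

Lemma rsqrt_prod (x : R) : 0 <= x -> rsqrt x * rsqrt (1 - x) = (Num.sqrt (x * (1 - x)))%:C.
Proof. by move=> x0; rewrite -realcM -sqrtrM. Qed.

Lemma parabola_inj (x y : R) : 0 <= x <= 2^-1 -> 0 <= y <= 2^-1 ->
  x * (1 - x) = y * (1 - y) -> x = y.
Proof.
move=> /andP[x0 x1] /andP[y0 y1] e.
have : (x - y) * (1 - x - y) = 0 by rewrite -(subrr (x * (1 - x))) {2}e; ring.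
move/eqP; rewrite mulf_eq0 => /orP[|/eqP h]; first by rewrite subr_eq0 => /eqP.
lra.
Qed.

Lemma cabs_circle (w : C) : w * w^* = 1 -> cabs w = 1.
Proof.
rewrite mulC_conj => -[/eqP]; rewrite sqrf_eq1 => /orP[/eqP//|/eqP h].
by have := cabs_ge0 w; rewrite h lerNr oppr0 leNgt ltr01.
Qed.

Lemma polar_inj (w w' : C) (x x' : R) : w * w^* = 1 -> w' * w'^* = 1 ->
  0 <= x <= 2^-1 -> 0 <= x' <= 2^-1 ->
  w * (rsqrt x * rsqrt (1 - x)) = w' * (rsqrt x' * rsqrt (1 - x')) ->
  x = x' /\ (x != 0 -> w = w').
Proof.
move=> ww ww' hx hx'; have [/andP[x0 x1] /andP[x0' x1']] := (hx, hx').
rewrite !rsqrt_prod // => e.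
have p0 : 0 <= x * (1 - x) by rewrite mulr_ge0 //; lra.
have p0' : 0 <= x' * (1 - x') by rewrite mulr_ge0 //; lra.
have xx : x = x'.
  apply: parabola_inj => //; have := congr1 (@cabs R) e.
  rewrite !cabsM (cabs_circle ww) (cabs_circle ww') !mul1r !cabs_real !ger0_norm ?sqrtr_ge0 //.
  by move=> h; rewrite -(sqr_sqrtr p0) h sqr_sqrtr.
split => // xn0; rewrite -xx in e.
apply: (mulIf _ e); rewrite realc_eq0 gt_eqF // sqrtr_gt0 mulr_gt0 //.
  by rewrite lt_def xn0.
by lra.
Qed.

Lemma polar_exists (z : C) : exists2 psi, is_angle psi & z = `|z| * cexp psi.
Proof.
have [->|z0] := eqVneq z 0.
  by exists 0; [exact: angle0|rewrite normr0 mul0r].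
have n0 : `|z| != 0 by rewrite normr_eq0.
have [|psi h e] := @cexp_surj R (z / `|z|).
  by rewrite normrM normfV normr_id mulfV.
by exists psi => //; rewrite -e mulrC divfK.
Qed.

Lemma radius_exists (c : R) : 0 <= c <= 2^-1 -> exists t : Ihalf R,
  Num.sqrt (val t * (1 - val t)) = c.
Proof.
(* [t] is [(1 - s) / 2], the smaller root of [t * (1 - t) = c ^+ 2]. *)
move=> /andP[c0 c1]; pose s := Num.sqrt (1 - 4 * c ^+ 2).
have d0 : 0 <= 1 - 4 * c ^+ 2 by rewrite expr2; nra.
have s2 : s ^+ 2 = 1 - 4 * c ^+ 2 by rewrite sqr_sqrtr.
have s0 : 0 <= s by exact: sqrtr_ge0.
have s1 : s <= 1 by rewrite -(@ler_pXn2r _ 2) ?nnegrE // expr1n s2 gerBl mulr_ge0 ?sqr_ge0.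
have t0 : 0 <= (1 - s) / 2 by rewrite divr_ge0 // subr_ge0.
have t1 : (1 - s) / 2 <= 2^-1 by move: s0; lra.
pose t : Ihalf R := exist _ ((1 - s) / 2) (mem_Ihalf t0 t1); exists t => /=.
have -> : (1 - s) / 2 * (1 - (1 - s) / 2) = c ^+ 2.
  have -> : (1 - s) / 2 * (1 - (1 - s) / 2) = (1 - s ^+ 2) / 4 by field.
  by rewrite s2; field.
by rewrite sqrtr_sqr ger0_norm.
Qed.
End Polar.

Section Canonical.
Variable R : realType.
Local Notation C := (Cplx R).
Variable U : Iunit R -> Ihalf R -> R -> R -> R -> 'M[C]_4.
Hypothesis hU : is_intertwiner U.
Local Notation L := (bc_rel U).
Local Notation fn := (@sval _ _).

Definition same_values (p q : dom R) :=
  [/\ alphav p = alphav q, betav p = betav q & gammav p = gammav q].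

(** It is enough to transport the vanishing of sections, since two sections are compared through
    their difference. *)
Definition leads_to (p q : dom R) := same_values p q /\
  forall f : balg L, fn f q = 0 <-> fn f p = 0.

Lemma leads_to_trans p q s : leads_to p q -> leads_to q s -> leads_to p s.
Proof.
move=> [[a1 a2 a3] h] [[b1 b2 b3] k]; split; last by move=> f; split=> [/k/h|/h/k].
by split; [rewrite a1|rewrite a2|rewrite a3].
Qed.

Lemma scalar_conj (V : 'M[C]_4) (a b : C) : V \is unitarymx ->
  V^t* *m a%:M *m V = b%:M -> a = b.
Proof.
move=> /unitarymxP VV; rewrite mul_mx_scalar -scalemxAl (mulmx1C VV) scalemx1.
by move=> /matrixP/(_ 0 0); rewrite !mxE eqxx !mulr1n.
Qed.

Lemma bc_leads_to p V q : L p V q -> V \is unitarymx -> leads_to p q.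
Proof.
move=> Lpq uV; have e1 := gen1_equivariant hU; have e2 := gen2_equivariant hU.
have m (f g : dom R -> 'M[C]_4) : equivariant L f -> equivariant L g ->
    V^t* *m (f p *m g p) *m V = f q *m g q.
  by move=> ef eg; rewrite -(ef p V q) // -(eg p V q) // !mulmxA mulmxtVK.
split; last first.
  move=> f; have [_ ef] := svalP f; have := ef p V q Lpq uV => h.
  split=> [fq|fp]; last by rewrite -h fp mulmx0 mul0mx.
  rewrite fq in h.
  have /unitarymxP VV := uV.
  have -> : fn f p = V *m (V^t* *m fn f p *m V) *m V^t*.
    by rewrite !mulmxA VV mul1mx -mulmxA VV mulmx1.
  by rewrite h mulmx0 mul0mx.
split; apply: (scalar_conj uV).
- by rewrite -!gen1_sqr m.
- by rewrite -!gen2_sqr m.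
rewrite -(gen12_anti p) -(gen12_anti q) mulmxDr mulmxDl.
exact: (congr2 +%R (m _ _ e1 e2) (m _ _ e2 e1)).
Qed.

(* The free variables of a canonical point are normalised, and [x1 = 1/2] only occurs
   with [r1 = 0]; every fibre of the map [p |-> (a1^2, a2^2, a1 a2 + a2 a1)] contains
   exactly one of them. *)
Definition canonical (q : dom R) :=
  [/\ cx1 q = 2^-1 -> cr q = 0, cx1 q = 0 -> cw1 q = 1, cr q = 0 -> cw q = 1,
      cx2 q = 0 -> cw2 q = 1 & cr q = 1 -> cx2 q = 0].

Lemma cexp0 : cexp (0 : R) = 1.
Proof. by rewrite /cexp cos0 sin0. Qed.

(** [alphav] determines [x1] and [w1]; then [gammav] determines [r1] and [w] unless [x1 = 1/2]; what
    is left of [betav] determines [x2] and [w2] unless [r1 = 1]. The normalisations settle the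
    exceptions and the phases of vanishing moduli. *)
Lemma canonical_uniq p q : canonical p -> canonical q -> same_values p q -> p = q.
Proof.
move=> [p1 p2 p3 p4 p5] [q1 q2 q3 q4 q5] [hal hbe hga].
have [ex1 ew1] := polar_inj (circle_conj p.1.2) (circle_conj q.1.2)
  (Ihalf_bounds p.1.1.1.1.2) (Ihalf_bounds q.1.1.1.1.2) hal.
rewrite -/(cx1 p) -/(cx1 q) in ex1; rewrite -/(cx1 p) -/(cw1 p) -/(cw1 q) in ew1.
have ew : cw1 p = cw1 q.
  have [x0|x0] := eqVneq (cx1 p) 0; last exact: ew1.
  by rewrite p2 // q2 // -ex1.
have /andP[rp0 rp1] := Iunit_bounds p.1.1.1.1.1; have /andP[rq0 rq1] := Iunit_bounds q.1.1.1.1.1.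
have [er ewc] : cr p = cr q /\ cw p = cw q.
  have [h|h] := eqVneq (cx1 p) 2^-1.
    have rp := p1 h; have rq : cr q = 0 by apply: q1; rewrite -ex1.
    by rewrite rp rq p3 // q3.
  have d0 : 1 - (cx1 p)%:C - (cx1 p)%:C != 0 :> C.
    rewrite -[1]/(1%:C) -!realcB realc_eq0; apply: contra_neq h => e.
    by rewrite -[cx1 p]mul1r; lra.
  have e : (cr p)%:C * cw p = (cr q)%:C * cw q.
    by move: hga; rewrite /gammav -ex1 => /(mulIf d0).
  have er : cr p = cr q.
    have := congr1 (@cabs R) e; rewrite !cabsM !cabs_real (cabs_circle (circle_conj p.1.1.2)).
    by rewrite (cabs_circle (circle_conj q.1.1.2)) !mulr1 !ger0_norm.
  split => //; have [r0|r0] := eqVneq (cr p) 0; first by rewrite p3 // q3 // -er.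
  by rewrite -er in e; apply: (mulfI _ e); rewrite realc_eq0.
have [ex2 ew2] : cx2 p = cx2 q /\ cw2 p = cw2 q.
  have [r1|r1] := eqVneq (cr p) 1.
    have xp := p5 r1; have xq : cx2 q = 0 by apply: q5; rewrite -er.
    by rewrite xp xq p4 // q4.
  have s0 : rsqrt (1 - cr p ^+ 2) * rsqrt (1 - cr p ^+ 2) != 0.
    have lt1 : cr p < 1 by rewrite lt_def eq_sym r1.
    have h : 0 < 1 - cr p ^+ 2 by rewrite subr_gt0 expr_lt1.
    by rewrite rsqrt_sqr ?(ltW h) // realc_eq0 gt_eqF.
  have e : cw2 p * (rsqrt (cx2 p) * rsqrt (1 - cx2 p)) = cw2 q * (rsqrt (cx2 q) * rsqrt (1 - cx2 q)).
    by move: hbe; rewrite /betav -er -ewc -ew -ex1 => /addIr/(mulfI s0).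
  have [e2 h2] := polar_inj (circle_conj p.2) (circle_conj q.2)
    (Ihalf_bounds p.1.1.1.2) (Ihalf_bounds q.1.1.1.2) e.
  split=> //; have [x0|x0] := eqVneq (cx2 p) 0; last exact: h2.
  by rewrite p4 // q4 // /cx2 -e2.
move: er ex1 ex2 ewc ew ew2; clear.
case: p => [[[[[r x1] x2] w] w1] w2]; case: q => [[[[[r' x1'] x2'] w'] w1'] w2'].
rewrite /cr /cx1 /cx2 /cw /cw1 /cw2 /=.
by do 6 move=> /val_inj ->.
Qed.

Lemma one_uni : (1%:M : 'M[C]_4) \is unitarymx.
Proof. exact: one_unitary. Qed.

(** After [x2] and [phi2] are settled, only [phi] and [phi1] change, so the earlier normalisations
    persist. *)
Lemma reduce_generic r x1 x2 phi phi1 phi2 : val x1 != 2^-1 ->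
  is_angle phi -> is_angle phi1 -> is_angle phi2 ->
  exists x2' phi' phi1' phi2', [/\ is_angle phi', is_angle phi1', is_angle phi2',
    canonical (pt r x1 x2' phi' phi1' phi2') &
    leads_to (pt r x1 x2 phi phi1 phi2) (pt r x1 x2' phi' phi1' phi2')].
Proof.
move=> x1h a a1 a2.
have [x2' [phi2' [a2' s1 c4 c5]]] : exists x2' phi2', [/\ is_angle phi2',
    leads_to (pt r x1 x2 phi phi1 phi2) (pt r x1 x2' phi phi1 phi2'),
    val x2' = 0 -> cexp phi2' = 1 & val r = 1 -> val x2' = 0].
  have [r1|r1] := eqVneq (val r) 1.
    exists half0, 0; split => //; first exact: angle0.
      have -> : r = unit1 by exact: val_inj.
      exact: bc_leads_to (BcR1 _ _ _ a a1 a2) one_uni.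
    by rewrite cexp0.
  have [x0|x0] := eqVneq (val x2) 0; last first.
    by exists x2, phi2; split => // e; [move: x0; rewrite e eqxx|move: r1; rewrite e eqxx].
  exists x2, 0; split; [exact: angle0| |by rewrite cexp0|by []].
  have -> : x2 = half0 by exact: val_inj.
  exact: bc_leads_to (BcX2 _ _ _ a a1 a2) one_uni.
have [phi' [a' s2 c3]] : exists phi', [/\ is_angle phi',
    leads_to (pt r x1 x2' phi phi1 phi2') (pt r x1 x2' phi' phi1 phi2') &
    val r = 0 -> cexp phi' = 1].
  have [r0|r0] := eqVneq (val r) 0; last first.
    by exists phi; split => // e; move: r0; rewrite e eqxx.
  exists 0; split; [exact: angle0| |by rewrite cexp0].
  have -> : r = unit0 by exact: val_inj.
  exact: bc_leads_to (BcR0 _ _ _ a a1 a2') one_uni.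
have [phi1' [a1' s3 c2]] : exists phi1', [/\ is_angle phi1',
    leads_to (pt r x1 x2' phi' phi1 phi2') (pt r x1 x2' phi' phi1' phi2') &
    val x1 = 0 -> cexp phi1' = 1].
  have [x0|x0] := eqVneq (val x1) 0; last first.
    by exists phi1; split => // e; move: x0; rewrite e eqxx.
  exists 0; split; [exact: angle0| |by rewrite cexp0].
  have -> : x1 = half0 by exact: val_inj.
  exact: bc_leads_to (BcX1 _ _ _ a' a1 a2') one_uni.
exists x2', phi', phi1', phi2'; split => //.
  by split => //; rewrite ptE => e; move: x1h; rewrite e eqxx.
exact: leads_to_trans s1 (leads_to_trans s2 s3).
Qed.

(** The two terms have moduli at most [(1 - r ^+ 2) / 2] and [r ^+ 2 / 2]. The bound makes the
    equation defining [t] solvable. *)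
Lemma zval_bound r x2 phi phi1 phi2 : cabs (@zval R r x2 phi phi1 phi2) <= 2^-1.
Proof.
have /andP[r0 r1] := Iunit_bounds r; have /andP[x0 x1] := Ihalf_bounds x2.
have c1 (y : R) : cabs (cexp y) = 1 by apply: cabs_circle; exact: cexp_conj_mul.
rewrite /zval; apply: le_trans (cabsD _ _) _; rewrite cabsN !cabsM !c1 mul1r mulr1 !cabs_real.
have s0 : 0 <= 1 - val r ^+ 2 by rewrite subr_ge0 expr_le1.
have -> : cabs (2^-1 : C) = 2^-1.
  by rewrite -[2^-1 : C]/((2 : C)^-1) -(rmorph_nat (real_complex R)) -fmorphV cabs_real ger0_norm // invr_ge0.
have sq : Num.sqrt (val x2 * (1 - val x2)) <= 2^-1.
  rewrite -[2^-1]ger0_norm ?invr_ge0 // -sqrtr_sqr ler_wsqrtr // expr2.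
  by move: (sqr_ge0 (val x2 - 2^-1)); rewrite expr2; nra.
rewrite !ger0_norm ?mulr_ge0 ?sqrtr_ge0 ?sqr_ge0 //.
have := ler_wpM2l s0 sq; have := sqr_ge0 (val r).
move: (val r ^+ 2) => y y0 h; apply: le_trans (lerD h (lexx _)) _.
by apply: le_of_eq; ring.
Qed.

Lemma reduce_half r x2 phi phi1 phi2 :
  is_angle phi -> is_angle phi1 -> is_angle phi2 ->
  exists t psi, [/\ is_angle psi, canonical (pt unit0 half1 t 0 phi1 psi) &
    leads_to (pt r half1 x2 phi phi1 phi2) (pt unit0 half1 t 0 phi1 psi)].
Proof.
move=> a a1 a2; set z := zval r x2 phi phi1 phi2.
have [|t ht] := @radius_exists R (cabs z); first by rewrite cabs_ge0 zval_bound.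
have [psi apsi hpsi] := polar_exists z.
have uU : U r x2 phi phi1 phi2 \is unitarymx by case: (hU r x2 a a1 a2).
have s1 : leads_to (pt r half1 x2 phi phi1 phi2) (pt unit0 half1 t 0 phi1 psi).
  by apply: bc_leads_to uU; apply: BcU.
have half_neq0 : (2^-1 : R) <> 0 by apply/eqP; rewrite invr_eq0.
have [t0|t0] := eqVneq (val t) 0; last first.
  exists t, psi; split => //; split; rewrite ?ptE ?cexp0 // => e.
    by move: t0; rewrite e eqxx.
  by move/eqP: e; rewrite eq_sym oner_eq0.
(* For [t = 0] the phase is not yet normalised; [BcX2] replaces [psi] by 0. *)
exists t, 0; split; first exact: angle0.
  split; rewrite ?ptE ?cexp0 // => e.
apply: leads_to_trans s1 _.
have -> : t = half0 by exact: val_inj.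
exact: bc_leads_to (BcX2 _ _ _ (angle0 R) a1 apsi) one_uni.
Qed.

Lemma canonical_exists p : exists r x1 x2 phi phi1 phi2, [/\ is_angle phi, is_angle phi1,
  is_angle phi2, canonical (pt r x1 x2 phi phi1 phi2) & leads_to p (pt r x1 x2 phi phi1 phi2)].
Proof.
have [phi [phi1 [phi2 [a a1 a2 ->]]]] := pt_surj p.
move: p.1.1.1.1.1 p.1.1.1.1.2 p.1.1.1.2 => r x1 x2.
have [h|h] := eqVneq (val x1) 2^-1.
  have -> : x1 = half1 by exact: val_inj.
  have [t [psi [apsi cq s]]] := reduce_half r x2 a a1 a2.
  by exists unit0, half1, t, 0, phi1, psi; split => //; exact: angle0.
have [x2' [phi' [phi1' [phi2' [b b1 b2 cq s]]]]] := reduce_generic r x2 h a a1 a2.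
by exists r, x1, x2', phi', phi1', phi2'.
Qed.

Lemma same_values_zero p q (f : balg L) : same_values p q -> fn f p = 0 -> fn f q = 0.
Proof.
move=> pq fp.
have [r [x1 [x2 [phi [phi1 [phi2 [_ _ _ cp [[a b c] hp]]]]]]]] := canonical_exists p.
have [r' [x1' [x2' [phi' [phi1' [phi2' [_ _ _ cq [[a' b' c'] hq]]]]]]]] := canonical_exists q.
case: pq => ea eb ec; apply/hq; rewrite -(canonical_uniq cp cq) ?hp //.
by split; rewrite -?a -?b -?c ?ea ?eb ?ec.
Qed.

End Canonical.

(** * Values of sections at canonical points *)

Section CanonicalImage.
Variable R : realType.
Local Notation C := (Cplx R).
Variable U : Iunit R -> Ihalf R -> R -> R -> R -> 'M[C]_4.
Hypothesis hU : is_intertwiner U.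
Local Notation L := (bc_rel U).
Local Notation fn := (@sval _ _).
Local Notation img := (img (gen1_equivariant hU) (gen2_equivariant hU)).

Lemma section_comm (f : balg L) p J : L p J p -> J^t* = J /\ J *m J = 1%:M ->
  J *m fn f p = fn f p *m J.
Proof.
move=> h /[dup] /symmetry_unitary uJ [s1 s2]; apply/(symmetry_fixed _ s1 s2).
by have [_ ef] := svalP f; exact: ef.
Qed.

(** The case distinction follows the symmetries attached to the canonical point itself: in each case
    their commutant is contained in the algebra that the generators produce there. *)
Lemma section_canonical_img (f : balg L) r x1 x2 phi phi1 phi2 :
  is_angle phi -> is_angle phi1 -> is_angle phi2 ->
  canonical (pt r x1 x2 phi phi1 phi2) ->
  img (pt r x1 x2 phi phi1 phi2) (fn f (pt r x1 x2 phi phi1 phi2)).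
Proof.
move=> a a1 a2 cq; set q := pt _ _ _ _ _ _.
have lt_half (x : Ihalf R) : val x != 2^-1 -> val x < 2^-1.
  by move=> h; case/andP: (Ihalf_bounds x) => _ x1h; rewrite lt_def eq_sym h.
have [h1|/lt_half h1] := eqVneq (val x1) 2^-1.
  have e1 : x1 = half1 by exact: val_inj.
  have r0 : r = unit0 by apply: val_inj; case: cq => + _ _ _ _; rewrite !ptE; exact.
  have hJ : kron (symm phi1) (sigz R) *m fn f q = fn f q *m kron (symm phi1) (sigz R).
    by apply: (section_comm f _ (sym_sz phi1)); rewrite /q e1 r0; exact: BcNu1.
  have cr0 : cr q = 0 by rewrite /q r0 ptE.
  have [h2|/lt_half h2] := eqVneq (val x2) 2^-1; last first.
    exact: (@img_boundary1 _ _ _ _ q phi1 _ cr0 h1 erefl h2 hJ).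
  have e2 : x2 = half1 by exact: val_inj.
  apply: (@img_boundary12 _ _ _ _ q phi1 phi2 _ cr0 h1 erefl h2 erefl hJ).
  by apply: (section_comm f _ (sym_1s phi2)); rewrite /q e2; exact: BcNu2.
have [r1|r1] := eqVneq (val r) 1.
  have e1 : r = unit1 by exact: val_inj.
  have x20 : x2 = half0 by apply: val_inj; case: cq => _ _ _ _; rewrite !ptE; exact.
  have e : q = pt unit1 x1 half0 phi phi1 0.
    have : cw2 q = 1 by case: cq => _ _ _ + _; apply; rewrite ptE x20.
    rewrite /q e1 x20 ptE => w2; rewrite /pt; congr pair; apply: val_inj => /=.
    by rewrite w2 cexp0.
  have [X ->] : in_M2_tens1 (fn f q).
    rewrite e; apply/in_M2_tens1P; split.
      by apply: (section_comm f _ (sym_1z R)); exact: BcR1z.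
    by apply: (section_comm f _ (sym_1x R)); exact: BcR1x.
  exact: img_left.
have r_lt1 : cr q < 1 by case/andP: (Iunit_bounds r) => _ rl; rewrite lt_def eq_sym r1.
have [h2|/lt_half h2] := eqVneq (val x2) 2^-1; last exact: img_generic.
have e2 : x2 = half1 by exact: val_inj.
have hJ : kron 1%:M (symm phi2) *m fn f q = fn f q *m kron 1%:M (symm phi2).
  by apply: (section_comm f _ (sym_1s phi2)); rewrite /q e2; exact: BcNu2.
exact: (@img_boundary2 _ _ _ _ q phi2 _ h1 r_lt1 h2 erefl hJ).
Qed.
End CanonicalImage.

(** * Density *)

Section Bernoulli.
Variable R : realType.

Lemma bernoulli_le (x : R) n : 0 <= x <= 1 -> 1 - n%:R * x <= (1 - x) ^+ n.
Proof.
move=> /andP[x0 x1]; elim: n => [|n ih]; first by rewrite mul0r subr0 expr0.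
have y0 : 0 <= 1 - x by rewrite subr_ge0.
rewrite exprS; apply: le_trans (ler_wpM2l y0 ih); rewrite -natr1.
have : 0 <= n%:R * x * x by rewrite !mulr_ge0.
by move: (n%:R : R) => m; lra.
Qed.

Lemma bernoulli_ge (x : R) n : 0 <= x <= 1 -> (1 - x) ^+ n * (1 + n%:R * x) <= 1.
Proof.
move=> /andP[x0 x1]; elim: n => [|n ih]; first by rewrite mul0r addr0 mul1r.
apply: le_trans ih; rewrite exprSr -mulrA ler_wpM2l ?exprn_ge0 ?subr_ge0 // -natr1.
have : 0 <= n%:R * x * x by rewrite !mulr_ge0.
have : 0 <= x * x by rewrite mulr_ge0.
by move: (n%:R : R) => m; lra.
Qed.

(** Polynomials approaching a step function. With the exponent [2 ^ n], Bernoulli's inequalities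
    involve [(2 * x) ^+ n], which is small for [x <= 1/3] and large for [x >= 2/3]. The rate 3/4
    serves both sides: it exceeds 2/3 and is the inverse of 4/3. *)
Definition step n (x : R) := (1 - x ^+ n) ^+ (2 ^ n).

Lemma step01 n (x : R) : 0 <= x <= 1 -> 0 <= step n x <= 1.
Proof.
move=> /andP[x0 x1]; have h0 : 0 <= x ^+ n by rewrite exprn_ge0.
have h1 : x ^+ n <= 1 by rewrite exprn_ile1.
by rewrite exprn_ge0 ?subr_ge0 //= exprn_ile1 ?subr_ge0 // gerBl.
Qed.

Lemma step_low n (x : R) : 0 <= x <= 3^-1 -> 1 - step n x <= (3 / 4) ^+ n.
Proof.
move=> /andP[x0 x1]; have h0 : 0 <= x ^+ n by rewrite exprn_ge0.
have h1 : x ^+ n <= 1 by rewrite exprn_ile1 //; move: x1; lra.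
have hx : 0 <= x ^+ n <= 1 by rewrite h0.
have := bernoulli_le (2 ^ n) hx; rewrite -/(step n x) natrX -exprMn => h.
have : (2 * x) ^+ n <= (3 / 4) ^+ n.
  by apply: lerXn2r; rewrite ?nnegrE; move: x0 x1; lra.
by move: h; lra.
Qed.

Lemma step_high n (x : R) : 2 / 3 <= x <= 1 -> step n x <= (3 / 4) ^+ n.
Proof.
move=> /andP[x1 x2]; have x0 : 0 <= x by move: x1; lra.
have h0 : 0 <= x ^+ n by rewrite exprn_ge0.
have hx : 0 <= x ^+ n <= 1 by rewrite h0 exprn_ile1.
have := bernoulli_ge (2 ^ n) hx; rewrite -/(step n x) natrX -exprMn => h.
have : (4 / 3) ^+ n <= (2 * x) ^+ n.
  by apply: lerXn2r; rewrite ?nnegrE; move: x0 x1; lra.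
have s0 : 0 <= step n x by rewrite exprn_ge0 // subr_ge0; case/andP: hx.
have g0 : 0 < (4 / 3 : R) ^+ n by rewrite exprn_gt0 // divr_gt0.
have -> : (3 / 4 : R) ^+ n = ((4 / 3) ^+ n)^-1 by rewrite -exprVn invf_div.
move: g0 h; move: (_ ^+ n) ((2 * x) ^+ n) => g y g0 h gy.
rewrite -[leRHS]mul1r ler_pdivlMr //; apply: le_trans h.
by rewrite ler_wpM2l //; move: gy; lra.
Qed.

Lemma geo_small (M d : R) : 0 <= M -> 0 < d -> exists n, (3 / 4) ^+ n * M <= d.
Proof.
move=> M0 d0; have M1 : 0 < M + 1 by rewrite ltr_wpDl.
have : (fun n => (3 / 4 : R) ^+ n) @ \oo --> (0 : R).
  by apply: cvg_expr; rewrite ger0_norm ?divr_ge0 // ltr_pdivrMr // mul1r ltr_nat.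
move=> /cvgrPdist_lt/(_ _ (divr_gt0 d0 M1))[n _ /(_ n (leqnn n))].
rewrite sub0r normrN ger0_norm ?exprn_ge0 ?divr_ge0 // ltr_pdivlMr // => h.
exists n; apply: le_trans (ltW h); rewrite ler_wpM2l ?exprn_ge0 ?divr_ge0 //.
by rewrite lerDl.
Qed.

End Bernoulli.

(** * Machado's theorem *)

Section Machado.
Variable R : realType.
Local Notation C := (Cplx R).
Local Notation Mat := 'M[C]_4.
Implicit Types (u v y f : dom R -> Mat) (a : dom R -> R) (F : set (dom R)).
Variable S : (dom R -> Mat) -> Prop.
Hypotheses (Sc : forall u, S u -> continuous u).
Hypotheses (S1 : S (fun=> 1%:M)) (SZ : forall (c : C) u, S u -> S (fun p => c *: u p)).
Hypotheses (SD : forall u v, S u -> S v -> S (fun p => u p + v p)).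
Hypotheses (SM : forall u v, S u -> S v -> S (fun p => u p *m v p)).

(** The admissible weights: convex combinations of members of [S] with such coefficients stay in
    [S]. *)
Definition central a := continuous a /\ S (fun p => ((a p)%:C : C)%:M).

Lemma central_affine a (c d : R) : central a -> central (fun p => c * a p + d).
Proof.
move=> [ca Sa]; split.
  by move=> x; apply: cvgD; [apply: cvgM; [exact: cvg_cst|exact: ca]|exact: cvg_cst].
have := SD (SZ c%:C Sa) (SZ d%:C S1); congr (S _); apply: funext => p.
by rewrite !scale_scalar_mx mulr1 -raddfD realcD realcM.
Qed.

Lemma central_exp a n : central a -> central (fun p => a p ^+ n).
Proof.
move=> [ca Sa]; elim: n => [|n [cn Sn]].
  split; first by move=> x; exact: cvg_cst.
  by have := S1; congr (S _); apply: funext => p; rewrite expr0.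
split; first by under eq_fun do rewrite exprS; move=> x; exact: (cvgM (ca x) (cn x)).
have := SM Sa Sn; congr (S _); apply: funext => p.
by rewrite -scalar_mxM -realcM exprS.
Qed.

Lemma central_step a n : central a -> central (fun p => step n (a p)).
Proof.
move=> ha; have := central_exp (2 ^ n) (central_affine (-1) 1 (central_exp n ha)).
by congr central; apply: funext => p; rewrite /step mulN1r addrC.
Qed.

Lemma S_mix a u v : central a -> S u -> S v ->
  S (fun p => (a p)%:C *: u p + (1 - a p)%:C *: v p).
Proof.
move=> ha Su Sv; have [_ Sa] := ha; have [_ Sb] := central_affine (-1) 1 ha.
have := SD (SM Sa Su) (SM Sb Sv); congr (S _); apply: funext => p.
by rewrite !mul_scalar_mx mulN1r [- _ + 1]addrC.
Qed.

Section Good.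
Variables (f : dom R -> Mat) (e : R).
Hypotheses (cf : continuous f) (e0 : 0 < e).

(** The slack between [e'] and [e] absorbs the mixing error in [good_split] and makes the
    compactness argument of [good_union] possible. *)
Definition good F := exists y e', [/\ S y, e' < e &
  forall p, F p -> opnorm (f p - y p) <= e'].

Lemma S_sub_bounded y : S y -> exists2 M, 0 <= M & forall p, opnorm (f p - y p) <= M.
Proof.
move=> Sy; have c : continuous (fun p => f p - y p).
  by move=> p; apply: cvgB; [exact: cf|exact: Sc].
exists (supnorm (fun p => f p - y p)) => [|p]; last exact: (supnorm_ub p c).
exact: le_trans (opnorm_ge0 _) (supnorm_ub (point_dom R) c).
Qed.

Lemma mix_error (q : R) (w u v : Mat) (a b : R) : 0 <= q <= 1 ->
  opnorm (w - u) <= a -> opnorm (w - v) <= b ->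
  opnorm (w - (q%:C *: u + (1 - q)%:C *: v)) <= q * a + (1 - q) * b.
Proof.
move=> /andP[q0 q1] ha hb.
have -> : w - (q%:C *: u + (1 - q)%:C *: v) = q%:C *: (w - u) + (1 - q)%:C *: (w - v).
  rewrite !scalerBr addrACA -scalerDl -realcD addrC subrKC scale1r.
  by rewrite -opprD addrC.
apply: le_trans (opnormD _ _) _; rewrite !opnormZ !cabs_real !ger0_norm ?subr_ge0 //.
by rewrite lerD // ler_wpM2l ?subr_ge0.
Qed.

(** [u] and [v] are mixed with weight [step n (a p)], which is close to 1 where only [u] is known to
    be accurate and close to 0 where only [v] is. On the middle third both are accurate, so any
    convex combination is. *)
Lemma good_split F a : central a -> (forall p, F p -> 0 <= a p <= 1) ->
  good [set p | F p /\ a p <= 2 / 3] -> good [set p | F p /\ 3^-1 <= a p] -> good F.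
Proof.
move=> ha a01 [u [e1 [Su le1 hu]]] [v [e2 [Sv le2 hv]]].
have [M1 M10 hM1] := S_sub_bounded Su; have [M2 M20 hM2] := S_sub_bounded Sv.
pose m := Num.max 0 (Num.max e1 e2); have me : m < e by rewrite !gt_max e0 le1.
have m0 : 0 <= m by rewrite le_max lexx.
have {}hu p : F p -> a p <= 2 / 3 -> opnorm (f p - u p) <= m.
  by move=> Fp ap; apply: le_trans (hu p (conj Fp ap)) _; rewrite !le_max lexx orbT.
have {}hv p : F p -> 3^-1 <= a p -> opnorm (f p - v p) <= m.
  by move=> Fp ap; apply: le_trans (hv p (conj Fp ap)) _; rewrite !le_max lexx !orbT.
have d0 : 0 < (e - m) / 2 by rewrite divr_gt0 // subr_gt0.
have M0 : 0 <= M1 + M2 by rewrite addr_ge0.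
have [n hn] := geo_small M0 d0.
exists (fun p => (step n (a p))%:C *: u p + (1 - step n (a p))%:C *: v p), (m + (e - m) / 2).
split; [exact: S_mix (central_step n ha) Su Sv|by move: me; lra|move=> p Fp].
have /andP[ap0 ap1] := a01 p Fp; have := step01 n (a01 p Fp).
move sE : (step n (a p)) => q q01; have /andP[q0 q1] := q01.
have g0 : 0 <= (3 / 4 : R) ^+ n by rewrite exprn_ge0 // divr_ge0.
have [lo|lo] := leP (a p) 3^-1.
  have hq : 1 - q <= (3 / 4) ^+ n by rewrite -sE step_low // ap0.
  have ap' : a p <= 2 / 3 by move: lo; lra.
  apply: le_trans (mix_error q01 (hu p Fp ap') (hM2 p)) _; apply: lerD.
    by rewrite ler_piMl.
  apply: le_trans hn; apply: ler_pM; rewrite ?subr_ge0 //.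
  by rewrite lerDr.
have [hi|hi] := leP (2 / 3) (a p).
  have hq : q <= (3 / 4) ^+ n by rewrite -sE step_high // hi.
  apply: le_trans (mix_error q01 (hM1 p) (hv p Fp (ltW lo))) _; rewrite addrC; apply: lerD.
    by rewrite ler_piMl // gerBl.
  apply: le_trans hn; apply: ler_pM => //.
  by rewrite lerDl.
apply: le_trans (mix_error q01 (hu p Fp (ltW hi)) (hv p Fp (ltW lo))) _.
by rewrite -mulrDl subrKC mul1r; move: d0; lra.
Qed.

(** Stated for open complements, since Zorn's lemma is used with unions. The set [K] on which the
    error reaches the midpoint of [e'] and [e] is compact and covered by the chain, hence contained
    in one member. *)
Lemma good_union (O : set (set (dom R))) : O !=set0 -> total_on O subset ->
  (forall X, O X -> open X) -> good (~` \bigcup_(X in O) X) ->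
  exists2 X, O X & good (~` X).
Proof.
move=> [X0 OX0] tO oO [y [e' [Sy le hy]]].
pose K := [set p | (e' + e) / 2 <= opnorm (f p - y p)].
have clK : closed K.
  have cn : continuous (fun p => opnorm (f p - y p)).
    by apply: continuous_opnorm => x; apply: cvgB; [exact: cf|exact: Sc].
  by apply: preimage_closed (@closed_ge R ((e' + e) / 2)) => p _; exact: cn.
have cK : compact K by exact: (subclosed_compact clK (@compact_dom R) (subsetT _)).
have KO p : K p -> exists2 X, O X & X p.
  move=> Kp; apply: contrapT => h.
  have := hy p h; move: Kp; rewrite /K /=; lra.
have [X OX KX] : exists2 X, O X & K `<=` X.
  apply: contrapT => h.
  (* If no member contained [K], the remainders of [K] would generate a proper filter, and its
     cluster point in [K] would avoid every member of the cover. *)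
  have FF : ProperFilter (filter_from O (fun X => K `&` ~` X)).
    apply: filter_from_proper => [|X OX]; last first.
      apply: contrapT => h'; apply: h; exists X => // p Kp; apply: contrapT => nXp.
      by apply: h'; exists p.
    apply: filter_from_filter; first by exists X0.
    move=> X Y OX OY; have [XY|YX] := tO X Y OX OY; [exists Y => //|exists X => //].
      by move=> p [Kp nYp]; split; split => // /XY.
    by move=> p [Kp nXp]; split; split => // /YX.
  have [|p [Kp clp]] := cK _ FF; first by exists X0 => // p [].
  have [X OX Xp] := KO p Kp.
  have [||q [[_ nXq] Xq]] := clp (K `&` ~` X) X; [by exists X| |by []].
  by apply: open_nbhs_nbhs; split => //; exact: oO.
exists X => //; exists y, ((e' + e) / 2); split => //; first by move: le; lra.
move=> p nXp; rewrite leNgt; apply/negP => h; apply: nXp.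
exact: KX (ltW h).
Qed.

Lemma central_sub_closed a c : central a -> closed [set p | a p <= c] /\ closed [set p | c <= a p].
Proof.
move=> [ca _]; split.
  by apply: preimage_closed (@closed_le R c) => p _; exact: ca.
by apply: preimage_closed (@closed_ge R c) => p _; exact: ca.
Qed.

Lemma bad_minimal : ~ good setT -> exists F, [/\ closed F, ~ good F &
  forall F', closed F' -> F' `<=` F -> ~ good F' -> F `<=` F'].
Proof.
move=> bad; pose P := [set O : set (dom R) | open O /\ ~ good (~` O)].
have [|O [[oO bO] hO]] := @Zorn_bigcup _ P.
  move=> O OP tO.
  have [[X OX]|O0] := pselect (O !=set0); last first.
    rewrite (_ : \bigcup_(X in O) X = set0); last first.
      by rewrite -subset0 => p [X OX]; case: O0; exists X.
    by split; [exact: open0|rewrite setC0].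
  have oX Y : O Y -> open Y by move=> /OP[].
  split; first exact: bigcup_open.
  move=> g; have [Y OY gY] := good_union (ex_intro _ X OX) tO oX g.
  by case: (OP Y OY).
exists (~` O); split => //; first exact: open_closedC.
move=> F' cF' sF' bF' p Op; apply: contrapT => nF'p.
apply: (hO (~` F')); last by split; [exact: closed_openC|rewrite setCK].
split; first by move=> q Oq F'q; exact: sF' F'q Oq.
by move=> /(_ p nF'p).
Qed.

(** If [a] took two values on [F], its range could be rescaled to the unit interval. Both
    overlapping pieces of [good_split] would be proper closed subsets of [F], hence good by
    minimality, and so would [F] be. *)
Lemma bad_const F a : closed F -> ~ good F ->
  (forall F', closed F' -> F' `<=` F -> ~ good F' -> F `<=` F') ->
  central a -> forall p q, F p -> F q -> a p = a q.
Proof.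
move=> cF bF mF ha.
have ba : exists M : R, forall p, `|a p| <= M.
  have [ca Sa] := ha; exists (supnorm (fun p => ((a p)%:C : C)%:M)) => p.
  apply: le_trans (supnorm_ub p (Sc Sa)); apply: le_trans (opnorm_entry _ 0 0).
  by rewrite mxE eqxx mulr1n cabs_real.
have [M hM] := ba.
suff h p q : F p -> F q -> ~ a p < a q.
  move=> p q Fp Fq; apply/eqP; rewrite eq_le; apply/andP; split.
    by rewrite leNgt; apply/negP; exact: h.
  by rewrite leNgt; apply/negP; exact: h.
move=> Fp Fq pq.
pose A := a @` F; have A0 : A !=set0 by exists (a p), p.
have uA : has_ubound A by exists M => _ [x _ <-]; exact: le_trans (ler_norm _) (hM x).
have lA : has_lbound A.
  by exists (- M) => _ [x _ <-]; rewrite lerNl; apply: le_trans (hM x); rewrite -normrN ler_norm.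
pose s := inf A; pose t := sup A.
have sp x : F x -> s <= a x by move=> Fx; apply: ge_inf => //; exists x.
have qt x : F x -> a x <= t by move=> Fx; apply: ub_le_sup => //; exists x.
have st : 0 < t - s by rewrite subr_gt0; apply: le_lt_trans (sp p Fp) (lt_le_trans pq (qt q Fq)).
have st3 : 0 < (t - s) / 3 by rewrite divr_gt0.
(* [x] and [y] are taken in the outer thirds of the range, so that each piece of the split misses
   one of them. *)
have [_ [x Fx <-] ax] := inf_adherent st3 (conj A0 lA); rewrite -/s in ax.
have [_ [y Fy <-] ay] := sup_adherent st3 (conj A0 uA); rewrite -/t in ay.
pose b := fun z => (t - s)^-1 * a z + - (s / (t - s)).
have hb : central b by exact: central_affine.
have bE z : b z = (a z - s) / (t - s) by rewrite /b mulrBl [_^-1 * _]mulrC.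
apply: (bF); apply: (good_split hb).
- move=> z Fz; rewrite bE divr_ge0 ?subr_ge0 ?sp ?(ltW st) //=.
    by rewrite ler_pdivrMr // mul1r lerD2r qt.
  by rewrite -subr_ge0 ltW.
- apply: contrapT => bad; have [c _] := central_sub_closed (2 / 3) hb.
  have := mF _ (closedI cF c) _ bad y Fy; case=> [|_].
    by move=> z [].
  by rewrite /= bE ler_pdivrMr //; move: ay; lra.
apply: contrapT => bad; have [_ c] := central_sub_closed 3^-1 hb.
have := mF _ (closedI cF c) _ bad x Fx; case=> [|_].
  by move=> z [].
by rewrite /= bE ler_pdivlMr //; move: ax; lra.
Qed.

(* A minimal closed set on which [f] cannot be approximated would be contained in a fibre of
   the central functions (Machado's theorem, with Ransford's proof). *)
Lemma machado : (forall p, exists2 y, S y &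
    forall q, (forall a, central a -> a p = a q) -> y q = f q) ->
  exists2 y, S y & forall p, opnorm (f p - y p) < e.
Proof.
move=> fib; have [[y [e' [Sy le hy]]]|bad] := pselect (good setT).
  by exists y => // p; exact: le_lt_trans (hy p I) le.
have [F [cF bF mF]] := bad_minimal bad.
have bc := bad_const cF bF mF; exfalso; apply: bF.
have [[p Fp]|F0] := pselect (F !=set0).
  have [y Sy hy] := fib p; exists y, 0; split => // q Fq.
  by rewrite hy ?subrr ?opnorm0 // => a ha; exact: bc.
by exists (fun=> 1%:M), 0; split => // q Fq; case: F0; exists q.
Qed.

End Good.
End Machado.

(** * Density of the generated algebra *)

Section Density.
Variable R : realType.
Local Notation C := (Cplx R).
Variable U : Iunit R -> Ihalf R -> R -> R -> R -> 'M[C]_4.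
Hypothesis hU : is_intertwiner U.
Local Notation L := (bc_rel U).
Local Notation fn := (@sval _ _).
Local Notation g1 := (gsec1 (gen1_equivariant hU)).
Local Notation g2 := (gsec2 (gen2_equivariant hU)).
Local Notation B := (balg_cstar L).

Definition polysec (u : dom R -> 'M[C]_4) := exists2 y : B, genalg g1 g2 y & fn y = u.

Lemma re_continuous (T : topologicalType) (c : T -> C) :
  continuous c -> continuous (fun p => complex.Re (c p)).
Proof.
move=> cc x; apply/cvgrPdist_lt => e e0; have /cvg_cabsP h := cc x.
near=> y; have hy : cabs (c x - c y) < e by near: y; exact: h.
by apply: le_lt_trans hy; rewrite -raddfB; exact: ler_Re_cabs.
Unshelve. all: by end_near.
Qed.

Lemma reC (z : C) : (complex.Re z)%:C = 2^-1 * (z + z^*).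
Proof.
case: z => a b; rewrite -[X in X * _]/((2 : C)^-1).
have -> : (2 : C)^-1 = (2^-1 : R)%:C by rewrite -(rmorph_nat (real_complex R)) -fmorphV.
by apply/eqP; rewrite eq_complex /=; apply/andP; split; apply/eqP; field.
Qed.

Lemma central_re (y : B) (c : dom R -> C) : genalg g1 g2 y ->
  (forall p, fn y p = (c p)%:M) -> central polysec (fun p => complex.Re (c p)).
Proof.
move=> gy yc; split.
  apply: re_continuous => p; have [cy _] := svalP y.
  have cE q : fn y q 0 0 = c q by rewrite yc mxE eqxx mulr1n.
  rewrite (_ : c = fun q => fn y q 0 0); last by apply: funext => q; rewrite cE.
  exact: (@cvg_entry _ _ _ _ _ _ 0 0 (cy p)).
exists ((2^-1 : C) *: (y + star y)).
  by apply: GenZ; apply: GenD => //; exact: Gen_star.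
apply: funext => p; rewrite balgZE balgDE /= yc.
rewrite tr_scalar_mx map_scalar_mx -raddfD /= scale_scalar_mx.
by rewrite -reC.
Qed.

Lemma central_im (y : B) (c : dom R -> C) : genalg g1 g2 y ->
  (forall p, fn y p = (c p)%:M) -> central polysec (fun p => complex.Im (c p)).
Proof.
move=> gy yc; have gi : genalg g1 g2 ((Complex 0 (-1) : C) *: y) by exact: GenZ.
have h p : fn ((Complex 0 (-1) : C) *: y) p = (Complex 0 (-1) * c p : C)%:M.
  by rewrite balgZE yc scale_scalar_mx.
have := central_re gi h; congr central; apply: funext => p.
by case: (c p) => a b /=; rewrite mul0r mulN1r sub0r opprK.
Qed.

Lemma central_same_values p q : (forall a, central polysec a -> a p = a q) -> same_values p q.
Proof.
move=> h.
have eqv (y : B) (c : dom R -> C) : genalg g1 g2 y -> (forall p, fn y p = (c p)%:M) -> c p = c q.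
  move=> gy yc; have := h _ (central_re gy yc); have := h _ (central_im gy yc).
  by case: (c p) (c q) => a b [a' b'] /= -> ->.
split.
- apply: (eqv (g1 * g1)); first by apply: GenM; exact: Gen1.
  by move=> s; exact: gen1_sqr.
- apply: (eqv (g2 * g2)); first by apply: GenM; exact: Gen2.
  by move=> s; exact: gen2_sqr.
apply: (eqv (g1 * g2 + g2 * g1)).
  by apply: GenD; apply: GenM; do [exact: Gen1|exact: Gen2].
by move=> s; exact: gen12_anti.
Qed.

Theorem generators_dense (f : B) (e : R) : 0 < e ->
  exists2 y : B, genalg g1 g2 y & cnorm (f - y) <= e.
Proof.
move=> e0.
have Sc u : polysec u -> continuous u by move=> [y _ <-]; case: (svalP y).
have S1 : polysec (fun=> 1%:M) by exists 1 => //; exact: Gen_1.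
have SZ (c : C) u : polysec u -> polysec (fun p => c *: u p).
  by move=> [y gy <-]; exists (c *: y) => //; exact: GenZ.
have SD u v : polysec u -> polysec v -> polysec (fun p => u p + v p).
  by move=> [y gy <-] [z gz <-]; exists (y + z) => //; exact: GenD.
have SM u v : polysec u -> polysec v -> polysec (fun p => u p *m v p).
  by move=> [y gy <-] [z gz <-]; exists (y * z) => //; exact: GenM.
(* A generated [y] agrees with [f] at the canonical point of the fibre; the difference [y - f] is a
   section that vanishes there, hence on the whole fibre. *)
have fib p : exists2 y, polysec y &
    forall q, (forall a, central polysec a -> a p = a q) -> y q = fn f q.
  have [r [x1 [x2 [phi [phi1 [phi2 [a a1 a2 cq [pq hpq]]]]]]]] := canonical_exists hU p.
  have [y gy yq] := section_canonical_img hU f a a1 a2 cq.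
  exists (fn y); first by exists y.
  move=> q /central_same_values pq'; apply/eqP; rewrite -subr_eq0; apply/eqP.
  have h : fn (y - f) q = 0.
    apply: (same_values_zero hU pq'); apply/hpq; rewrite balgBE yq; exact: subrr.
  by rewrite -h balgBE.
have [cf _] := svalP f.
have [_ [z gz <-] hy] := machado Sc S1 SZ SD SM cf e0 fib.
exists z => //; apply: supnorm_le => p; rewrite balgBE; exact: ltW.
Qed.

End Density.

(** * The norm inequality *)

Section Values.
Variable R : realType.
Local Notation C := (Cplx R).

Lemma realc0 : (0 : R)%:C = 0 :> C. Proof. by []. Qed.
Lemma realc1 : (1 : R)%:C = 1 :> C. Proof. by []. Qed.

Lemma realc_nat n : (n%:R : R)%:C = n%:R :> C.
Proof. exact: (rmorph_nat (real_complex R)). Qed.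

Lemma unit_root (v : C) : v != 0 -> exists2 m : C, m * m^* = 1 & m * m * v = - `|v|.
Proof.
move=> v0; have n0 : `|v| != 0 by rewrite normr_eq0.
exists (sqrtC (- (v^* / `|v|))).
  rewrite -normCK -normrX sqrtCK normrN normrM norm_conjC normfV normr_id.
  by rewrite mulfV.
rewrite -expr2 sqrtCK mulNr mulrAC [v^* * v]mulrC -normCK expr2 mulfK //.
Qed.

(** The form is tested at a unit [m] whose square turns [v] into [- |v|], where it is smallest on
    the unit circle. *)
Lemma quad_bound (a v : C) :
  (forall m : C, 0 <= m * m^* * a + (m * m * v + (m * m * v)^*)) -> 2 * `|v| <= a.
Proof.
move=> h; have [v0|v0] := eqVneq v 0.
  have := h 1; rewrite v0 normr0 !mulr0 conjC0 addr0 conjC1 mulr1 mul1r addr0.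
  exact.
have [m m1 mv] := unit_root v0; have := h m; rewrite mv m1 mul1r rmorphN /=.
rewrite conj_Creal ?normr_real // -opprD subr_ge0; congr (_ <= _).
by rewrite mulr_natl mulr2n.
Qed.

(* The value at a point of the square of the self-adjoint element
   [(l a1 + m a2) + star (l a1 + m a2)], see [energy_square]. *)
Definition energy (al be ga l m : C) : C :=
  l * l^* + m * m^* + (l * l * al + l * m * ga + m * m * be +
    (l * l * al + l * m * ga + m * m * be)^*).

(** The value of [l] is the stationary point for fixed [m]: it solves
    [l + 2 * al^* * l^* + (m * ga)^* = 0], after elimination of [l^*]. What remains is a form in [m]
    to which [quad_bound] applies. *)
Lemma energy_minimum (al be ga m : C) (u : C) : u != 0 -> u^* = u -> u * u = 1 - 4 * (al * al^*) ->
  energy al be ga ((2 * al^* * (m * ga) - (m * ga)^*) / (u * u)) m =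
  m * m^* * (1 - ga * ga^* / (u * u)) +
   (m * m * (be + al^* * (ga / u * (ga / u))) + (m * m * (be + al^* * (ga / u * (ga / u))))^*).
Proof.
move=> u0 cu uu; rewrite /energy; do 2 rewrite !(rmorphM, rmorphD, rmorphN, fmorphV, conjC1, conjCK, cu) /=.
move: al^* be^* ga^* m^* uu => al' be' ga' m' uu.
have w0 : 1 - 4 * (al * al') != 0 by rewrite -uu mulf_neq0.
have -> : ga / u * (ga / u) = ga * ga / (u * u) by field.
have -> : ga' / u * (ga' / u) = ga' * ga' / (u * u) by field.
by rewrite uu; field.
Qed.

Lemma energy_line (al be ga l s m : C) : s^* = s -> l * l^* = 1 -> l * l * al = - 2^-1 ->
  energy al be ga (s * l) m = m * m^* + (m * m * be + (m * m * be)^*) +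
    s * (l * m * ga + (l * m * ga)^*).
Proof.
move=> cs ll la; rewrite /energy.
have -> : s * l * (s * l) * al = - (s * s / 2).
  by transitivity (s * s * (l * l * al)); [ring|rewrite la; field].
do 2 rewrite !(rmorphD, rmorphM, rmorphN, fmorphV, conjC1, cs) /=.
have -> : s * l * (s * l^*) = s * s by transitivity (s * s * (l * l^*)); [ring|rewrite ll mulr1].
by field.
Qed.

Section Bounds.
Variables al be ga : C.
Hypothesis h : forall l m, 0 <= energy al be ga l m.

Lemma energy_al : 2 * `|al| <= 1.
Proof.
apply: quad_bound => l; have := h l 0.
by rewrite /energy !(mulr0, mul0r, addr0, conjC0) mulr1.
Qed.

Lemma energy_be : 2 * `|be| <= 1.
Proof.
apply: quad_bound => m; have := h 0 m.
by rewrite /energy !(mulr0, mul0r, add0r, addr0, conjC0) mulr1.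
Qed.

Lemma energy_ga : 1 - 4 * (al * al^*) = 0 -> ga = 0.
Proof.
move=> d0; have nal : `|al| = 2^-1.
  have e : (2 * `|al|) ^+ 2 = 1 ^+ 2.
    rewrite exprMn normCK expr1n -natrX.
    by apply/eqP; rewrite eq_sym -subr_eq0 d0.
  have : 2 * `|al| = 1 by apply: (pexpIrn _ _ _ e) => //; rewrite nnegrE // mulr_ge0.
  by move=> e2; apply: (@mulfI _ 2); rewrite ?pnatr_eq0 // e2 mulfV // pnatr_eq0.
have al0 : al != 0 by rewrite -normr_eq0 nal invr_eq0 pnatr_eq0.
have [l ll la] := unit_root al0; rewrite nal in la.
apply: contrapT => /eqP ga0.
pose m := (l * ga)^*; have g : l * m * ga = `|ga| ^+ 2.
  by rewrite normCK /m rmorphM /= -[RHS]mul1r -ll; ring.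
have g0 : 0 < `|ga| ^+ 2 by rewrite exprn_gt0 // normr_gt0.
pose K := m * m^* + (m * m * be + (m * m * be)^*).
have cK : K^* = K by rewrite /K !rmorphD /= rmorphM /= !conjCK; congr (_ + _); [exact: mulrC|exact: addrC].
(* The affine function [K + s * (2 * |ga| ^+ 2)] takes the value -1 at this [s], against
   nonnegativity. *)
pose s := - (K + 1) / (`|ga| ^+ 2 + `|ga| ^+ 2).
have cs : s^* = s.
  rewrite /s fmorph_div !rmorphD /= rmorphN rmorphD /= cK conjC1 rmorphXn /=.
  by rewrite conj_Creal ?normr_real.
have := h (s * l) m; rewrite energy_line // -/K g.
rewrite rmorphXn /= conj_Creal ?normr_real // /s divfK; last first.
  by rewrite -mulr2n mulrn_eq0 /= gt_eqF.
by rewrite opprD addrA subrr sub0r oppr_ge0 ler10.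
Qed.

Lemma energy_disc (u : C) : u != 0 -> u^* = u -> u * u = 1 - 4 * (al * al^*) ->
  2 * `|be + al^* * (ga / u * (ga / u))| <= 1 - ga * ga^* / (u * u).
Proof.
move=> u0 cu uu; apply: quad_bound => m.
by rewrite -energy_minimum.
Qed.

End Bounds.

Lemma cabs_polar (z : C) : exists w : circle R, z = val w * (cabs z)%:C.
Proof.
have [psi _ e] := polar_exists z; exists (cis psi).
by rewrite cabsE mulrC.
Qed.

(* For [u = 0] the quotients below are [0], which is the value of [r1] required then. *)
Lemma values_point (al be ga : C) (u : R) : 0 <= u -> u ^+ 2 = 1 - 4 * cabs al ^+ 2 ->
  (u = 0 -> ga = 0) -> cabs ga <= u ->
  2 * cabs (be + al^* * (ga / u%:C * (ga / u%:C))) <= 1 - (cabs ga / u) ^+ 2 ->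
  exists p : dom R, [/\ alphav p = al, betav p = be & gammav p = ga].
Proof.
move=> u0 uu ga0 gu; set v := be + _ => hv.
have al2 : 0 <= cabs al <= 2^-1.
  by have := sqr_ge0 u; rewrite uu cabs_ge0 /= expr2; have := cabs_ge0 al; nra.
have [x1 hx1] := radius_exists al2; have [w1 hw1] := cabs_polar al.
have [w hw] := cabs_polar ga.
have r0 : 0 <= cabs ga / u by rewrite divr_ge0 ?cabs_ge0.
have r1 : cabs ga / u <= 1.
  have [->|un0] := eqVneq u 0; first by rewrite invr0 mulr0.
  by rewrite ler_pdivrMr ?mul1r // lt_def un0.
pose r : Iunit R := exist _ (cabs ga / u) (mem_Iunit r0 r1).
set d := 1 - (cabs ga / u) ^+ 2 in hv.
have d0 : 0 <= d by apply: le_trans hv; rewrite mulr_ge0 ?cabs_ge0.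
(* [z] is to be the polar value of [x2] and [w2]. When [d = 0], that is [r1 = 1], division gives
   [z = 0], and [hv] forces [v = 0] as well. *)
pose z := v / d%:C.
have dz : d%:C * z = v.
  have [e|dn0] := eqVneq d 0; last by rewrite mulrC divfK // realc_eq0.
  rewrite e mul0r; apply/esym/eqP; rewrite -cabs_eq0 eq_le cabs_ge0 andbT.
  by move: hv; rewrite e; lra.
have hz : 0 <= cabs z <= 2^-1.
  rewrite cabs_ge0 /=; have [e|dn0] := eqVneq d 0.
    by rewrite /z e invr0 mulr0 cabs0 invr_ge0.
  have dp : 0 < d by rewrite lt_def dn0.
  by move: hv; rewrite -dz cabsM cabs_real ger0_norm //; nra.
have [x2 hx2] := radius_exists hz; have [w2 hw2] := cabs_polar z.
have /andP[x10 x1h] := Ihalf_bounds x1; have /andP[x20 x2h] := Ihalf_bounds x2.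
have x1u : 1 - val x1 - val x1 = u.
  have x12 : val x1 * (1 - val x1) = cabs al ^+ 2.
    by rewrite -hx1 sqr_sqrtr // mulr_ge0 //; move: x1h; lra.
  apply/eqP; rewrite -(@eqrXn2 _ 2) //; last by move: x1h; lra.
  by rewrite uu -x12; apply/eqP; ring.
exists (r, x1, x2, w, w1, w2); rewrite /alphav /betav /gammav.
have q1 : rsqrt (val x1) * rsqrt (1 - val x1) = (cabs al)%:C by rewrite rsqrt_prod // hx1.
have q2 : rsqrt (val x2) * rsqrt (1 - val x2) = (cabs z)%:C by rewrite rsqrt_prod // hx2.
have t1 : (val r)%:C * val w = ga / u%:C.
  transitivity (val w * (cabs ga)%:C / u%:C); last by rewrite -hw.
  rewrite -mulrA -realcV -realcM mulrC; exact: erefl.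
have s2 : rsqrt (1 - val r ^+ 2) * rsqrt (1 - val r ^+ 2) = d%:C by rewrite rsqrt_sqr.
split.
- transitivity (val w1 * (rsqrt (val x1) * rsqrt (1 - val x1))); first exact: erefl.
  by rewrite q1 -hw1.
- transitivity (rsqrt (1 - val r ^+ 2) * rsqrt (1 - val r ^+ 2) *
      (val w2 * (rsqrt (val x2) * rsqrt (1 - val x2))) +
    (val r)%:C * val w * ((val r)%:C * val w) *
      (- ((val w1)^* * (rsqrt (val x1) * rsqrt (1 - val x1))))); first exact: erefl.
  rewrite s2 q1 q2 -hw2 dz t1.
  have -> : (val w1)^* * (cabs al)%:C = al^* by rewrite {2}hw1 rmorphM /= conj_realc.
  by rewrite /v; ring.
transitivity ((val r)%:C * val w * (1 - (val x1)%:C - (val x1)%:C)); first exact: erefl.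
rewrite t1; have -> : 1 - (val x1)%:C - (val x1)%:C = u%:C :> C by rewrite -x1u !realcB.
have [e|un0] := eqVneq u 0; last by rewrite divfK // realc_eq0.
by rewrite e realc0 mulr0 ga0.
Qed.

Theorem energy_values (al be ga : C) : (forall l m, 0 <= energy al be ga l m) ->
  exists p : dom R, [/\ alphav p = al, betav p = be & gammav p = ga].
Proof.
move=> h.
have half (z : C) : 2 * `|z| <= 1 -> 2 * cabs z <= 1.
  by move=> hz; rewrite -lecR realcM realc_nat cabsE realc1.
have ha := half _ (energy_al h); have hb := half _ (energy_be h).
have d0 : 0 <= 1 - 4 * cabs al ^+ 2 by have := cabs_ge0 al; rewrite expr2; nra.
pose u := Num.sqrt (1 - 4 * cabs al ^+ 2).
have u0 : 0 <= u by exact: sqrtr_ge0.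
have uu : u ^+ 2 = 1 - 4 * cabs al ^+ 2 by rewrite sqr_sqrtr.
have uuC : u%:C * u%:C = 1 - 4 * (al * al^*).
  rewrite -realcM -expr2 uu realcB realcM mulC_conj realc1.
  by rewrite realc_nat.
have [e|un0] := eqVneq u 0.
  have g0 : ga = 0 by apply: (energy_ga h); rewrite -uuC e realc0 mulr0.
  apply: (@values_point al be ga u) => //; first by rewrite g0 cabs0.
  rewrite g0 cabs0 !mul0r expr0n /= subr0 !mulr0 addr0; exact: hb.
have hd : 2 * cabs (be + al^* * (ga / u%:C * (ga / u%:C))) <= 1 - (cabs ga / u) ^+ 2.
  have := @energy_disc _ _ _ h u%:C _ (conj_realc u) uuC; rewrite realc_eq0 => /(_ un0).
  move=> hd; rewrite -lecR realcM realc_nat cabsE; congr (_ <= _): hd.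
  by rewrite mulC_conj -realcM -expr2 -realcV -realcM -realc1 -realcB exprMn exprVn.
apply: (@values_point al be ga u) => //; first by move=> e; rewrite e eqxx in un0.
have up : 0 < u by rewrite lt_def un0.
have : 0 <= 1 - (cabs ga / u) ^+ 2 by apply: le_trans hd; rewrite mulr_ge0 ?cabs_ge0.
by rewrite subr_ge0 expr_le1 ?divr_ge0 ?cabs_ge0 // ler_pdivrMr // mul1r.
Qed.
End Values.

(** * A path from any point into the generic region *)

Section Path.
Variable R : realType.
Local Notation C := (Cplx R).

(** Equal to 1 at 0 and strictly between 0 and 1 at every other real [s], so the parameter of the
    path ranges over the whole line. *)
Definition shrink (s : R) : R := (1 + s ^+ 2)^-1.

Lemma shrink_gt0 s : 0 < shrink s.
Proof. by rewrite invr_gt0 ltr_pwDl // sqr_ge0. Qed.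
Lemma shrink_le1 s : shrink s <= 1.
Proof. by rewrite invf_le1 ?ltr_pwDl ?sqr_ge0 // lerDl sqr_ge0. Qed.
Lemma shrink_lt1 s : s != 0 -> shrink s < 1.
Proof.
move=> s0; have h : 0 < s ^+ 2 by rewrite exprn_even_gt0.
by rewrite /shrink invf_lt1 ?ltrDl // addr_gt0.
Qed.
Lemma shrink0 : shrink 0 = 1.
Proof. by rewrite /shrink expr0n addr0 invr1. Qed.

Lemma shrink_continuous : continuous shrink.
Proof.
move=> s; apply: cvgV; first by rewrite gt_eqF // ltr_pwDl // sqr_ge0.
by apply: cvgD; [exact: cvg_cst|exact: exprn_continuous].
Qed.

Lemma shrink_Iunit s (r : Iunit R) : shrink s * val r \in Iunit R.
Proof.
have /andP[r0 r1] := Iunit_bounds r; apply: mem_Iunit.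
  by rewrite mulr_ge0 // ltW // shrink_gt0.
by rewrite mulr_ile1 ?shrink_le1 // ltW // shrink_gt0.
Qed.

Lemma shrink_Ihalf s (r : Ihalf R) : shrink s * val r \in Ihalf R.
Proof.
have /andP[r0 r1] := Ihalf_bounds r; apply: mem_Ihalf.
  by rewrite mulr_ge0 // ltW // shrink_gt0.
by apply: le_trans r1; rewrite ler_piMl // shrink_le1.
Qed.

Definition shrink_path (p : dom R) (s : R) : dom R :=
  let: (r1, x1, x2, w, w1, w2) := p in
  (exist _ (shrink s * val r1) (shrink_Iunit s r1), exist _ (shrink s * val x1) (shrink_Ihalf s x1),
   exist _ (shrink s * val x2) (shrink_Ihalf s x2), w, w1, w2).

Lemma shrink_path0 p : shrink_path p 0 = p.
Proof.
case: p => [[[[[r x1] x2] w] w1] w2] /=; congr (_, _, _, _, _, _);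
by apply: val_inj; rewrite /= shrink0 mul1r.
Qed.

Lemma shrink_path_generic p s : s != 0 ->
  [/\ cx1 (shrink_path p s) < 2^-1, cr (shrink_path p s) < 1 & cx2 (shrink_path p s) < 2^-1].
Proof.
move=> /shrink_lt1 s1; case: p => [[[[[r x1] x2] w] w1] w2]; rewrite /cx1 /cx2 /cr /=.
have half (x : Ihalf R) : shrink s * val x < 2^-1.
  have /andP[x0 xh] := Ihalf_bounds x; apply: le_lt_trans (_ : shrink s * 2^-1 < _).
    by rewrite ler_wpM2l // ltW // shrink_gt0.
  by rewrite gtr_pMl // invr_gt0.
split; [exact: half| |exact: half].
have /andP[r0 r1] := Iunit_bounds r; apply: le_lt_trans s1.
by rewrite ler_piMr // ltW // shrink_gt0.
Qed.

Lemma shrink_path_continuous p : continuous (shrink_path p).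
Proof.
have sub (K : set R) (x : K) (h : forall s, shrink s * val x \in K) :
    continuous (fun s => exist (fun y => y \in K) (shrink s * val x) (h s) : K).
  apply: continuous_comp_initial => s /=.
  by apply: cvgM; [exact: shrink_continuous|exact: cvg_cst].
have pair (X Y : topologicalType) (f : R -> X) (g : R -> Y) :
    continuous f -> continuous g -> continuous (fun s => (f s, g s)).
  by move=> cf cg s; exact: (cvg_pair (cf s) (cg s)).
have cst (X : topologicalType) (x : X) : continuous (fun _ : R => x).
  by move=> s; exact: cvg_cst.
case: p => [[[[[r x1] x2] w] w1] w2].
exact: (pair _ _ _ _ (pair _ _ _ _ (pair _ _ _ _ (pair _ _ _ _ (pair _ _ _ _
  (sub _ _ (shrink_Iunit^~ r)) (sub _ _ (shrink_Ihalf^~ x1))) (sub _ _ (shrink_Ihalf^~ x2)))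
  (cst _ w)) (cst _ w1)) (cst _ w2)).
Qed.

End Path.

Section EnergySquare.
Variable R : realType.
Local Notation C := (Cplx R).

Lemma cross_terms (V : zmodType) (P P' Q Q' S T : V) :
  P + S + (T + Q) + (P' - T + (- S + Q')) = P + P' + (Q + Q').
Proof.
by rewrite (addr_perm P) (addr_perm P') -opprD [T + S]addrC addrACA subrr addr0 addrACA.
Qed.

(** The relations pass to linear combinations of the generators: [u * star u + star u * u] is a
    scalar. The remaining terms are [u ^+ 2] and its adjoint, combinations of the central
    elements. *)
Lemma energy_square (E : cstarType R) (a b : E) (l m : C) : wcar a b ->
  let u := l *: a + m *: b in
  let q := (l * l) *: a ^+ 2 + (l * m) *: (a * b + b * a) + (m * m) *: b ^+ 2 in
  (u + star u) ^+ 2 = (l * l^* + m * m^*)%:A + (q + star q).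
Proof.
move=> w u q; have [r1 r2 r3] := w; have [_ _ r4] := wcar_sym w.
have uu : u * u = q.
  rewrite /u /q mulrDl !mulrDr -!scalerAl -!scalerAr !scalerA -!expr2 scalerDr (mulrC m l).
  by rewrite !addrA.
have su : star u = l^* *: star a + m^* *: star b by rewrite starD !starZ.
have cross : u * star u + star u * u = (l * l^* + m * m^*)%:A.
  rewrite su /u !mulrDl !mulrDr -!scalerAl -!scalerAr !scalerA r3 r4.
  rewrite !scalerN (mulrC l^*) (mulrC m^* m) (mulrC m^* l) (mulrC l^* m).
  rewrite cross_terms -!scalerDr [a * _ + _]addrC [b * _ + _]addrC r1 r2 -scalerDl.
  by [].
clear su; clearbody u q; rewrite expr2 mulrDl !mulrDr uu -starM uu -cross.
by rewrite addr_perm (addrC q (star q)) [LHS]addrC.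
Qed.
End EnergySquare.

(** * The central ring of the pairs and the norm comparison *)

Section CentralRing.
Variable R : realType.
Local Notation C := (Cplx R).
Variable L : dom R -> 'M[C]_4 -> dom R -> Prop.
Hypotheses (eq1 : equivariant L (@gen1 R)) (eq2 : equivariant L (@gen2 R)).
Variables (A : cstarType R) (a1 a2 : A).
Hypothesis wA : wcar a1 a2.
Local Notation fn := (@sval _ _).
Local Notation B := (balg_cstar L).
Local Notation g1 := (gsec1 eq1).
Local Notation g2 := (gsec2 eq2).

Definition pairs : cstarType R := prod_cstar A B.
Definition pair1 : pairs := (a1, g1).
Definition pair2 : pairs := (a2, g2).

Lemma pair_wcar : wcar pair1 pair2. Proof. exact: prod_wcar wA (gsec_wcar eq1 eq2). Qed.

Inductive zgen : pairs -> Prop :=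
| ZScal (c : C) : zgen (c *: 1)
| ZAl : zgen (pair1 ^+ 2)
| ZBe : zgen (pair2 ^+ 2)
| ZGa : zgen (pair1 * pair2 + pair2 * pair1)
| ZStar x : zgen x -> zgen (star x)
| ZD x y : zgen x -> zgen y -> zgen (x + y)
| ZM x y : zgen x -> zgen y -> zgen (x * y).

Lemma zgen_gen x : zgen x -> genalg pair1 pair2 x.
Proof.
elim=> [c|||| y _|y z _ gy _ gz|y z _ gy _ gz].
- exact: GenScal.
- by apply: Gen_sqr; exact: Gen1.
- by apply: Gen_sqr; exact: Gen2.
- by apply: GenD; apply: GenM; do [exact: Gen1|exact: Gen2].
- exact: Gen_star.
- exact: GenD.
- exact: GenM.
Qed.

Lemma zgen_central x : zgen x -> commutes_with_gens pair1 pair2 x.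
Proof.
elim=> [c|||| y _|y z _ [y1 y2 y3 y4] _ [z1 z2 z3 z4]|y z _ [y1 y2 y3 y4] _ [z1 z2 z3 z4]].
- by split; rewrite -scalerAl -scalerAr mul1r mulr1.
- exact: wcar_sqr_central pair_wcar.
- by apply: commutes_with_gens_sym; exact: wcar_sqr_central (wcar_sym pair_wcar).
- exact: wcar_anticomm_central pair_wcar.
- exact: commutes_with_gens_star.
- by split; rewrite mulrDl mulrDr; congr (_ + _).
- by split; rewrite -mulrA ?z1 ?z2 ?z3 ?z4 mulrA ?y1 ?y2 ?y3 ?y4 mulrA.
Qed.

Lemma zgen_comm x y : zgen x -> genalg pair1 pair2 y -> x * y = y * x.
Proof. by move=> /zgen_central; exact: Gen_comm. Qed.

Lemma zgen_scalar p x : zgen x -> exists c : C, fn x.2 p = c%:M.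
Proof.
elim=> [c|||| y _ [c h]|y z _ [c hc] _ [d hd]|y z _ [c hc] _ [d hd]].
- by exists c; rewrite balgZE balg1E scalemx1.
- by exists (alphav p); exact: gen1_sqr.
- by exists (betav p); exact: gen2_sqr.
- by exists (gammav p); exact: gen12_anti.
- exists c^*; transitivity ((fn y.2 p)^t*); first exact: erefl.
  by rewrite h tr_scalar_mx map_scalar_mx.
- by exists (c + d); rewrite balgDE hc hd raddfD.
- by exists (c * d); rewrite balgME hc hd scalar_mxM.
Qed.

Definition zpred : pred pairs := fun x => `[< zgen x >].

Lemma zpredP x : reflect (zgen x) (x \in zpred). Proof. exact: asboolP. Qed.

Fact zpred_closed : subring_closed zpred.
Proof.
have z1 : zgen 1 by have := ZScal 1; rewrite scale1r.
have zN x : zgen x -> zgen (- x).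
  by move=> zx; have := ZM (ZScal (-1)) zx; rewrite -scalerAl mul1r scaleN1r.
split; first exact/zpredP.
  by move=> x y /zpredP zx /zpredP zy; apply/zpredP/ZD => //; exact: zN.
by move=> x y /zpredP zx /zpredP zy; apply/zpredP/ZM.
Qed.
HB.instance Definition _ := GRing.isSubringClosed.Build pairs zpred zpred_closed.

(** A ring type of its own, because determinants require a commutative ring of coefficients;
    commutativity holds since its elements are central among generated pairs. *)
Record zt := Zt { zv :> pairs; zvP : zv \in zpred }.
HB.instance Definition _ := [isSub for zv].
HB.instance Definition _ := [Choice of zt by <:].
HB.instance Definition _ := [SubChoice_isSubNzRing of zt by <:].
Fact zt_mulC : commutative (@GRing.mul zt).
Proof.
move=> x y; apply: val_inj; rewrite !rmorphM /=; apply: zgen_comm.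
  by apply/zpredP; exact: zvP.
by apply: zgen_gen; apply/zpredP; exact: zvP.
Qed.
HB.instance Definition _ := GRing.PzRing_hasCommutativeMul.Build zt zt_mulC.

Definition zinc : {rmorphism zt -> pairs} := \val.

Lemma zincP z : zgen (zinc z). Proof. by apply/zpredP; exact: zvP. Qed.

Lemma zinc_inj : injective zinc. Proof. exact: val_inj. Qed.

Definition mkz x (zx : zgen x) : zt := Zt (introT (zpredP x) zx).

Lemma zinc_mkz x (zx : zgen x) : zinc (mkz zx) = x. Proof. by []. Qed.

Lemma zt_ind (P : zt -> Prop) :
  (forall c, P (mkz (ZScal c))) -> P (mkz ZAl) -> P (mkz ZBe) -> P (mkz ZGa) ->
  (forall z, P z -> P (mkz (ZStar (zincP z)))) ->
  (forall z w, P z -> P w -> P (z + w)) -> (forall z w, P z -> P w -> P (z * w)) ->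
  forall z, P z.
Proof.
move=> hc ha hb hg hs hD hM z.
suff h x : zgen x -> exists2 w, zinc w = x & P w.
  by have [w /zinc_inj ->] := h _ (zincP z).
elim=> [c|||| y _ [w <- pw]|y y' _ [w <- pw] _ [w' <- pw']|y y' _ [w <- pw] _ [w' <- pw']].
- by exists (mkz (ZScal c)) => //; exact: hc.
- by exists (mkz ZAl).
- by exists (mkz ZBe).
- by exists (mkz ZGa).
- by exists (mkz (ZStar (zincP w))) => //; exact: hs.
- by exists (w + w'); [rewrite rmorphD|exact: hD].
- by exists (w * w'); [rewrite rmorphM|exact: hM].
Qed.

Definition zscal (c : C) : zt := mkz (ZScal c).
Definition zstar (z : zt) : zt := mkz (ZStar (zincP z)).
Definition zal : zt := mkz ZAl.
Definition zbe : zt := mkz ZBe.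
Definition zga : zt := mkz ZGa.

Fact zscal_additive : zmod_morphism zscal.
Proof. by move=> x y; apply: zinc_inj; rewrite rmorphB !zinc_mkz scalerBl. Qed.
HB.instance Definition _ := GRing.isZmodMorphism.Build C zt zscal zscal_additive.
Fact zscal_multiplicative : monoid_morphism zscal.
Proof.
split; first by apply: zinc_inj; rewrite rmorph1 zinc_mkz scale1r.
by move=> x y; apply: zinc_inj; rewrite rmorphM !zinc_mkz -scalerAl mul1r scalerA.
Qed.
HB.instance Definition _ := GRing.isMonoidMorphism.Build C zt zscal zscal_multiplicative.

Fact zstar_additive : zmod_morphism zstar.
Proof. by move=> x y; apply: zinc_inj; rewrite rmorphB !zinc_mkz rmorphB starB. Qed.
HB.instance Definition _ := GRing.isZmodMorphism.Build zt zt zstar zstar_additive.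
Fact zstar_multiplicative : monoid_morphism zstar.
Proof.
split; first by apply: zinc_inj; rewrite rmorph1 zinc_mkz rmorph1 star1.
by move=> x y; apply: zinc_inj; rewrite mulrC !rmorphM !zinc_mkz rmorphM starM.
Qed.
HB.instance Definition _ := GRing.isMonoidMorphism.Build zt zt zstar zstar_multiplicative.

Lemma zstarK : involutive zstar.
Proof. by move=> z; apply: zinc_inj; rewrite !zinc_mkz starK. Qed.
Lemma zstar_scal c : zstar (zscal c) = zscal c^*.
Proof. by apply: zinc_inj; rewrite !zinc_mkz starZ star1. Qed.

(** The section in the second coordinate has scalar values, so one diagonal entry determines it. *)
Definition evz p (z : zt) : C := fn (zinc z).2 p 0 0.

Lemma evzE p z : fn (zinc z).2 p = (evz p z)%:M.
Proof.
have [c h] := zgen_scalar p (zincP z); rewrite /evz {}h; congr (_%:M).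
by rewrite mxE eqxx mulr1n.
Qed.

Lemma scalar_mx_inj : injective (fun c : C => c%:M : 'M[C]_4).
Proof. by move=> c d /matrixP/(_ 0 0); rewrite !mxE eqxx !mulr1n. Qed.

Section Evaluation.
Variable p : dom R.

Fact evz_additive : zmod_morphism (evz p).
Proof.
move=> x y; apply: scalar_mx_inj; rewrite raddfB /= -!evzE rmorphB /=.
exact: balgBE.
Qed.
HB.instance Definition _ := GRing.isZmodMorphism.Build zt C (evz p) evz_additive.
Fact evz_multiplicative : monoid_morphism (evz p).
Proof.
split; first by apply: scalar_mx_inj; rewrite -evzE rmorph1.
by move=> x y; apply: scalar_mx_inj; rewrite scalar_mxM -!evzE rmorphM.
Qed.
HB.instance Definition _ := GRing.isMonoidMorphism.Build zt C (evz p) evz_multiplicative.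

Lemma evz_scal c : evz p (zscal c) = c.
Proof. by apply: scalar_mx_inj; rewrite -evzE zinc_mkz balgZE balg1E scalemx1. Qed.
Lemma evz_star z : evz p (zstar z) = (evz p z)^*.
Proof.
apply: scalar_mx_inj; rewrite -evzE zinc_mkz.
transitivity ((fn (zinc z).2 p)^t*); first exact: erefl.
by rewrite evzE tr_scalar_mx map_scalar_mx.
Qed.
Lemma evz_al : evz p zal = alphav p.
Proof. by apply: scalar_mx_inj; rewrite -evzE; exact: gen1_sqr. Qed.
Lemma evz_be : evz p zbe = betav p.
Proof. by apply: scalar_mx_inj; rewrite -evzE; exact: gen2_sqr. Qed.
Lemma evz_ga : evz p zga = gammav p.
Proof. by apply: scalar_mx_inj; rewrite -evzE; exact: gen12_anti. Qed.

End Evaluation.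

Lemma iota_comm_gen y : genalg pair1 pair2 y -> iota_comm zinc y.
Proof. by move=> gy z; apply: zgen_comm => //; exact: zincP. Qed.

Lemma gens_act : exists W : 'cV[pairs]_16, [/\ iota_comm_col zinc W, W 0 0 = 1 &
  forall y, genalg pair1 pair2 y -> acts zinc W y].
Proof.
have [r1 r2 r3] := pair_wcar.
have r4 : star pair2 * pair1 = - (pair1 * star pair2) by case: (wcar_sym pair_wcar).
pose s := [:: pair1; star pair1; pair2; star pair2].
have sg x : x \in s -> genalg pair1 pair2 x.
  by rewrite !inE => /or4P[]/eqP->; [exact: Gen1|exact: Gen1s|exact: Gen2|exact: Gen2s].
have Z0 : exists z, 0 = zinc z by exists 0; rewrite rmorph0.
have Z1 : exists z, 1 = zinc z by exists 1; rewrite rmorph1.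
have Za : exists z, pair1 * pair1 = zinc z by exists zal.
have Zb : exists z, pair2 * pair2 = zinc z by exists zbe.
have Zg : exists z, pair1 * pair2 + pair2 * pair1 = zinc z by exists zga.
have Zd x : (exists z, x * x = zinc z) -> exists z, x * x + x * x = zinc z.
  by move=> [z ->]; exists (z + z); rewrite rmorphD.
have Zsq x : (exists z, x * x = zinc z) -> exists z, star x * star x = zinc z.
  by move=> [z e]; exists (zstar z); rewrite -starM e.
have Zs x y : (exists z, x * y + y * x = zinc z) ->
    exists z, star x * star y + star y * star x = zinc z.
  move=> [z e]; exists (zstar z); rewrite -!starM -starD addrC e; exact: erefl.
have Zc x y : (exists z, x * y + y * x = zinc z) -> exists z, y * x + x * y = zinc z.
  by rewrite addrC.
have r3' : star pair1 * pair2 + pair2 * star pair1 = 0 by rewrite r3 addNr.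
have r4' : star pair2 * pair1 + pair1 * star pair2 = 0 by rewrite r4 addNr.
have [||x|W [cW W0 hW]] := @four_generators _ _ zinc pair1 (star pair1) pair2 (star pair2).
- by move=> x /sg; exact: iota_comm_gen.
(* Anticommutators of a generator with an adjoint are 0 or 1 by the relations; the others come from
   [zal], [zbe], [zga] and their adjoints. *)
- move=> x y; rewrite !inE => /or4P[]/eqP-> /or4P[]/eqP->.
  + exact: Zd.
  + by apply: (Zc); rewrite r1.
  + by [].
  + by apply: (Zc); rewrite r4'.
  + by rewrite r1.
  + by apply: (Zd); exact: Zsq.
  + by rewrite r3'.
  + exact: Zs.
  + exact: Zc.
  + by apply: (Zc); rewrite r3'.
  + exact: Zd.
  + by apply: (Zc); rewrite r2.
  + by rewrite r4'.
  + by apply: (Zc); exact: Zs.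
  + by rewrite r2.
  + by apply: (Zd); exact: Zsq.
- by rewrite !inE => /or4P[]/eqP->; [|exact: Zsq| |exact: Zsq].
exists W; split=> // y; elim=> [c||||| x z _ ax _ az|x z _ ax _ az].
- by apply: (@acts_iota _ _ zinc _ _ (zscal c)).
- by apply: hW; rewrite !inE eqxx.
- by apply: hW; rewrite !inE eqxx orbT.
- by apply: hW; rewrite !inE eqxx !orbT.
- by apply: hW; rewrite !inE eqxx !orbT.
- exact: actsD.
- exact: actsM.
Qed.

Local Notation "t %:S" := ((t%:C : C)%:A) (at level 2, format "t %:S").

Definition ev (p : dom R) (x : pairs) : 'M[C]_4 := fn x.2 p.

Section DeterminantBound.

Lemma ev_sum p (n : nat) (f : 'I_n -> pairs) : ev p (\sum_i f i) = \sum_i ev p (f i).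
Proof. by apply: big_morph => //; exact: balg0E. Qed.

Variables (W : 'cV[pairs]_16).
Hypotheses (W0 : W 0 0 = 1) (hW : forall y, genalg pair1 pair2 y -> acts zinc W y).

Lemma ev_row p x (K : 'M[zt]_16) i : W *m x%:M = map_mx zinc K *m W ->
  ev p (W i 0) *m ev p x = \sum_j evz p (K i j) *: ev p (W j 0).
Proof.
move=> /matrixP/(_ i 0); rewrite !mxE big_ord1 mxE eqxx mulr1n => /(congr1 (ev p)).
rewrite ev_sum => e; rewrite -[LHS]/(ev p (W i 0 * x)) e; apply: eq_bigr => j _.
by rewrite mxE -mul_scalar_mx -evzE.
Qed.

Lemma l2norm_shift (Y : 'M[C]_4) (l N : R) v : opnorm Y <= N ->
  (l - N) * l2norm v <= l2norm ((l%:C%:M - Y) *m v).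
Proof.
move=> YN; rewrite mulmxBl mul_scalar_mx.
have h := l2normD (l%:C *: v - Y *m v) (Y *m v); rewrite subrK l2normZ cabs_real in h.
have h2 := opnorm_ub Y v; have v0 := l2norm_ge0 v.
have h3 : l2norm (Y *m v) <= N * l2norm v by apply: le_trans h2 _; rewrite ler_wpM2r.
have h4 : l * l2norm v <= `|l| * l2norm v by rewrite ler_wpM2r // ler_norm.
rewrite mulrBl lerBlDr; apply: le_trans h4 _; apply: le_trans h _.
by rewrite lerD2l.
Qed.

Variables (y : pairs) (l : R).
Hypotheses (sy : star y = y) (yl : cnorm y.2 <= l).
Variable K : 'M[zt]_16.
Hypothesis hK : W *m (l%:S - y)%:M = map_mx zinc K *m W.

Lemma det_bound_generic p : cx1 p < 2^-1 -> cr p < 1 -> cx2 p < 2^-1 ->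
  (l - cnorm y.2) ^+ 16 <= cabs (evz p (\det K)).
Proof.
move=> x1 r1 x2; rewrite -det_map_mx.
have evh : ev p (l%:S - y) = l%:C%:M - ev p y.
  transitivity (fn (l%:S - y.2) p); first exact: erefl.
  by rewrite balgBE balgZE balg1E scalemx1.
apply: (@spanning_det_bound _ (fun i => ev p (W i 0)) (ev p (l%:S - y))).
- by rewrite subr_ge0.
(* [M] is the value of a generated section, which lifts to a generated pair. Row 0 of the matrix of
   that pair, where [W] is 1, writes [M] as a combination of the values of [W]. *)
- move=> M; have [b gb <-] := img_generic eq1 eq2 x1 r1 x2 M.
  have [a ga] := Gen_lift a1 a2 gb; have [Q hQ] := hW ga.
  exists (fun j => evz p (Q 0 j)); rewrite -(ev_row p 0 hQ) W0.
  transitivity (1%:M *m fn b p); first by rewrite mul1mx.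
  exact: erefl.
- by move=> i; rewrite (ev_row p i hK); apply: eq_bigr => j _; rewrite mxE.
move=> v; rewrite evh.
have sY : (ev p y)^t* = ev p y by rewrite -{2}sy.
have -> : (l%:C%:M - ev p y)^t* = l%:C%:M - ev p y.
  by rewrite linearB /= map_mxB tr_scalar_mx map_scalar_mx /= conj_realc sY.
by apply: l2norm_shift; exact: balg_ub.
Qed.

(** Every point is the end of a [shrink_path] whose other points are generic, and the determinant is
    continuous along it. *)
Lemma det_bound_everywhere p : (l - cnorm y.2) ^+ 16 <= cabs (evz p (\det K)).
Proof.
set d := _ ^+ 16; rewrite leNgt; apply/negP => lt.
pose f s := evz (shrink_path p s) (\det K).
have cf : continuous f.
  move=> s; have [cv _] := svalP (zinc (\det K)).2.
  have cs : continuous (fun s => fn (zinc (\det K)).2 (shrink_path p s)).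
    by move=> t; apply: continuous_comp; [exact: shrink_path_continuous|exact: cv].
  exact: (@cvg_entry _ _ _ _ _ _ 0 0 (cs s)).
have e0 : 0 < d - cabs (f 0) by rewrite subr_gt0 /f shrink_path0.
have /cvg_cabsP/(_ _ e0) := cf 0.
case/nbhs_ballP => e /= ep /(_ (e / 2)).
have he : 0 < e / 2 by rewrite divr_gt0.
have s0 : e / 2 != 0 by rewrite gt_eqF.
have [x1 r1 x2] := shrink_path_generic p s0; have hd := det_bound_generic x1 r1 x2.
move=> h; have {}h : cabs (f 0 - f (e / 2)) < d - cabs (f 0).
  apply: h; rewrite /ball /= sub0r normrN ger0_norm ?ltW //.
  by rewrite ltr_pdivrMr // ltr_pMr // ltr1n.
have : cabs (f (e / 2)) <= cabs (f 0) + cabs (f 0 - f (e / 2)).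
  have := cabsD (f 0) (- (f 0 - f (e / 2))); rewrite cabsN opprB.
  by rewrite addrC subrK.
move/(le_trans hd); rewrite -lerBlDl => hd'.
by have := lt_le_trans h hd'; rewrite ltxx.
Qed.

End DeterminantBound.


Section Character.
Variable chi : zt -> R.
Definition zreal : set zt := [set z | zstar z = z].
Hypothesis chi_scal : forall r : R, chi (zscal r%:C) = r.
Hypothesis chiD : forall z w, zreal z -> zreal w -> chi (z + w) = chi z + chi w.
Hypothesis chiM : forall z w, zreal z -> zreal w -> chi (z * w) = chi z * chi w.

Let h := zscal 2^-1.
Let ii := zscal 'i.
Let hh : h + h = 1.
Proof.
have e : 2^-1 + 2^-1 = 1 :> C by field.
by rewrite -rmorphD e rmorph1.
Qed.
Let ii2 : ii * ii = -1.
Proof. by rewrite -rmorphM -expr2 sqrCi rmorphN1. Qed.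
Let sh : zstar h = h.
Proof. by rewrite zstar_scal fmorphV rmorph_nat. Qed.
Let sii : zstar ii = - ii.
Proof. by rewrite zstar_scal conjCi rmorphN. Qed.

Definition zre z := h * (z + zstar z).
Definition zim z := - (ii * h) * (z - zstar z).

Lemma zre_real z : zreal (zre z).
Proof. by rewrite /zreal /= rmorphM rmorphD /= sh zstarK addrC. Qed.
Lemma zim_real z : zreal (zim z).
Proof. by rewrite /zreal /= rmorphM rmorphB rmorphN rmorphM /= sh sii zstarK /zim; ring. Qed.

Let hx x : h * x + h * x = x. Proof. by rewrite -mulrDl hh mul1r. Qed.

Lemma zreM z w : zre (z * w) = zre z * zre w - zim z * zim w.
Proof.
rewrite /zre /zim rmorphM /=.
transitivity (h * (h * (z * w + zstar z * zstar w) + h * (z * w + zstar z * zstar w))).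
  by rewrite hx.
transitivity (h * h * ((z + zstar z) * (w + zstar w)) -
  (ii * ii) * (h * h) * ((z - zstar z) * (w - zstar w))); last by ring.
by rewrite ii2; ring.
Qed.

Lemma zimM z w : zim (z * w) = zre z * zim w + zim z * zre w.
Proof.
rewrite /zre /zim rmorphM /=.
transitivity (- (ii * h) * (h * (z * w - zstar z * zstar w) + h * (z * w - zstar z * zstar w))).
  by rewrite hx.
by ring.
Qed.

Lemma zre_id z : zreal z -> zre z = z.
Proof. by rewrite /zreal /= /zre => ->; rewrite mulrDr hx. Qed.
Lemma zim_id z : zreal z -> zim z = 0.
Proof. by rewrite /zreal /= /zim => ->; rewrite subrr mulr0. Qed.

Lemma zreal_scal (r : R) : zreal (zscal r%:C).
Proof. by rewrite /zreal /= zstar_scal conj_realc. Qed.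
Lemma zrealM z w : zreal z -> zreal w -> zreal (z * w).
Proof. by rewrite /zreal /= rmorphM /= => -> ->. Qed.
Lemma zrealN z : zreal z -> zreal (- z).
Proof. by rewrite /zreal /= rmorphN /= => ->. Qed.

Lemma chi0 : chi 0 = 0.
Proof. by have := chi_scal 0; rewrite rmorph0. Qed.
Lemma chiN z : zreal z -> chi (- z) = - chi z.
Proof.
move=> rz; apply/eqP; rewrite -addr_eq0 addrC -chiD ?subrr ?chi0 //.
exact: zrealN.
Qed.

(** The complex extension of [chi], whose additivity and multiplicativity are known on [zreal]
    only. *)
Definition chiC z : C := (chi (zre z))%:C + 'i * (chi (zim z))%:C.

Lemma chiC_real z : zreal z -> chiC z = (chi z)%:C.
Proof. by move=> rz; rewrite /chiC zre_id // zim_id // chi0 rmorph0 mulr0 addr0. Qed.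

Lemma chiCD z w : chiC (z + w) = chiC z + chiC w.
Proof.
have eR : zre (z + w) = zre z + zre w by rewrite /zre rmorphD /=; ring.
have eI : zim (z + w) = zim z + zim w by rewrite /zim rmorphD /=; ring.
have [a b c d] := And4 (zre_real z) (zre_real w) (zim_real z) (zim_real w).
by rewrite /chiC eR eI (chiD a b) (chiD c d) !realcD; ring.
Qed.

Lemma chiCM z w : chiC (z * w) = chiC z * chiC w.
Proof.
have [a b c d] := And4 (zre_real z) (zre_real w) (zim_real z) (zim_real w).
rewrite /chiC zreM zimM (chiD (zrealM a b) (zrealN (zrealM c d))) (chiN (zrealM c d)).
rewrite (chiD (zrealM a d) (zrealM c b)) (chiM a b) (chiM c d) (chiM a d) (chiM c b).
rewrite !(realcD, realcN, realcM).
transitivity ((chi (zre z))%:C * (chi (zre w))%:C + ('i ^+ 2) * ((chi (zim z))%:C * (chi (zim w))%:C) +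
  'i * ((chi (zre z))%:C * (chi (zim w))%:C + (chi (zim z))%:C * (chi (zre w))%:C) : C).
  by rewrite sqrCi; ring.
by ring.
Qed.

Lemma chiC_star z : chiC (zstar z) = (chiC z)^*.
Proof.
have eR : zre (zstar z) = zre z by rewrite /zre zstarK addrC.
have eI : zim (zstar z) = - zim z by rewrite /zim zstarK; ring.
rewrite /chiC eR eI chiN; last exact: zim_real.
by rewrite rmorphD rmorphM /= !conj_realc conjCi realcN; ring.
Qed.

Lemma chiC_scal c : chiC (zscal c) = c.
Proof.
have ci : chiC ii = 'i.
  have rN : zre ii = 0 by rewrite /zre sii subrr mulr0.
  have iN : zim ii = zscal (1 : R)%:C.
    rewrite (_ : zscal _ = 1); last exact: rmorph1.
    transitivity (- (ii * ii) * (h + h)); first by rewrite /zim sii; ring.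
    by rewrite ii2 hh; ring.
  by rewrite /chiC rN iN chi0 chi_scal rmorph0 add0r mulr1.
have -> : c = (complex.Re c)%:C + 'i * (complex.Im c)%:C.
  by case: c => a b; apply/eqP; rewrite eq_complex /= !(mul0r, mulr0, subr0, add0r, addr0, mul1r, mulr1) !eqxx.
rewrite rmorphD rmorphM /= chiCD chiCM -/ii ci !chiC_real ?chi_scal //; exact: zreal_scal.
Qed.

(** At the values of [chiC] on [zal], [zbe] and [zga] the energy is [chi] of a square of a
    self-adjoint pair, hence nonnegative; [energy_values] supplies a point with these values.
    Induction over the ring then identifies both characters. *)
Lemma chiC_point : (forall z, zreal z -> pos (zinc z).1 -> 0 <= chi z) ->
  exists p, forall z, evz p z = chiC z.
Proof.
move=> chi_pos.
have [l m|p [pa pb pg]] := @energy_values R (chiC zal) (chiC zbe) (chiC zga).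
  pose q := zscal (l * l) * zal + zscal (l * m) * zga + zscal (m * m) * zbe.
  pose e := zscal (l * l^* + m * m^*) + (q + zstar q).
  pose u := l *: pair1 + m *: pair2.
  have scE c z : zinc (zscal c * z) = c *: zinc z by rewrite rmorphM /= -scalerAl mul1r.
  have eE : zinc e = (u + star u) ^+ 2.
    have qE : zinc q = (l * l) *: pair1 ^+ 2 + (l * m) *: (pair1 * pair2 + pair2 * pair1) + (m * m) *: pair2 ^+ 2.
      by rewrite /q !(rmorphD zinc) !scE.
    have := energy_square l m pair_wcar; rewrite -/u -qE => ->.
    rewrite /e !(rmorphD zinc); exact: erefl.
  have re : zreal e.
    by apply: zinc_inj; rewrite zinc_mkz eE starX starD starK addrC.
  have : 0 <= chi e.
    apply: (chi_pos) => //; rewrite eE.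
    have -> : ((u + star u) ^+ 2).1 = (u.1 + star u.1) ^+ 2 by [].
    by apply: pos_sq; rewrite starD starK addrC.
  rewrite -lecR -chiC_real // /e /q !(chiCD, chiC_star, chiCM, chiC_scal).
  by congr (_ <= _); rewrite /energy.
exists p; elim/zt_ind => [c||||z e|z w e e'|z w e e'].
- by rewrite chiC_scal evz_scal.
- by rewrite evz_al.
- by rewrite evz_be.
- by rewrite evz_ga.
- by rewrite evz_star chiC_star e.
- by rewrite rmorphD /= chiCD e e'.
- by rewrite rmorphM /= chiCM e e'.
Qed.

End Character.

(** Positivity is tested in [A] only. Requiring it in the second coordinate too would presuppose
    information on [B] in a certificate about [A]. *)
Definition zpos : set zt := [set z | zreal z /\ pos (zinc z).1].

Lemma zpos_preorder : preorder (zscal \o real_complex R) zreal zpos.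
Proof.
split.
- by move=> z [].
- move=> z w [rz pz] [rw pw]; split; first by rewrite /zreal /= rmorphD /= rz rw.
  by rewrite (rmorphD zinc); exact: posD.
- move=> z w [rz pz] [rw pw]; split; first exact: zrealM.
  rewrite (rmorphM zinc); apply: posM => //.
  by have := congr1 (fun x => (zinc x).1) (mulrC z w); rewrite !(rmorphM zinc).
- move=> z rz; split; first exact: zrealM.
  rewrite (rmorphM zinc); apply: (@pos_sq _ _ (zinc z).1).
  by have := congr1 (fun x => (zinc x).1) rz.
- by move=> r r0; split; [exact: zreal_scal|exact: pos_realS].
move=> z rz; exists (cnorm (zinc z).1); split.
  by rewrite /zreal /= rmorphB /= zstar_scal conj_realc rz.
rewrite (rmorphB zinc); apply: pos_sub_norm => //.
by have := congr1 (fun x => (zinc x).1) rz.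
Qed.

Lemma first_invertible (y : pairs) (l : R) : genalg pair1 pair2 y -> star y = y -> cnorm y.2 < l ->
  exists k, k * (l%:S - y.1) = 1 /\ (l%:S - y.1) * k = 1.
Proof.
move=> gy sy yl; have [W [cW W0 hW]] := gens_act.
have [K hK] := hW _ (GenB (GenScal pair1 pair2 l%:C) gy).
have [k0 hk0] := acts_det W0 hK.
have hd p := det_bound_everywhere W0 hW sy (ltW yl) hK p.
have d0 : 0 < (l - cnorm y.2) ^+ 16 by rewrite exprn_gt0 // subr_gt0.
set d := \det K in hk0 hd.
(* [d] itself is not known to be self-adjoint; its square modulus is, and takes the values
   [|d| ^+ 2] at points. *)
have rg : zreal (zstar d * d) by rewrite /zreal /= rmorphM /= zstarK mulrC.
have rD z w : zreal z -> zreal w -> zreal (z + w) by rewrite /zreal /= rmorphD /= => -> ->.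
have [[a [b [[_ pa] _ e]]]|[chi [chi1 chi2 chi3 chi4 chi5]]] :=
    preorder_character (i := zscal \o real_complex R) rD zrealM zreal_scal zpos_preorder rg.
  (* The certificate [zstar d * d * b = 1 + a] has an invertible right-hand side in [A], and [d] is
     a left multiple of [l - y]; together they give a left inverse [r]. *)
  have [k [k1 _]] := pos_succ_inv pa.
  have sh : star (l%:S - y.1) = l%:S - y.1.
    by rewrite starB star_real; have := congr1 fst sy => /= ->.
  pose r := k * ((zinc (b * zstar d)).1 * k0.1).
  have rh : r * (l%:S - y.1) = 1.
    transitivity (k * (1 + (zinc a).1)); last exact: k1.
    rewrite /r -(mulrA k) -(mulrA _ k0.1); congr (k * _).
    have e' : b * zstar d * d = 1 + a by rewrite -e; ring.
    have : zinc (b * zstar d) * zinc d = 1 + zinc a.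
      by rewrite -(rmorphM zinc) e' (rmorphD zinc) rmorph1.
    by rewrite hk0 => /(congr1 fst) E; exact: E.
  (* Since [l - y] is self-adjoint, [star r] is a right inverse, and a left and a right inverse
     coincide. *)
  exists r; split => //; have hr : (l%:S - y.1) * star r = 1 by have := congr1 star rh; rewrite starM sh star1.
  suff -> : r = star r by exact: hr.
  by rewrite -[LHS]mulr1 -[X in _ * X]hr mulrA rh mul1r.
(* In the other case the character is evaluation at a point, where [|d| ^+ 2] would be at most 0,
   against the lower bound on [D]. *)
have [p hp] : exists p, forall z, evz p z = chiC chi z.
  by apply: chiC_point => // z rz pz; exact: chi4.
have := hp (zstar d * d); rewrite (chiC_real chi1 rg) rmorphM /= evz_star mulrC mulC_conj.
move=> [e]; move: chi5; rewrite -e leNgt => /negP[].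
by rewrite exprn_gt0 // (lt_le_trans d0).
Qed.

Lemma first_norm_le (y : pairs) : genalg pair1 pair2 y -> cnorm y.1 <= cnorm y.2.
Proof.
have sa z : genalg pair1 pair2 z -> star z = z -> cnorm z.1 <= cnorm z.2.
  move=> gz sz; apply/ler_addgt0Pr => e e0.
  have s1 : star z.1 = z.1 by have := congr1 fst sz.
  have lt : cnorm z.2 < cnorm z.2 + e by rewrite ltrDl.
  apply: sa_norm_le => //; first by rewrite addr_ge0 ?cnorm_ge0 // ltW.
    by apply: (sa_spectral_bound s1 _ lt) => l; exact: first_invertible.
  rewrite -[z.1 in X in pos X]opprK.
  apply: (@sa_spectral_bound _ _ (cnorm z.2) (- z.1)) lt; first by rewrite starN s1.
  move=> l hl; apply: (@first_invertible (- z)); first exact: GenN.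
    by rewrite starN sz.
  by move: hl; rewrite -(cnormN z.2).
move=> gy; rewrite -(@ler_pXn2r _ 2) ?nnegrE ?cnorm_ge0 // -!cnorm_cstar.
by apply: (sa (star y * y)); [apply: GenM => //; exact: Gen_star|rewrite starM starK].
Qed.

End CentralRing.

(** * The closure of the generated *-algebra *)

Section Closure.
Variables (R : realType) (E : cstarType R) (a1 a2 : E).
Local Notation C := (Cplx R).

Definition clgen (x : E) := forall e : R, 0 < e -> exists2 y, genalg a1 a2 y & cnorm (y - x) < e.

Lemma clgen_gen x : genalg a1 a2 x -> clgen x.
Proof. by move=> gx e e0; exists x => //; rewrite subrr cnorm0. Qed.

Lemma clgenD x y : clgen x -> clgen y -> clgen (x + y).
Proof.
move=> cx cy e e0; have e2 : 0 < e / 2 by rewrite divr_gt0.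
have [u gu hu] := cx _ e2; have [v gv hv] := cy _ e2.
exists (u + v); first exact: GenD.
rewrite opprD addrACA; apply: le_lt_trans (ler_cnormD _ _) _.
by rewrite [e](splitr e) ltrD.
Qed.

Lemma clgenM x y : clgen x -> clgen y -> clgen (x * y).
Proof.
move=> cx cy e e0; set M := cnorm x + cnorm y + 1.
have [x0 y0] := (cnorm_ge0 x, cnorm_ge0 y).
have M0 : 0 < M by rewrite /M; move: x0 y0; lra.
pose d := Num.min 1 (e / (2 * M)).
have d0 : 0 < d by rewrite lt_min ltr01 divr_gt0 // mulr_gt0.
have d1 : d <= 1 by rewrite ge_min lexx.
have d2 : d * M <= e / 2.
  apply: (@le_trans _ _ (e / (2 * M) * M)); first by rewrite ler_wpM2r ?(ltW M0) // ge_min lexx orbT.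
  by rewrite invfM mulrA divfK // gt_eqF.
have [u gu hu] := cx _ d0; have [v gv hv] := cy _ d0.
exists (u * v); first exact: GenM.
have -> : u * v - x * y = (u - x) * v + x * (v - y) by rewrite mulrBl mulrBr addrA subrK.
have v1 : cnorm v <= cnorm y + 1.
  rewrite -[v](subrK y); apply: le_trans (ler_cnormD _ _) _.
  by rewrite addrC lerD2l; apply: le_trans (ltW hv) d1.
apply: le_lt_trans (ler_cnormD _ _) _.
have h1 : cnorm ((u - x) * v) <= d * (cnorm y + 1).
  apply: le_trans (ler_cnormM _ _) _; apply: ler_pM; rewrite ?cnorm_ge0 //; exact: ltW.
have h2 : cnorm (x * (v - y)) <= d * cnorm x.
  apply: le_trans (ler_cnormM _ _) _; rewrite mulrC; apply: ler_pM; rewrite ?cnorm_ge0 //; exact: ltW.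
apply: le_lt_trans (lerD h1 h2) _.
have -> : d * (cnorm y + 1) + d * cnorm x = d * M by rewrite /M; ring.
by apply: le_lt_trans d2 _; rewrite ltr_pdivrMr // ltr_pMr // ltr1n.
Qed.

Lemma clgenZ (c : C) x : clgen x -> clgen (c *: x).
Proof.
move=> cx; rewrite -[x]mul1r scalerAl; apply: clgenM => //.
by apply: clgen_gen; exact: GenScal.
Qed.

Lemma clgen_star x : clgen x -> clgen (star x).
Proof.
move=> cx e /cx[y gy hy]; exists (star y); first exact: Gen_star.
by rewrite -starB cnorm_star.
Qed.

End Closure.

Lemma norm_chain (R : realType) (a b c d f g e : R) : a < e / 2 -> b < e / 2 -> c <= f + a ->
  g <= d + b -> f <= g -> c <= d + e.
Proof. lra. Qed.

(** * The universal property of the function algebra *)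

Section Universal.
Variable R : realType.
Local Notation C := (Cplx R).
Variable U : Iunit R -> Ihalf R -> R -> R -> R -> 'M[C]_4.
Hypothesis hU : is_intertwiner U.
Local Notation L := (bc_rel U).
Local Notation e1 := (gen1_equivariant hU).
Local Notation e2 := (gen2_equivariant hU).
Local Notation g1 := (gsec1 e1).
Local Notation g2 := (gsec2 e2).
Local Notation B := (balg_cstar L).

Section Map.
Variables (A : cstarType R) (a1 a2 : A).
Hypothesis wA : wcar a1 a2.
Local Notation X := (pairs L A).
Local Notation cl := (@clgen R X (pair1 e1 a1) (pair2 e2 a2)).

Lemma closure_first_le (x : X) : cl x -> cnorm x.1 <= cnorm x.2.
Proof.
move=> cx; apply/ler_addgt0Pr => e e0; have d0 : 0 < e / 2 by rewrite divr_gt0.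
have [y gy hy] := cx _ d0.
have h1 := le_lt_trans (@prod_norm1 _ _ _ (y - x)) hy.
have h2 := le_lt_trans (@prod_norm2 _ _ _ (y - x)) hy.
have h3 : cnorm x.1 <= cnorm y.1 + cnorm (y.1 - x.1).
  by rewrite -{1}[x.1](subKr y.1); apply: le_trans (ler_cnormB _ _) _.
have h4 : cnorm y.2 <= cnorm x.2 + cnorm (y.2 - x.2).
  by rewrite -{1}[y.2](subrKC x.2); exact: ler_cnormD.
exact: norm_chain h1 h2 h3 h4 (first_norm_le wA gy).
Qed.

(** The closure of the generated pairs is the graph of the map to be constructed. The difference of
    the two pairs has second coordinate 0, so its first coordinate vanishes by the norm
    inequality. *)
Lemma closure_inj (b : B) (a a' : A) : cl (a, b) -> cl (a', b) -> a = a'.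
Proof.
move=> h h'; have h'' : cl ((a, b) - (a', b)).
  by rewrite -scaleN1r; apply: clgenD => //; exact: clgenZ.
apply/eqP; rewrite -subr_eq0; apply/eqP/cnorm_eq0/eqP; rewrite eq_le cnorm_ge0 andbT.
have := closure_first_le h''.
have -> : ((a, b) - (a', b) : X).2 = 0 by exact: subrr.
by rewrite cnorm0.
Qed.

(** By density [b] is a limit of second coordinates of generated pairs; the norm inequality makes
    their first coordinates a Cauchy sequence. *)
Lemma closure_total (b : B) : exists a : A, cl (a, b).
Proof.
have /choice[y hy] : forall n : nat, exists y : X,
    genalg (pair1 e1 a1) (pair2 e2 a2) y /\ cnorm (b - y.2) <= n.+1%:R^-1.
  move=> n; have n0 : 0 < n.+1%:R^-1 :> R by rewrite invr_gt0.
  have [z gz hz] := generators_dense hU b n0.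
  by have [a ga] := Gen_lift a1 a2 gz; exists (a, z).
have small (e : R) : 0 < e -> exists N, forall n, (N <= n)%N -> n.+1%:R^-1 < e.
  move=> e0; have /cvgrPdist_lt/(_ _ e0)[N _ hN] := @cvg_harmonic R.
  exists N => n Nn; have := hN n Nn.
  by rewrite /= sub0r normrN /harmonic /= ger0_norm // invr_ge0.
have [|a ha] := @complete_dist R A (fun n => (y n).1).
  move=> e e0.
  have d0 : 0 < e / 2 by rewrite divr_gt0.
  have [N hN] := small _ d0; exists N => m n Nm Nn.
  have g : genalg (pair1 e1 a1) (pair2 e2 a2) (y m - y n).
    by apply: GenB; [case: (hy m)|case: (hy n)].
  have := first_norm_le wA g.
  move/le_lt_trans; apply.
  have h : cnorm ((y m).2 - (y n).2) <= cnorm ((y m).2 - b) + cnorm (b - (y n).2).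
    exact: ler_cnorm_dist.
  apply: le_lt_trans h _; rewrite cnormBC [e](splitr e); apply: ltrD.
    by have [_ h] := hy m; exact: le_lt_trans h (hN m Nm).
  by have [_ h] := hy n; exact: le_lt_trans h (hN n Nn).
exists a => e e0; have [N hN] := ha e e0; have [M hM] := small e e0.
pose n := maxn N M; have [gy h2] := hy n; exists (y n) => //.
have h3 : cnorm ((y n).2 - b) < e.
  rewrite cnormBC; apply: le_lt_trans h2 (hM _ _); exact: leq_maxr.
have h4 : cnorm ((y n).1 - a) < e by apply: hN; exact: leq_maxl.
have : prod_norm (y n - (a, b)) < e by rewrite prod_norm_lt; apply/andP; split; [exact: h4|exact: h3].
exact.
Qed.

Definition umap (b : B) : A := projT1 (cid (closure_total b)).

Lemma umapP b : cl (umap b, b). Proof. exact: projT2 (cid (closure_total b)). Qed.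

Lemma umapE b a : cl (a, b) -> umap b = a.
Proof. exact: closure_inj (umapP b). Qed.

Fact umap_linear : linear umap.
Proof.
move=> c b b'; apply: umapE.
exact: clgenD (clgenZ c (umapP b)) (umapP b').
Qed.
HB.instance Definition _ := GRing.isLinear.Build C B A _ umap umap_linear.

Fact umap_multiplicative : monoid_morphism umap.
Proof.
split; first by apply: umapE; apply: clgen_gen; exact: Gen_1.
by move=> b b'; apply: umapE; exact: clgenM (umapP b) (umapP b').
Qed.
HB.instance Definition _ := GRing.isMonoidMorphism.Build B A umap umap_multiplicative.

Lemma universal_hom : exists h : {lrmorphism B -> A},
  [/\ {morph h : x / star x}, h g1 = a1 & h g2 = a2].
Proof.
exists umap; split; last 2 first.
- by apply: umapE; apply: clgen_gen; exact: Gen1.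
- by apply: umapE; apply: clgen_gen; exact: Gen2.
by move=> b; apply: umapE; exact: clgen_star (umapP b).
Qed.

End Map.

(** Both maps are contractive and agree on a dense subset. *)
Lemma hom_unique (A : cstarType R) (h h' : {lrmorphism B -> A}) :
  {morph h : x / star x} -> {morph h' : x / star x} -> h g1 = h' g1 -> h g2 = h' g2 -> h =1 h'.
Proof.
move=> sh sh' q1 q2 b; apply/eqP; rewrite -subr_eq0; apply/eqP/cnorm_eq0/eqP.
rewrite eq_le cnorm_ge0 andbT; apply/ler_addgt0Pr => e e0; rewrite add0r.
have d0 : 0 < e / 2 by rewrite divr_gt0.
have [y gy hy] := generators_dense hU b d0.
have -> : h b - h' b = h (b - y) - h' (b - y).
  by rewrite !rmorphB /= (Gen_hom_eq sh sh' q1 q2 gy) opprB addrA subrK.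
apply: le_trans (ler_cnormB _ _) _; rewrite [e](splitr e); apply: lerD.
  exact: le_trans (hom_contractive sh _) hy.
exact: le_trans (hom_contractive sh' _) hy.
Qed.

Lemma sections_envelope : is_wcar_envelope (E := B) g1 g2.
Proof.
split; first exact: gsec_wcar.
move=> A b1 b2 wA induced; split; first by have [h hh] := universal_hom wA; exists h.
move=> h h' [s q1 q2] [s' q1' q2']; apply: hom_unique => //; first by rewrite q1.
by rewrite q2.
Qed.

(** The maps between the two universal objects are mutually inverse by uniqueness; both are
    contractive, so each is isometric. *)
Lemma envelope_iso (E : cstarType R) (a1 a2 : E) : is_wcar_envelope a1 a2 ->
  exists h : E -> dom R -> 'M[C]_4, is_cstar_iso (boundary_algebra U) h.
Proof.
move=> [wE uE]; have [wB uB] := sections_envelope.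
have [[f [fs f1 f2]] _] := uE B _ _ wB; have [[k [ks k1 k2]] _] := uB E _ _ wE.
have fk : cancel k f.
  have [_ u] := uB B _ _ wB.
  apply: (u (f \o k : {lrmorphism B -> B}) (idfun : {lrmorphism B -> B})).
    by split=> [x||] /=; rewrite ?ks ?fs ?k1 ?k2.
  by split.
have kf : cancel f k.
  have [_ u] := uE E _ _ wE.
  apply: (u (k \o f : {lrmorphism E -> E}) (idfun : {lrmorphism E -> E})).
    by split=> [x||] /=; rewrite ?fs ?ks ?f1 ?f2.
  by split.
exists (fun x => sval (f x)); split.
- by move=> c x y p; rewrite linearP.
- split=> [p|x y p]; first by rewrite rmorph1.
  by rewrite rmorphM.
- by move=> x p; rewrite fs.
- split.
    move=> x y e; apply: (can_inj kf); apply: balgP => p; by rewrite e.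
  apply/seteqP; split=> [_ [x _ <-]|u [cu bu]].
    by have [cx ex] := svalP (f x); split => //; apply/(boundaryP hU).
  exists (k (exist _ u (conj cu (proj1 (boundaryP hU u) bu)))) => //.
  by rewrite fk.
move=> x; apply/eqP; rewrite eq_le; apply/andP; split; first exact: (hom_contractive fs).
by rewrite -{1}(kf x); exact: (hom_contractive ks).
Qed.

End Universal.

Theorem theorem4p4 (R : realType)
    (U : Iunit R -> Ihalf R -> R -> R -> R -> 'M[Cplx R]_4)
    (hU : is_intertwiner U) :
  (exists (E : cstarType R) (a1 a2 : E), is_wcar_envelope a1 a2) /\
  (forall (E : cstarType R) (a1 a2 : E), is_wcar_envelope a1 a2 ->
     exists h : E -> dom R -> 'M[Cplx R]_4,
       is_cstar_iso (boundary_algebra U) h).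
Proof.
split; last exact: envelope_iso hU.
by eexists; eexists; eexists; exact: sections_envelope hU.
Qed.
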